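(* Let $k$ be a field, let $G$ be a pro-oligomorphic group equipped with a $k$-valued measure $\mu$, put $\mathfrak{P}=\underline{\mathrm{Perm}}(G,\mu)$, and let $\mathfrak{T}$ be a Karoubian tensor category. For a tensor functor $\Phi\colon \mathfrak{P}\to\mathfrak{T}$ let $\Psi^{\circ}_{\Phi}\colon \mathbf{S}(G)^{\mathrm{op}}\to \mathrm{Et}(\mathfrak{T})$ be the functor $X\mapsto \Phi(\mathcal{C}(X))$, $f\mapsto \Phi(f^* )$. Then the functor $$\mathrm{Fun}^{\otimes}(\mathfrak{P},\mathfrak{T})\to \mathrm{Fun}(\mathbf{S}(G)^{\mathrm{op}},\mathrm{Et}(\mathfrak{T}))_{\mathrm{isom}},\qquad \Phi\mapsto \Psi^{\circ}_{\Phi}$$ is fully faithful, and its essential image consists of exactly those functors $\Psi^{\circ}$ whose opposite $\Psi\colon \mathbf{S}(G)\to \mathrm{Et}(\mathfrak{T})^{\mathrm{op}}$ is left-exact, additive, and compatible with $\mu$. In particular, giving a tensor functor $\mathfrak{P}\to\mathfrak{T}$ is equivalent to giving a functor $\mathbf{S}(G)\to\mathrm{Et}(\mathfrak{T})^{\mathrm{op}}$ that is additive, left-exact and compatible with $\mu$.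
   Context: **Tensor categories.** Fix a field $k$. A tensor category is an additive $k$-linear category with a $k$-bilinear symmetric monoidal structure; its unit is denoted $\mathbf{1}$, and $\Gamma(X)=\mathrm{Hom}(\mathbf{1},X)$. A tensor functor is a $k$-linear symmetric monoidal functor. $\mathrm{Fun}^{\otimes}$ is the category of tensor functors and monoidal natural transformations. Karoubian means all idempotents split. For a category $\mathfrak{X}$, $\mathfrak{X}_{\mathrm{isom}}$ has the same objects and only the isomorphisms as morphisms. **Étale algebras.** An algebra in $\mathfrak{T}$ is a commutative associative unital algebra object, with multiplication $m_A$ and unit $\eta_A$. If $A$ is rigid (has a dual), its trace map $\epsilon_A\colon A\to\mathbf{1}$ is the composite of $A\to A\otimes A^\vee$ (adjoint to multiplication) with evaluation. $A$ is étale if it is rigid and the pairing $\epsilon_A\circ m_A\colon A\otimes A\to\mathbf{1}$ is perfect. $\mathrm{Et}(\mathfrak{T})$ is the category of étale algebras and algebra homomorphisms. For a map $f\colon A\to B$ of étale algebras, $f^\vee\colon B\to A$ is the dual map under the self-dualities given by the trace pairings (so $\epsilon_A(a f^\vee(b))=\epsilon_B(f(a)b)$); put $\tilde\gamma(f)=f^\vee\circ\eta_B\in\Gamma(A)$. $f$ is uniform if $A\neq0$ and $\tilde\gamma(f)\in k\cdot\eta_A$; then $\gamma(f)\in k$ denotes the corresponding scalar. **Groups and measures.** A pro-oligomorphic group is a Hausdorff topological group $G$ whose open subgroups form a neighborhood basis of the identity and such that $U\backslash G/V$ is finite for all open subgroups $U,V$. $\mathbf{S}(G)$ is the category of $G$-sets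 that are smooth (open point stabilizers) and finitary (finitely many orbits). A $k$-valued measure $\mu$ assigns to each map $f\colon Y\to X$ of transitive $G$-sets in $\mathbf{S}(G)$ an element $\mu(f)\in k$ such that: (a) $\mu(f)=1$ if $f$ is an isomorphism; (b) $\mu(g\circ f)=\mu(g)\mu(f)$; (c) if $X'\to X$ is a map of transitive $G$-sets and $Y'=Y\times_XX'=\bigsqcup_iY'_i$ is the orbit decomposition, then $\mu(f)=\sum_i\mu(Y_i'\to X')$. For $f\colon Y\to X$ with $X$ transitive and $Y$ arbitrary in $\mathbf{S}(G)$, $\mu(f)$ is the sum of the values of $\mu$ on the restrictions of $f$ to the orbits of $Y$. **The category $\underline{\mathrm{Perm}}(G,\mu)$.** Its objects are symbols $\mathcal{C}(X)$ with $X\in\mathbf{S}(G)$. Morphisms $\mathcal{C}(X)\to\mathcal{C}(Y)$ are $G$-invariant functions $Y\times X\to k$ (matrices). The composite of $A\colon\mathcal{C}(X)\to\mathcal{C}(Y)$ and $B\colon\mathcal{C}(Y)\to\mathcal{C}(Z)$ has, on a $G$-orbit $W\subset Z\times X$, the value $\sum_T B(T)A(T)\,\mu(T\to W)$, the sum over $G$-orbits $T\subset Z\times Y\times X$ mapping to $W$, where $B(T),A(T)$ are the values of $B(z,y),A(y,x)$ for $(z,y,x)\in T$. One has $\mathcal{C}(X)\oplus\mathcal{C}(Y)=\mathcal{C}(X\amalg Y)$, $\mathcal{C}(X)\otimes\mathcal{C}(Y)=\mathcal{C}(X\times Y)$, with block matrices and Kronecker products on morphisms. For $f\colon Y\to X$,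 $f^*\colon\mathcal{C}(X)\to\mathcal{C}(Y)$ is the indicator function of $\{(y,f(y))\}\subset Y\times X$. With unit $p^*$ ($p\colon X\to\mathrm{pt}$) and multiplication $\Delta^*$ ($\Delta\colon X\to X\times X$ the diagonal), $\mathcal{C}(X)$ is an étale algebra, and $f^*$ is an algebra homomorphism. **Conditions on functors.** A functor is additive if it preserves finite coproducts, left-exact if it preserves finite limits. A functor $\Psi\colon\mathbf{S}(G)\to\mathrm{Et}(\mathfrak{T})^{\mathrm{op}}$ is compatible with $\mu$ if for every $f\colon Y\to X$ in $\mathbf{S}(G)$ with $X$ transitive, either $\Psi(X)=0$, or the algebra map $\Psi(f)\colon\Psi(X)\to\Psi(Y)$ is uniform with $\gamma(\Psi(f))=\mu(f)$. *)

(* Defs.v *)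
From HB Require Import structures.
From mathcomp Require Import all_boot all_algebra.
From mathcomp Require Import all_classical topology.

Set Implicit Arguments.
Unset Strict Implicit.
Unset Printing Implicit Defensive.

Import GRing.Theory.
Local Open Scope classical_set_scope.
Local Open Scope ring_scope.

Declare Scope cat_scope.
Delimit Scope cat_scope with cat.
Local Open Scope cat_scope.

Reserved Notation "g ∘ f" (at level 40, left associativity).
Reserved Notation "X ⊗ Y" (at level 35, right associativity).
Reserved Notation "f ⊠ g" (at level 35, right associativity).

Record category := Category {
  obj :> Type;
  hom : obj -> obj -> Type;
  idm : forall X, hom X X;
  comp : forall X Y Z, hom Y Z -> hom X Y -> hom X Z;
  comp1m : forall X Y (f : hom X Y), comp (idm Y) f = f;
  compm1 : forall X Y (f : hom X Y), comp f (idm X) = f;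
  compA : forall X Y Z W (h : hom Z W) (g : hom Y Z) (f : hom X Y),
    comp h (comp g f) = comp (comp h g) f }.

Arguments idm {c} X.
Arguments hom : simpl never.
Arguments idm : simpl never.
Arguments comp : simpl never.
Notation "g ∘ f" := (comp g f) : cat_scope.

Definition is_iso (C : category) (X Y : C) (f : hom X Y) : Prop :=
  exists g : hom Y X, g ∘ f = idm X /\ f ∘ g = idm Y.

Record functor (C D : category) := Functor {
  fobj :> C -> D;
  fmap : forall X Y, hom X Y -> hom (fobj X) (fobj Y);
  fmap1 : forall X, fmap (idm X) = idm (fobj X);
  fmapM : forall X Y Z (g : hom Y Z) (f : hom X Y), fmap (g ∘ f) = fmap g ∘ fmap f }.

Arguments fmap {C D} F {X Y} f : rename.

Record nat_trans (C D : category) (F F' : functor C D) := NatTrans {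
  ntc :> forall X, hom (F X) (F' X);
  ntP : forall X Y (f : hom X Y), ntc Y ∘ fmap F f = fmap F' f ∘ ntc X }.

Lemma nat_trans_ext (C D : category) (F F' : functor C D) (a b : nat_trans F F') :
  (forall X, a X = b X) -> a = b.
Proof.
case: a b => [a aP] [b bP] /= ab; have {}ab : a = b by exact: functional_extensionality_dep.
by subst b; congr NatTrans; exact: Prop_irrelevance.
Qed.

Section FunctorCategory.
Variables C D : category.

Definition nt_id (F : functor C D) : nat_trans F F.
Proof. by exists (fun X => idm (F X)) => X Y f; rewrite comp1m compm1. Defined.

Definition nt_comp (F F' F'' : functor C D) (b : nat_trans F' F'') (a : nat_trans F F') :
  nat_trans F F''.
Proof.
exists (fun X => b X ∘ a X) => X Y f.
by rewrite -compA ntP compA ntP compA.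
Defined.

Definition functor_cat : category.
Proof.
refine (@Category (functor C D) (@nat_trans C D) nt_id nt_comp _ _ _).
- by move=> F F' a; apply: nat_trans_ext => X; exact: comp1m.
- by move=> F F' a; apply: nat_trans_ext => X; exact: compm1.
- by move=> F F' F'' F3 c b a; apply: nat_trans_ext => X; exact: compA.
Defined.

End FunctorCategory.

Definition op (C : category) : category.
Proof.
refine (@Category C (fun X Y => hom Y X) (@idm C) (fun X Y Z g f => f ∘ g) _ _ _).
- by move=> *; exact: compm1.
- by move=> *; exact: comp1m.
- by move=> *; rewrite compA.
Defined.

Definition op_functor (C D : category) (F : functor (op C) D) : functor C (op D) :=
  @Functor C (op D) F (fun X Y f => @fmap (op C) D F Y X f)
    (fun X => @fmap1 (op C) D F X)
    (fun X Y Z g f => @fmapM (op C) D F Z Y X f g).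

Section Isom.
Variable C : category.

Record iso_hom (X Y : C) := IsoHom { ihom :> hom X Y; ihomP : is_iso ihom }.

Lemma iso_hom_ext (X Y : C) (f g : iso_hom X Y) : ihom f = ihom g -> f = g.
Proof.
case: f g => [f fP] [g gP] /= fg; subst g; congr IsoHom; exact: Prop_irrelevance.
Qed.

Lemma is_iso_id (X : C) : is_iso (idm X).
Proof. by exists (idm X); rewrite comp1m. Qed.

Lemma is_iso_comp (X Y Z : C) (g : hom Y Z) (f : hom X Y) :
  is_iso g -> is_iso f -> is_iso (g ∘ f).
Proof.
move=> [g' [g'g gg']] [f' [f'f ff']]; exists (f' ∘ g'); split.
- by rewrite -compA (compA g') g'g comp1m.
- by rewrite -compA (compA f) ff' comp1m.
Qed.

Definition isom_cat : category.
Proof.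
refine (@Category C iso_hom (fun X => IsoHom (is_iso_id X))
  (fun X Y Z g f => IsoHom (is_iso_comp (ihomP g) (ihomP f))) _ _ _).
- by move=> *; apply: iso_hom_ext; exact: comp1m.
- by move=> *; apply: iso_hom_ext; exact: compm1.
- by move=> *; apply: iso_hom_ext; exact: compA.
Defined.

End Isom.

Definition full_subcat (C : category) (P : C -> Prop) : category :=
  @Category {X : C | P X} (fun X Y => hom (sval X) (sval Y)) (fun X => idm (sval X))
    (fun X Y Z g f => g ∘ f) (fun X Y f => comp1m f) (fun X Y f => compm1 f)
    (fun X Y Z W h g f => compA h g f).

Definition corestrict (C D : category) (F : functor C D) (P : D -> Prop)
    (FP : forall X, P (F X)) : functor C (full_subcat P) :=
  @Functor C (full_subcat P) (fun X => exist P (F X) (FP X)) (fun X Y f => fmap F f)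
    (fun X => fmap1 F X) (fun X Y Z g f => fmapM F g f).

Definition id_functor (C : category) : functor C C :=
  @Functor C C id (fun _ _ f => f) (fun _ => erefl) (fun _ _ _ _ _ => erefl).

Definition comp_functor (C D E : category) (F' : functor D E) (F : functor C D) :
  functor C E.
Proof.
exists (fun X => F' (F X)) (fun X Y f => fmap F' (fmap F f)).
- by move=> X; rewrite !fmap1.
- by move=> X Y Z g f; rewrite !fmapM.
Defined.

Definition isomorphic (C : category) (X Y : C) : Prop := exists f : hom X Y, is_iso f.

Definition fully_faithful (C D : category) (F : functor C D) : Prop :=
  forall X Y : C, bijective (@fmap C D F X Y).

Definition essential_image (C D : category) (F : functor C D) (Y : D) : Prop :=
  exists X : C, isomorphic (F X) Y.

Definition is_equivalence (C D : category) (F : functor C D) : Prop :=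
  exists F' : functor D C,
    @isomorphic (functor_cat C C) (comp_functor F' F) (id_functor C) /\
    @isomorphic (functor_cat D D) (comp_functor F F') (id_functor D).

Section Limits.
Variables (J C : category) (D : functor J C).

Record cone (L : C) := Cone {
  cproj :> forall j, hom L (D j);
  cproj_nat : forall i j (u : hom i j), fmap D u ∘ cproj i = cproj j }.

Definition is_limit (L : C) (p : cone L) : Prop :=
  forall (M : C) (q : cone M), exists! u : hom M L, forall j, p j ∘ u = q j.

End Limits.

Definition map_cone (J C C' : category) (F : functor C C') (D : functor J C) (L : C)
  (p : cone D L) : cone (comp_functor F D) (F L).
Proof.
exists (fun j => fmap F (p j)) => i j u /=.
by rewrite -fmapM cproj_nat.
Defined.

Definition finite_category (J : category) : Prop :=
  finite_set [set: J] /\ forall i j : J, finite_set [set: hom i j].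

Definition left_exact (C C' : category) (F : functor C C') : Prop :=
  forall J : category, finite_category J ->
  forall (D : functor J C) (L : C) (p : cone D L),
    is_limit p -> is_limit (map_cone F p).

Definition is_coproduct (C : category) (I : Type) (X : I -> C) (S : C)
    (inj : forall i, hom (X i) S) : Prop :=
  forall (M : C) (q : forall i, hom (X i) M),
    exists! u : hom S M, forall i, u ∘ inj i = q i.

Definition additive_functor (C C' : category) (F : functor C C') : Prop :=
  forall (I : finType) (X : I -> C) (S : C) (inj : forall i, hom (X i) S),
    is_coproduct inj -> is_coproduct (fun i => fmap F (inj i)).

Definition karoubian (C : category) : Prop :=
  forall (X : C) (e : hom X X), e ∘ e = e ->
  exists (Y : C) (r : hom X Y) (s : hom Y X), r ∘ s = idm Y /\ s ∘ r = e.

Record linCat (k : fieldType) := LinCat {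
  lobj : Type;
  lhom : lobj -> lobj -> lmodType k;
  lidm : forall X, lhom X X;
  lcomp : forall X Y Z, lhom Y Z -> lhom X Y -> lhom X Z;
  lcomp1m : forall X Y (f : lhom X Y), lcomp (lidm Y) f = f;
  lcompm1 : forall X Y (f : lhom X Y), lcomp f (lidm X) = f;
  lcompA : forall X Y Z W (h : lhom Z W) (g : lhom Y Z) (f : lhom X Y),
    lcomp h (lcomp g f) = lcomp (lcomp h g) f;
  lcomp_linl : forall X Y Z (f : lhom X Y), linear (fun g : lhom Y Z => lcomp g f);
  lcomp_linr : forall X Y Z (g : lhom Y Z), linear (fun f : lhom X Y => lcomp g f) }.

Definition cat_of_linCat (k : fieldType) (C : linCat k) : category :=
  @Category (lobj C) (fun X Y => lhom X Y) (@lidm k C) (@lcomp k C)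
    (@lcomp1m k C) (@lcompm1 k C) (@lcompA k C).
Coercion cat_of_linCat : linCat >-> category.

HB.instance Definition _ (k : fieldType) (C : linCat k) (X Y : C) :=
  GRing.Lmodule.copy (hom X Y) (lhom X Y).

Definition is_zero_object (k : fieldType) (C : linCat k) (Z : C) : Prop :=
  forall X : C, (forall f : hom X Z, f = 0) /\ (forall f : hom Z X, f = 0).

Definition has_zero_object (k : fieldType) (C : linCat k) : Prop :=
  exists Z : C, is_zero_object Z.

Definition has_biproducts (k : fieldType) (C : linCat k) : Prop :=
  forall X Y : C, exists (S : C) (i1 : hom X S) (i2 : hom Y S) (p1 : hom S X) (p2 : hom S Y),
    [/\ p1 ∘ i1 = idm X, p2 ∘ i2 = idm Y, p1 ∘ i2 = 0, p2 ∘ i1 = 0 &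
        i1 ∘ p1 + i2 ∘ p2 = idm S].

Record tensorCat (k : fieldType) := TensorCat {
  tlin :> linCat k;
  tens_zero : has_zero_object tlin;
  tens_biprod : has_biproducts tlin;
  tens : tlin -> tlin -> tlin;
  tensm : forall X X' Y Y' : tlin, hom X X' -> hom Y Y' -> hom (tens X Y) (tens X' Y');
  tunit : tlin;
  assoc : forall X Y Z, hom (tens (tens X Y) Z) (tens X (tens Y Z));
  assocV : forall X Y Z, hom (tens X (tens Y Z)) (tens (tens X Y) Z);
  lunit : forall X, hom (tens tunit X) X;
  lunitV : forall X, hom X (tens tunit X);
  runit : forall X, hom (tens X tunit) X;
  runitV : forall X, hom X (tens X tunit);
  braid : forall X Y, hom (tens X Y) (tens Y X);
  tensm1 : forall X Y, tensm (idm X) (idm Y) = idm (tens X Y);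
  tensmM : forall X X' X'' Y Y' Y'' (f' : hom X' X'') (f : hom X X')
      (g' : hom Y' Y'') (g : hom Y Y'),
    tensm (f' ∘ f) (g' ∘ g) = tensm f' g' ∘ tensm f g;
  tensm_linl : forall X X' Y Y' (g : hom Y Y'), linear (fun f : hom X X' => tensm f g);
  tensm_linr : forall X X' Y Y' (f : hom X X'), linear (fun g : hom Y Y' => tensm f g);
  assocK : forall X Y Z, assocV X Y Z ∘ assoc X Y Z = idm _;
  assocVK : forall X Y Z, assoc X Y Z ∘ assocV X Y Z = idm _;
  lunitK : forall X, lunitV X ∘ lunit X = idm _;
  lunitVK : forall X, lunit X ∘ lunitV X = idm _;
  runitK : forall X, runitV X ∘ runit X = idm _;
  runitVK : forall X, runit X ∘ runitV X = idm _;
  braidK : forall X Y, braid Y X ∘ braid X Y = idm _;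
  assoc_nat : forall X X' Y Y' Z Z' (f : hom X X') (g : hom Y Y') (h : hom Z Z'),
    assoc X' Y' Z' ∘ tensm (tensm f g) h = tensm f (tensm g h) ∘ assoc X Y Z;
  lunit_nat : forall X X' (f : hom X X'),
    lunit X' ∘ tensm (idm tunit) f = f ∘ lunit X;
  runit_nat : forall X X' (f : hom X X'),
    runit X' ∘ tensm f (idm tunit) = f ∘ runit X;
  braid_nat : forall X X' Y Y' (f : hom X X') (g : hom Y Y'),
    braid X' Y' ∘ tensm f g = tensm g f ∘ braid X Y;
  pentagon : forall X Y Z W,
    assoc X Y (tens Z W) ∘ assoc (tens X Y) Z W =
    tensm (idm X) (assoc Y Z W) ∘ assoc X (tens Y Z) W ∘ tensm (assoc X Y Z) (idm W);
  triangle : forall X Y,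
    tensm (idm X) (lunit Y) ∘ assoc X tunit Y = tensm (runit X) (idm Y);
  hexagon : forall X Y Z,
    assoc Y Z X ∘ braid X (tens Y Z) ∘ assoc X Y Z =
    tensm (idm Y) (braid X Z) ∘ assoc Y X Z ∘ tensm (braid X Y) (idm Z) }.

Arguments tunit {k t}.
Arguments assoc {k t} X Y Z.
Arguments assocV {k t} X Y Z.
Arguments lunit {k t} X.
Arguments lunitV {k t} X.
Arguments runit {k t} X.
Arguments runitV {k t} X.
Arguments braid {k t} X Y.
Notation "X ⊗ Y" := (tens X Y) : cat_scope.
Notation "f ⊠ g" := (tensm f g) : cat_scope.
Notation "𝟙" := tunit : cat_scope.

(** The points [Γ(X)] of an object. *)
Definition points (k : fieldType) (T : tensorCat k) (X : T) := hom 𝟙 X.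

Record tensor_functor (k : fieldType) (P T : tensorCat k) := TensorFunctor {
  tfun :> functor P T;
  tfun_linear : forall X Y : P, linear (fun f : hom X Y => fmap tfun f);
  tfun2 : forall X Y : P, hom (tfun X ⊗ tfun Y) (tfun (X ⊗ Y));
  tfun2V : forall X Y : P, hom (tfun (X ⊗ Y)) (tfun X ⊗ tfun Y);
  tfun0 : hom 𝟙 (tfun 𝟙);
  tfun0V : hom (tfun 𝟙) 𝟙;
  tfun2K : forall X Y, tfun2V X Y ∘ tfun2 X Y = idm _;
  tfun2VK : forall X Y, tfun2 X Y ∘ tfun2V X Y = idm _;
  tfun0K : tfun0V ∘ tfun0 = idm _;
  tfun0VK : tfun0 ∘ tfun0V = idm _;
  tfun2_nat : forall X X' Y Y' (f : hom X X') (g : hom Y Y'),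
    tfun2 X' Y' ∘ (fmap tfun f ⊠ fmap tfun g) = fmap tfun (f ⊠ g) ∘ tfun2 X Y;
  tfun_assoc : forall X Y Z,
    fmap tfun (assoc X Y Z) ∘ tfun2 (X ⊗ Y) Z ∘ (tfun2 X Y ⊠ idm (tfun Z)) =
    tfun2 X (Y ⊗ Z) ∘ (idm (tfun X) ⊠ tfun2 Y Z) ∘ assoc (tfun X) (tfun Y) (tfun Z);
  tfun_lunit : forall X,
    fmap tfun (lunit X) ∘ tfun2 𝟙 X ∘ (tfun0 ⊠ idm (tfun X)) = lunit (tfun X);
  tfun_runit : forall X,
    fmap tfun (runit X) ∘ tfun2 X 𝟙 ∘ (idm (tfun X) ⊠ tfun0) = runit (tfun X);
  tfun_braid : forall X Y,
    fmap tfun (braid X Y) ∘ tfun2 X Y = tfun2 Y X ∘ braid (tfun X) (tfun Y) }.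

Arguments tfun2 {k P T} t X Y.
Arguments tfun2V {k P T} t X Y.
Arguments tfun0 {k P T} t.
Arguments tfun0V {k P T} t.

Record monoidal_trans (k : fieldType) (P T : tensorCat k) (F F' : tensor_functor P T) :=
  MonoidalTrans {
    mtrans :> nat_trans F F';
    mtrans2 : forall X Y, mtrans (X ⊗ Y) ∘ tfun2 F X Y = tfun2 F' X Y ∘ (mtrans X ⊠ mtrans Y);
    mtrans0 : mtrans 𝟙 ∘ tfun0 F = tfun0 F' }.

Lemma monoidal_trans_ext (k : fieldType) (P T : tensorCat k) (F F' : tensor_functor P T)
  (a b : monoidal_trans F F') : (forall X, a X = b X) -> a = b.
Proof.
case: a b => [a a2 a0] [b b2 b0] /= ab.
have {}ab : a = b by exact: nat_trans_ext.
by subst b; congr MonoidalTrans; exact: Prop_irrelevance.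
Qed.

Section TensorFunctorCategory.
Variables (k : fieldType) (P T : tensorCat k).

Definition mt_id (F : tensor_functor P T) : monoidal_trans F F.
Proof.
exists (nt_id F) => [X Y|] /=.
- by rewrite comp1m tensm1 compm1.
- by rewrite comp1m.
Defined.

Definition mt_comp (F F' F'' : tensor_functor P T) (b : monoidal_trans F' F'')
  (a : monoidal_trans F F') : monoidal_trans F F''.
Proof.
exists (nt_comp b a) => [X Y|] /=.
- by rewrite -compA mtrans2 compA mtrans2 -compA tensmM.
- by rewrite -compA !mtrans0.
Defined.

Definition tensor_functor_cat : category.
Proof.
refine (@Category (tensor_functor P T) (@monoidal_trans k P T) mt_id mt_comp _ _ _).
- by move=> F F' a; apply: monoidal_trans_ext => X; exact: comp1m.
- by move=> F F' a; apply: monoidal_trans_ext => X; exact: compm1.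
- by move=> F F' F'' F3 c b a; apply: monoidal_trans_ext => X; exact: compA.
Defined.

End TensorFunctorCategory.

Section EtaleAlgebras.
Variables (k : fieldType) (T : tensorCat k).

Record algebra := Algebra {
  aobj :> T;
  amul : hom (aobj ⊗ aobj) aobj;
  aone : hom 𝟙 aobj;
  amulA : amul ∘ (idm aobj ⊠ amul) ∘ assoc aobj aobj aobj = amul ∘ (amul ⊠ idm aobj);
  amulC : amul ∘ braid aobj aobj = amul;
  amul1 : amul ∘ (aone ⊠ idm aobj) = lunit aobj }.

Record alg_hom (A B : algebra) := AlgHom {
  ahom :> hom A B;
  ahomM : ahom ∘ amul A = amul B ∘ (ahom ⊠ ahom);
  ahom1 : ahom ∘ aone A = aone B }.

Lemma alg_hom_ext (A B : algebra) (f g : alg_hom A B) : ahom f = ahom g -> f = g.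
Proof.
by case: f g => [f fM f1] [g gM g1] /= fg; subst g; congr AlgHom; exact: Prop_irrelevance.
Qed.

Definition alg_id (A : algebra) : alg_hom A A.
Proof. by exists (idm A); rewrite ?comp1m // tensm1 compm1. Defined.

Definition alg_comp (A B C : algebra) (g : alg_hom B C) (f : alg_hom A B) : alg_hom A C.
Proof.
exists (ahom g ∘ ahom f).
- by rewrite -compA ahomM compA ahomM -compA tensmM.
- by rewrite -compA !ahom1.
Defined.

Definition alg_cat : category.
Proof.
refine (@Category algebra alg_hom alg_id alg_comp _ _ _).
- by move=> *; apply: alg_hom_ext; exact: comp1m.
- by move=> *; apply: alg_hom_ext; exact: compm1.
- by move=> *; apply: alg_hom_ext; exact: compA.
Defined.

(** [ev] and [coev] exhibit [D] as a dual of [X]. *)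
Definition is_duality (X D : T) (ev : hom (D ⊗ X) 𝟙) (coev : hom 𝟙 (X ⊗ D)) : Prop :=
  runit X ∘ (idm X ⊠ ev) ∘ assoc X D X ∘ (coev ⊠ idm X) ∘ lunitV X = idm X /\
  lunit D ∘ (ev ⊠ idm D) ∘ assocV D X D ∘ (idm D ⊠ coev) ∘ runitV D = idm D.

Record dual (X : T) := Dual {
  dobj : T;
  dev : hom (dobj ⊗ X) 𝟙;
  dcoev : hom 𝟙 (X ⊗ dobj);
  dualP : is_duality dev dcoev }.

Definition perfect (X Y : T) (b : hom (X ⊗ Y) 𝟙) : Prop :=
  exists c : hom 𝟙 (Y ⊗ X), is_duality b c.

(** The composite [A ⟶ A ⊗ A^∨ ⟶ 𝟙], where the first map is adjoint to the
    multiplication of [A]. *)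
Definition trace_map (A : algebra) (D : dual A) : hom A 𝟙 :=
  dev D ∘ braid A (dobj D) ∘
  ((amul A ⊠ idm (dobj D)) ∘ assocV A A (dobj D) ∘ (idm (A : T) ⊠ dcoev D) ∘ runitV A).

(** Duals are unique up to unique isomorphism, so the trace map does not depend
    on the chosen dual; likewise for the copairing of a perfect pairing. *)
Definition etale (A : algebra) : Prop :=
  exists D : dual A, perfect (trace_map D ∘ amul A).

Definition et_cat : category := @full_subcat alg_cat etale.

Definition et_alg (A : et_cat) : algebra := sval A.
Coercion et_alg : obj >-> algebra.

Definition et_dual (A : et_cat) : dual A := projT1 (cid (svalP A)).

Definition et_trace (A : et_cat) : hom (A : T) 𝟙 := trace_map (et_dual A).

Definition trace_pairing (A : et_cat) : hom (A ⊗ A) 𝟙 := et_trace A ∘ amul A.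

Definition trace_copairing (A : et_cat) : hom 𝟙 (A ⊗ A) :=
  projT1 (cid (projT2 (cid (svalP A)))).

Lemma trace_pairingP (A : et_cat) : is_duality (trace_pairing A) (trace_copairing A).
Proof. exact: (projT2 (cid (projT2 (cid (svalP A))))). Qed.

(** The map dual to [f] under the self-dualities of [A] and [B] given by the
    trace pairings. *)
Definition et_transpose (A B : et_cat) (f : hom A B) : hom (B : T) A :=
  runit A ∘ (idm (A : T) ⊠ trace_pairing B) ∘ (idm (A : T) ⊠ (ahom f ⊠ idm (B : T))) ∘
  assoc A A B ∘ (trace_copairing A ⊠ idm (B : T)) ∘ lunitV B.

Definition gamma_tilde (A B : et_cat) (f : hom A B) : points A := et_transpose f ∘ aone B.

Definition uniform (A B : et_cat) (f : hom A B) : Prop :=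
  ~ is_zero_object (A : T) /\ exists c : k, gamma_tilde f = c *: aone A.

Definition gamma (A B : et_cat) (f : hom A B) (fU : uniform f) : k :=
  projT1 (cid (proj2 fU)).

End EtaleAlgebras.

HB.mixin Record isTopologicalGroup G of Group G & Topological G := {
  mulg_continuous : continuous (fun p : G * G => (p.1 * p.2)%g);
  invg_continuous : continuous (fun x : G => (x^-1)%g) }.

#[short(type="topologicalGroupType")]
HB.structure Definition TopologicalGroup :=
  {G of Group G & Topological G & isTopologicalGroup G}.

Definition open_subgroup (G : topologicalGroupType) (U : set G) : Prop :=
  [/\ open U, U 1%g, forall g h, U g -> U h -> U (g * h)%g & forall g, U g -> U (g^-1)%g].

Definition double_coset (G : topologicalGroupType) (U V : set G) (g : G) : set G :=
  [set h | exists u v, [/\ U u, V v & h = (u * g * v)%g]].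

Record proOligoGroup := ProOligoGroup {
  pog :> topologicalGroupType;
  pog_hausdorff : hausdorff_space pog;
  pog_basis : forall A : set pog, nbhs (1%g : pog) A ->
    exists U : set pog, open_subgroup U /\ U `<=` A;
  pog_finite : forall U V : set pog, open_subgroup U -> open_subgroup V ->
    finite_set (range (double_coset U V)) }.

Definition orbit_of (G : topologicalGroupType) (X : Type) (act : G -> X -> X) (x : X) : set X :=
  [set y | exists g, y = act g x].

Record sgset (G : topologicalGroupType) := SGSet {
  gcar :> Type;
  gact : G -> gcar -> gcar;
  gact1 : forall x, gact 1%g x = x;
  gactM : forall g h x, gact (g * h)%g x = gact g (gact h x);
  gsmooth : forall x, open [set g | gact g x = x];
  gfinitary : finite_set (range (orbit_of gact)) }.

Section GSets.
Variable G : proOligoGroup.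
Local Notation SG := (sgset G).

Definition orb (X : SG) (x : X) : set X := orbit_of (@gact G X) x.

Record gmap (X Y : SG) := GMap {
  gfun :> X -> Y;
  gfunP : forall g x, gfun (gact g x) = gact g (gfun x) }.

Lemma gmap_ext (X Y : SG) (f g : gmap X Y) : (forall x, f x = g x) -> f = g.
Proof.
case: f g => [f fP] [g gP] /= fg; have {}fg : f = g by exact: functional_extensionality_dep.
by subst g; congr GMap; exact: Prop_irrelevance.
Qed.

Definition gid (X : SG) : gmap X X := @GMap X X id (fun _ _ => erefl).

Definition gcomp (X Y Z : SG) (g : gmap Y Z) (f : gmap X Y) : gmap X Z.
Proof. by exists (fun x => g (f x)) => a x; rewrite !gfunP. Defined.

Definition S_cat : category.
Proof. by refine (@Category SG gmap gid gcomp _ _ _) => *; exact: gmap_ext. Defined.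

Lemma gactK (X : SG) g (x : X) : gact g^-1%g (gact g x) = x.
Proof. by rewrite -gactM mulVg gact1. Qed.

Lemma gactVK (X : SG) g (x : X) : gact g (gact g^-1%g x) = x.
Proof. by rewrite -gactM mulgV gact1. Qed.

Lemma orb_refl (X : SG) (x : X) : orb x x.
Proof. by exists 1%g; rewrite gact1. Qed.

Lemma orb_act (X : SG) g (x : X) : orb (gact g x) = orb x.
Proof.
apply/seteqP; split => y [h ->]; first by exists (h * g)%g; rewrite gactM.
by exists (h * g^-1)%g; rewrite gactM gactK.
Qed.

Lemma orb_eq (X : SG) (x y : X) : orb x y -> orb y = orb x.
Proof. by move=> [g ->]; rewrite orb_act. Qed.

Lemma orbP (X : SG) (x y : X) : orb y = orb x -> exists g, y = gact g x.
Proof. by move=> e; have : orb y y := orb_refl y; rewrite e. Qed.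

Lemma orb_map (X Y : SG) (f : gmap X Y) (x y : X) : orb x = orb y -> orb (f x) = orb (f y).
Proof. by move=> /orbP[g ->]; rewrite gfunP orb_act. Qed.

Lemma orbits_mem (X : SG) : exists s : seq X,
  uniq (map (@orb X) s) /\ forall x, orb x \in map (@orb X) s.
Proof.
have /finite_seqP[L0 eL] := gfinitary X.
have eL' : forall T, T \in undup L0 -> exists x, orb x = T.
  move=> T; rewrite mem_undup => TL; have : [set` L0] T by [].
  by rewrite -eL => -[x _ <-]; exists x.
have eL2 : forall x, orb x \in undup L0.
  move=> x; rewrite mem_undup; have : range (orbit_of (@gact G X)) (orb x) by exists x.
  by rewrite eL.
suff [s es] : exists s, map (@orb X) s = undup L0.
  by exists s; rewrite es; split; [exact: undup_uniq | exact: eL2].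
elim: (undup L0) eL' => [|T L IH] h; first by exists [::].
have [x ex] := h T (mem_head _ _).
have [|s es] := IH; first by move=> T' T'L; apply: h; rewrite inE T'L orbT.
by exists (x :: s); rewrite /= ex es.
Qed.

(** A system of representatives of the [G]-orbits on [X]. *)
Definition orbreps (X : SG) : seq X := projT1 (cid (orbits_mem X)).

Lemma orbreps_uniq (X : SG) : uniq (map (@orb X) (orbreps X)).
Proof. by rewrite /orbreps; case: cid => s []. Qed.

Lemma mem_orbreps (X : SG) (x : X) : orb x \in map (@orb X) (orbreps X).
Proof. by rewrite /orbreps; case: cid => s []. Qed.

Definition transitive_gset (X : SG) : Prop := exists x : X, forall y, orb x y.

Section Sub.
Variables (X : SG) (A : set X) (AP : forall g x, A x -> A (gact g x)).

Definition sub_act (g : G) (x : {x | A x}) : {x | A x} :=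
  exist A (gact g (sval x)) (AP g (svalP x)).

Lemma sub_ext (x y : {x | A x}) : sval x = sval y -> x = y.
Proof. by case: x y => [x xA] [y yA] /= e; subst y; congr exist; exact: Prop_irrelevance. Qed.

Definition subG : SG.
Proof.
refine (@SGSet G {x | A x} sub_act _ _ _ _).
- by move=> x; apply: sub_ext; exact: gact1.
- by move=> g h x; apply: sub_ext; exact: gactM.
- move=> x; have := gsmooth (sval x); congr (open _); apply/seteqP; split=> g /=.
  + by move=> e; exact: sub_ext.
  + by move=> /(congr1 sval).
- pose F (T : set {x | A x}) : set X := [set sval z | z in T].
  have Finj : injective F.
    move=> T T' e; apply/seteqP; split => z zT.
    + have : F T' (sval z) by rewrite -e; exists z.
      by move=> [z' z'T /sub_ext <-].
    + have : F T (sval z) by rewrite e; exists z.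
      by move=> [z' z'T /sub_ext <-].
  apply: (@sub_finite_set _ _ (F @^-1` (range (@orb X)))); last first.
    by apply: finite_preimage (gfinitary X) => ? ? _ _; exact: Finj.
  move=> _ [x _ <-]; exists (sval x) => //=; apply/seteqP; split => [y [g ->]|y [z [g ->] <-]].
  + by exists (sub_act g x) => //; exists g.
  + by exists g.
Defined.

Definition sub_incl : gmap subG X := @GMap subG X sval (fun _ _ => erefl).

End Sub.

Lemma orb_inv (X : SG) (x : X) (g : G) (y : X) : orb x y -> orb x (gact g y).
Proof. by move=> [h ->]; exists (g * h)%g; rewrite gactM. Qed.

Definition orbG (X : SG) (x : X) : SG := subG (@orb_inv X x).

Definition orbG_incl (X : SG) (x : X) : gmap (orbG x) X := sub_incl (@orb_inv X x).

Lemma orbG_trans (X : SG) (x : X) : transitive_gset (orbG x).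
Proof.
exists (exist _ x (orb_refl x)) => -[y [g yg]].
by exists g; apply: sub_ext => /=.
Qed.

Lemma orb_fun (X Y : SG) (f : gmap X Y) (x y : X) : orb x y -> orb (f x) (f y).
Proof. by move=> [g ->]; exists g; rewrite gfunP. Qed.

(** The map [orbit of x ⟶ orbit of f x] induced by [f]. *)
Definition orb_restr (X Y : SG) (f : gmap X Y) (x : X) : gmap (orbG x) (orbG (f x)).
Proof.
exists (fun y => exist _ (f (sval y)) (orb_fun f (svalP y))) => g y.
by apply: sub_ext => /=; rewrite gfunP.
Defined.

Section Products.
Variables X Y : SG.

Definition prod_act (g : G) (p : X * Y) : X * Y := (gact g p.1, gact g p.2).

Lemma stab_open_subgroup (Z : SG) (z : Z) : open_subgroup [set g | gact g z = z].
Proof.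
split; first exact: gsmooth.
- by rewrite /= gact1.
- by move=> g h /= gz hz; rewrite gactM hz.
- by move=> g /= gz; rewrite -{1}gz gactK.
Qed.

Lemma prod_finitary : finite_set (range (orbit_of prod_act)).
Proof.
pose O := orbit_of prod_act.
have Oact g p : O (prod_act g p) = O p.
  apply/seteqP; split => q [h ->].
  - by exists (h * g)%g; rewrite /prod_act /= !gactM.
  - by exists (h * g^-1)%g; rewrite /prod_act /= !gactM !gactK.
pose F (S : set X) (T : set Y) := [set O (x, y) | x in S & y in T].
apply: (@sub_finite_set _ _ (\bigcup_(S in range (@orb X)) \bigcup_(T in range (@orb Y)) F S T)).
  move=> _ [[x y] _ <-]; exists (orb x); first by exists x.
  exists (orb y); first by exists y.
  by exists x; [exact: orb_refl|exists y => //; exact: orb_refl].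
apply: bigcup_finite; first exact: gfinitary.
move=> _ [x _ <-]; apply: bigcup_finite; first exact: gfinitary.
move=> _ [y _ <-].
have := pog_finite (stab_open_subgroup x) (stab_open_subgroup y).
set DC := double_coset _ _ => DCfin.
apply: (@sub_finite_set _ _ [set O (x, gact (xget 1%g D) y) | D in range DC]); last first.
  exact: finite_image.
move=> _ [_ [g ->] [_ [h ->] <-]] /=.
exists (DC (g^-1 * h)%g); first by exists (g^-1 * h)%g.
have : DC (g^-1 * h)%g (xget 1%g (DC (g^-1 * h)%g)).
  apply: (@xgetPex _ 1%g (DC (g^-1 * h)%g)).
  by exists (g^-1 * h)%g, 1%g, 1%g; rewrite /= !gact1 mul1g mulg1.
move=> [u [v [/= ux vy ->]]].
rewrite !gactM vy -{1}ux -(Oact u^-1%g) -(Oact g) /prod_act /=.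
by rewrite !gactK gactVK.
Qed.

Definition prodG : SG.
Proof.
refine (@SGSet G (X * Y)%type prod_act _ _ _ prod_finitary).
- by move=> [x y]; rewrite /prod_act !gact1.
- by move=> g h [x y]; rewrite /prod_act !gactM.
- move=> [x y].
  have -> : [set g | prod_act g (x, y) = (x, y)] =
            [set g | gact g x = x] `&` [set g | gact g y = y].
    by apply/seteqP; split => g /=; [case|move=> [e e']; rewrite /prod_act /= e e'].
  by apply: openI; exact: gsmooth.
Defined.

Definition gfst : gmap prodG X := @GMap prodG X fst (fun _ _ => erefl).
Definition gsnd : gmap prodG Y := @GMap prodG Y snd (fun _ _ => erefl).

End Products.

Definition gpair (X Y Z : SG) (f : gmap Z X) (g : gmap Z Y) : gmap Z (prodG X Y).
Proof. by exists (fun z => (f z, g z)) => a z /=; rewrite !gfunP. Defined.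

Definition gprod (X X' Y Y' : SG) (f : gmap X X') (g : gmap Y Y') :
  gmap (prodG X Y) (prodG X' Y') := gpair (gcomp f (gfst X Y)) (gcomp g (gsnd X Y)).

Definition gdiag (X : SG) : gmap X (prodG X X) := gpair (gid X) (gid X).

Definition ptG : SG.
Proof.
refine (@SGSet G unit (fun _ x => x) _ _ _ _) => //.
- move=> x; suff -> : [set g : G | x = x] = setT by exact: openT.
  by apply/seteqP; split.
- by apply: finite_image; exact: finite_finset.
Defined.

Definition gterm (X : SG) : gmap X ptG := @GMap X ptG (fun _ => tt) (fun _ _ => erefl).

Definition emptyG : SG.
Proof.
refine (@SGSet G void (fun _ x => x) _ _ _ _) => //.
by apply: (@sub_finite_set _ _ set0) => // _ [[]].
Defined.

Section Sums.
Variables X Y : SG.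

Definition sum_act (g : G) (p : X + Y) : X + Y :=
  match p with inl x => inl (gact g x) | inr y => inr (gact g y) end.

Definition sumG : SG.
Proof.
refine (@SGSet G (X + Y)%type sum_act _ _ _ _).
- by move=> [x|y]; rewrite /= gact1.
- by move=> g h [x|y]; rewrite /= gactM.
- move=> [x|y].
  + have := gsmooth x; congr open; apply/seteqP; split=> g /=; by [move=> -> | case].
  + have := gsmooth y; congr open; apply/seteqP; split=> g /=; by [move=> -> | case].
- apply: (@sub_finite_set _ _ ([set inl @` S | S in range (@orb X)] `|`
                               [set inr @` S | S in range (@orb Y)])); last first.
    by rewrite finite_setU; split; apply: finite_image; exact: gfinitary.
  move=> _ [[x|y] _ <-]; [left; exists (orb x); first by exists x
                         |right; exists (orb y); first by exists y].
  + apply/seteqP; split => [_ [_ [g ->] <-]|_ [g ->]]; first by exists g.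
    by exists (gact g x) => //; exists g.
  + apply/seteqP; split => [_ [_ [g ->] <-]|_ [g ->]]; first by exists g.
    by exists (gact g y) => //; exists g.
Defined.

Definition ginl : gmap X sumG := @GMap X sumG inl (fun _ _ => erefl).
Definition ginr : gmap Y sumG := @GMap Y sumG inr (fun _ _ => erefl).

End Sums.

Section Pullback.
Variables (X Y X' : SG) (f : gmap Y X) (g : gmap X' X).

Lemma pullback_inv (a : G) (p : prodG Y X') :
  f p.1 = g p.2 -> f (gact a p).1 = g (gact a p).2.
Proof. by move=> e; rewrite !gfunP e. Qed.

Definition pullback : SG := @subG (prodG Y X') [set p | f p.1 = g p.2] pullback_inv.

Definition pb_incl : gmap pullback (prodG Y X') := sub_incl pullback_inv.
Definition pb1 : gmap pullback Y := gcomp (gfst Y X') pb_incl.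
Definition pb2 : gmap pullback X' := gcomp (gsnd Y X') pb_incl.

End Pullback.

Record measure (k : fieldType) := Measure {
  mval : forall Y X : SG, transitive_gset Y -> transitive_gset X -> gmap Y X -> k;
  mval_iso : forall (Y X : SG) (tY : transitive_gset Y) (tX : transitive_gset X)
      (f : gmap Y X), @is_iso S_cat Y X f -> mval tY tX f = 1;
  mval_comp : forall (Z Y X : SG) (tZ : transitive_gset Z) (tY : transitive_gset Y)
      (tX : transitive_gset X) (f : gmap Z Y) (g : gmap Y X),
    mval tZ tX (gcomp g f) = mval tY tX g * mval tZ tY f;
  mval_base : forall (Y X X' : SG) (tY : transitive_gset Y) (tX : transitive_gset X)
      (tX' : transitive_gset X') (f : gmap Y X) (g : gmap X' X),
    mval tY tX f = \sum_(t <- orbreps (pullback f g))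
      mval (orbG_trans t) tX' (gcomp (pb2 f g) (orbG_incl t)) }.

End GSets.

Section InvariantFunctions.
Variables (k : fieldType) (G : proOligoGroup) (X : sgset G).

Record invfun := InvFun {
  ifun :> X -> k;
  ifunP : forall g x, ifun (gact g x) = ifun x }.

Lemma invfun_ext (a b : invfun) : (forall x, a x = b x) -> a = b.
Proof.
case: a b => [a aP] [b bP] /= ab; have {}ab : a = b by exact: functional_extensionality_dep.
by subst b; congr InvFun; exact: Prop_irrelevance.
Qed.

Lemma invfun_orb (a : invfun) x y : orb x = orb y -> a x = a y.
Proof. by move=> /orbP[g ->]; rewrite ifunP. Qed.

Definition icst (c : k) : invfun := @InvFun (fun _ => c) (fun _ _ => erefl).
Definition iopp (a : invfun) : invfun.
Proof. by exists (fun x => - a x) => g x; rewrite ifunP. Defined.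
Definition iadd (a b : invfun) : invfun.
Proof. by exists (fun x => a x + b x) => g x; rewrite !ifunP. Defined.
Definition imul (a b : invfun) : invfun.
Proof. by exists (fun x => a x * b x) => g x; rewrite !ifunP. Defined.

HB.instance Definition _ := gen_eqMixin invfun.
HB.instance Definition _ := gen_choiceMixin invfun.

Lemma iaddA : associative iadd.
Proof. by move=> a b c; apply: invfun_ext => x; exact: addrA. Qed.
Lemma iaddC : commutative iadd.
Proof. by move=> a b; apply: invfun_ext => x; exact: addrC. Qed.
Lemma iadd0 : left_id (icst 0) iadd.
Proof. by move=> a; apply: invfun_ext => x; exact: add0r. Qed.
Lemma iaddN : left_inverse (icst 0) iopp iadd.
Proof. by move=> a; apply: invfun_ext => x; exact: addNr. Qed.

HB.instance Definition _ := GRing.isZmodule.Build invfun iaddA iaddC iadd0 iaddN.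

Definition iscale (c : k) (a : invfun) : invfun := imul (icst c) a.

Lemma iscaleA (c d : k) (a : invfun) : iscale c (iscale d a) = iscale (c * d) a.
Proof. by apply: invfun_ext => x; exact: mulrA. Qed.
Lemma iscale1 : left_id 1 iscale.
Proof. by move=> a; apply: invfun_ext => x; exact: mul1r. Qed.
Lemma iscaleDr : right_distributive iscale +%R.
Proof. by move=> c a b; apply: invfun_ext => x; exact: mulrDr. Qed.
Lemma iscaleDl (a : invfun) : {morph iscale^~ a : c d / c + d}.
Proof. by move=> c d; apply: invfun_ext => x; exact: mulrDl. Qed.

HB.instance Definition _ :=
  GRing.Zmodule_isLmodule.Build k invfun iscaleA iscale1 iscaleDr iscaleDl.

End InvariantFunctions.

Section Integration.
Variables (k : fieldType) (G : proOligoGroup) (mu : measure G k).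
Local Notation SG := (sgset G).
Implicit Types X Y Z : SG.

Definition ipull X Y (f : gmap Y X) (a : invfun k X) : invfun k Y.
Proof. by exists (fun y => a (f y)) => g y; rewrite gfunP ifunP. Defined.

(** [μ(T ⟶ W)] for the orbit [T] of [y] and the orbit [W] of [f y] *)
Definition morb X Y (f : gmap Y X) (y : Y) : k :=
  mval mu (orbG_trans y) (orbG_trans (f y)) (orb_restr f y).

(** The value of the measure on a map from an arbitrary [Y] to a transitive [X]. *)
Definition mval_finitary X Y (tX : transitive_gset X) (f : gmap Y X) : k :=
  \sum_(y <- orbreps Y) mval mu (orbG_trans y) tX (gcomp f (orbG_incl y)).

Lemma bij_is_iso X Y (f : gmap Y X) :
  injective f -> (forall x, exists y, f y = x) -> @is_iso (S_cat G) Y X f.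
Proof.
move=> finj /choice[g gP].
have gE : forall a x, g (gact a x) = gact a (g x).
  by move=> a x; apply: finj; rewrite gfunP !gP.
exists (GMap gE); split; apply: gmap_ext => x /=; last exact: gP.
by apply: finj; rewrite gP.
Qed.

Lemma trans_from X (tX : transitive_gset X) (x y : X) : orb x y.
Proof.
by case: tX => x0 h; rewrite (orb_eq (h x)).
Qed.

Lemma mval_morb (A B Y X : SG) (tA : transitive_gset A) (tB : transitive_gset B)
  (a : gmap A B) (f : gmap Y X) (i : gmap A Y) (j : gmap B X) (p : A) :
  injective i -> injective j -> (forall q, j (a q) = f (i q)) ->
  mval mu tA tB a = morb f (i p).
Proof.
move=> iinj jinj sq.
have hi q : orb (i p) (i q) by apply: orb_fun; exact: trans_from.
have hj q : orb (f (i p)) (j q).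
  by rewrite -sq; apply: orb_fun; exact: trans_from.
pose i0 q : orbG (i p) := exist _ (i q) (hi q).
pose j0 q : orbG (f (i p)) := exist _ (j q) (hj q).
have i0P g q : i0 (gact g q) = gact g (i0 q) by apply: sub_ext; exact: gfunP.
have j0P g q : j0 (gact g q) = gact g (j0 q) by apply: sub_ext; exact: gfunP.
pose i' := GMap i0P; pose j' := GMap j0P.
have e : gcomp (orb_restr f (i p)) i' = gcomp j' a.
  by apply: gmap_ext => q; apply: sub_ext => /=; rewrite sq.
have := congr1 (mval mu tA (orbG_trans (f (i p)))) e.
rewrite (mval_comp mu tA (orbG_trans (i p))) (mval_comp mu tA tB).
rewrite (_ : mval mu tA _ i' = 1); last first.
  apply: mval_iso; apply: bij_is_iso.
    by move=> q q' /(congr1 sval) /= /iinj.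
  move=> [y [g yg]]; exists (gact g p); apply: sub_ext => /=.
  by rewrite gfunP yg.
rewrite (_ : mval mu tB _ j' = 1); last first.
  apply: mval_iso; apply: bij_is_iso.
    by move=> q q' /(congr1 sval) /= /jinj.
  move=> [y [g yg]]; exists (gact g (a p)); apply: sub_ext => /=.
  by rewrite gfunP sq yg.
by rewrite mulr1 mul1r.
Qed.

Lemma morb_act X Y (f : gmap Y X) g y : morb f (gact g y) = morb f y.
Proof.
have h : orb y (gact g y) by exists g.
apply/esym; rewrite {1}/morb.
apply: (@mval_morb _ _ _ _ _ _ _ f (orbG_incl y) (orbG_incl (f y)) (exist _ _ h)) => //.
- by move=> ? ? /sub_ext.
- by move=> ? ? /sub_ext.
Qed.

Lemma morb_orb X Y (f : gmap Y X) y y' : orb y = orb y' -> morb f y = morb f y'.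
Proof. by move=> /orbP[g ->]; rewrite morb_act. Qed.

Lemma morb_inj X Y (f : gmap Y X) y : injective f -> morb f y = 1.
Proof.
move=> finj; apply: mval_iso; apply: bij_is_iso.
  by move=> q q' /(congr1 sval) /= /finj /sub_ext.
move=> [x [g xg]].
have h : orb y (gact g y) by exists g.
by exists (exist _ _ h); apply: sub_ext => /=; rewrite gfunP xg.
Qed.

Lemma morb_comp X Y Z (g : gmap Y X) (f : gmap Z Y) z :
  morb (gcomp g f) z = morb g (f z) * morb f z.
Proof.
rewrite /morb -(mval_comp mu _ _ (orbG_trans (g (f z)))); congr mval.
by apply: gmap_ext => q; apply: sub_ext.
Qed.

Lemma sum_pick X (F : X -> k) x0 : (forall x y, orb x = orb y -> F x = F y) ->
  \sum_(x <- orbreps X | orb x == orb x0) F x = F x0.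
Proof.
move=> FP.
have sum0 s : orb x0 \notin map (@orb G X) s -> \sum_(x <- s | orb x == orb x0) F x = 0.
  elim: s => [|x s IH]; first by rewrite big_nil.
  by rewrite inE negb_or big_cons eq_sym => /andP[/negPf -> /IH].
have := orbreps_uniq X; have := mem_orbreps x0.
elim: (orbreps X) => [//|x s IH] /=; rewrite inE big_cons [orb x == _]eq_sym.
case: (eqVneq (orb x0) (orb x)) => [e _|ne /= x0s] /andP[xs us]; last exact: IH.
by rewrite (FP _ _ e) sum0 ?e ?addr0.
Qed.

Lemma sum_reindex (A P : SG) (e : gmap A P) (Q : P -> bool) (F : P -> k) :
  injective e -> (forall t, Q t <-> exists a, t = e a) ->
  (forall x y, orb x = orb y -> F x = F y) ->
  \sum_(a <- orbreps A) F (e a) = \sum_(t <- orbreps P | Q t) F t.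
Proof.
move=> einj QP FP.
have eE a b : orb (e a) = orb (e b) -> orb a = orb b.
  by move=> /orbP[g]; rewrite -gfunP => /einj ->; rewrite orb_act.
under eq_bigr => a _ do rewrite -(sum_pick (e a) FP) big_mkcond.
rewrite exchange_big /= [RHS]big_mkcond; apply: eq_bigr => t _.
rewrite -big_mkcond; case: ifPn => [/QP[a ->]|nQ]; last first.
  rewrite big1 // => a /eqP ta; exfalso; move/negP: nQ; apply; apply/QP.
  by move/orbP: ta => [g ->]; exists (gact g a); rewrite gfunP.
rewrite -[RHS](@sum_pick A (fun=> F (e a)) a) //; apply: eq_bigl => b.
by apply/eqP/eqP => [/eE ->|/(orb_map e)->].
Qed.

(** Integration along the fibres of [f]: the sum runs over the orbits of [Y]
    mapping to the orbit of [x]. *)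
Definition ipush X Y (f : gmap Y X) (a : invfun k Y) : invfun k X.
Proof.
exists (fun x => \sum_(y <- orbreps Y | orb (f y) == orb x) a y * morb f y) => g x.
by under eq_bigl do rewrite orb_act.
Defined.

Lemma ipush_lin X Y (f : gmap Y X) : linear (ipush f).
Proof.
move=> c a b; apply: invfun_ext => x /=.
rewrite mulr_sumr -big_split; apply: eq_bigr => y _ /=.
by rewrite mulrDl mulrA.
Qed.

Lemma ipush_comp X Y Z (g : gmap Y X) (f : gmap Z Y) a :
  ipush (gcomp g f) a = ipush g (ipush f a).
Proof.
apply: invfun_ext => x /=.
under [RHS]eq_bigr => y _ do rewrite mulr_suml big_mkcond.
rewrite exchange_big /= [LHS]big_mkcond; apply: eq_bigr => z _.
transitivity (if orb (g (f z)) == orb x then a z * morb f z * morb g (f z) else 0).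
  by rewrite morb_comp [X in a z * X]mulrC mulrA.
rewrite -(@sum_pick Y (fun y => if orb (g y) == orb x then a z * morb f z * morb g y else 0)).
  rewrite [RHS]big_mkcond [LHS]big_mkcond; apply: eq_bigr => y _.
  by rewrite eq_sym; case: ifP; case: ifP.
by move=> y y' yy'; rewrite (morb_orb g yy') (orb_map g yy').
Qed.

Lemma ipush_proj X Y (f : gmap Y X) a b :
  ipush f (imul a (ipull f b)) = imul (ipush f a) b.
Proof.
apply: invfun_ext => x /=; rewrite mulr_suml; apply: eq_bigr => y /eqP e.
by rewrite (invfun_orb b e) mulrAC.
Qed.

Lemma ipush_projl X Y (f : gmap Y X) a b :
  ipush f (imul (ipull f b) a) = imul b (ipush f a).
Proof.
have imulC Z (u v : invfun k Z) : imul u v = imul v u.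
  by apply: invfun_ext => x; exact: mulrC.
by rewrite imulC ipush_proj imulC.
Qed.

Lemma ipush_inj X Y (f : gmap Y X) a y : injective f -> ipush f a (f y) = a y.
Proof.
move=> finj /=; rewrite -[RHS](@sum_pick Y a); last by move=> ? ?; exact: invfun_orb.
rewrite big_mkcond [RHS]big_mkcond; apply: eq_bigr => y' _.
rewrite morb_inj // mulr1; congr (if _ then _ else _).
apply/eqP/eqP => [/orbP[g]|/(orb_map f)//].
by rewrite -gfunP => /finj ->; rewrite orb_act.
Qed.

Lemma ipush_out X Y (f : gmap Y X) a x : (forall y, f y <> x) -> ipush f a x = 0.
Proof.
move=> h /=; rewrite big_pred0 // => y; apply/eqP => /esym/orbP[g xg].
by apply: (h (gact g y)); rewrite gfunP.
Qed.

Lemma ipush_id X a : ipush (gid X) a = a.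
Proof. by apply: invfun_ext => x; rewrite (@ipush_inj _ _ (gid X)). Qed.

Lemma ipush1 X Y (f : gmap Y X) x : injective f ->
  ipush f (icst Y (1 : k)) x = (`[< exists y, f y = x >])%:R.
Proof.
move=> finj; case: asboolP => [[y <-]|h]; first by rewrite ipush_inj.
by rewrite ipush_out // => y e; apply: h; exists y.
Qed.

Section BaseChange.
Variables (X Y X' P : SG) (f : gmap Y X) (g : gmap X' X) (p : gmap P Y) (q : gmap P X').

Definition cartesian : Prop :=
  [/\ forall t, f (p t) = g (q t),
      forall t t', p t = p t' -> q t = q t' -> t = t' &
      forall y x', f y = g x' -> exists t, p t = y /\ q t = x'].

Hypothesis cart : cartesian.

Lemma morb_base0 (y : Y) (x' : X') : f y = g x' ->
  \sum_(t <- orbreps P | (orb (q t) == orb x') && (orb (p t) == orb y)) morb q t = morb f y.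
Proof.
move=> e; case: cart => sq inj ex.
have hg z : orb x' z -> orb (f y) (g z) by rewrite e => /(orb_fun g).
pose g0 (z : orbG x') : orbG (f y) := exist _ (g (sval z)) (hg _ (svalP z)).
have g0P a z : g0 (gact a z) = gact a (g0 z) by apply: sub_ext; exact: gfunP.
rewrite {2}/morb (mval_base mu _ _ (orbG_trans x') _ (GMap g0P)).
set P0 := pullback _ _.
have : forall s : P0, exists t, p t = sval (sval s).1 /\ q t = sval (sval s).2.
  by move=> [[y0 x0] /= /(congr1 sval) /= s]; exact: ex.
move=> /choice[h hP].
have hE a s : h (gact a s) = gact a (h s).
  by case: (hP (gact a s)) => p1 q1; case: (hP s) => p2 q2; apply: inj;
    rewrite ?p1 ?q1 !gfunP ?p2 ?q2.
pose h' := GMap hE.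
have hinj : injective h'.
  move=> s s' /= ss.
  case: (hP s) (hP s') => p1 q1 [p2 q2]; rewrite -ss p1 in p2; rewrite -ss q1 in q2.
  case: s s' {ss p1 q1} p2 q2 => [[a b] e1] [[a' b'] e2] /= /sub_ext aa' /sub_ext bb'.
  by subst a' b'; congr exist; exact: Prop_irrelevance.
rewrite -(@sum_reindex _ _ h' _ (fun t => morb q t)) //; first last.
- by move=> t t'; exact: morb_orb.
- move=> t; split=> [/andP[/eqP e1 /eqP e2]|[s ->]].
    have py : orb y (p t) by case/orbP: e2 => a ->; exists a.
    have qx : orb x' (q t) by case/orbP: e1 => a ->; exists a.
    have s0P : orb_restr f y (exist _ (p t) py) = g0 (exist _ (q t) qx).
      by apply: (@sub_ext _ _ (orb (f y))) => /=; exact: sq.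
    exists (exist _ (exist _ (p t) py, exist _ (q t) qx) s0P).
    by apply: inj; rewrite /= ?(hP _).1 ?(hP _).2.
  apply/andP; split; apply/eqP; rewrite /= ?(hP _).1 ?(hP _).2.
    by apply: orb_eq; exact: svalP.
  by apply: orb_eq; exact: svalP.
apply: eq_bigr => s _; apply/esym.
apply: (@mval_morb _ _ _ _ _ _ _ q (gcomp h' (orbG_incl s)) (orbG_incl x')
  (exist _ s (orb_refl s))).
- by move=> ? ? /hinj /sub_ext.
- by move=> ? ? /sub_ext.
- by move=> t /=; rewrite (hP _).2.
Qed.

Lemma morb_base (y : Y) (x' : X') :
  \sum_(t <- orbreps P | (orb (q t) == orb x') && (orb (p t) == orb y)) morb q t =
  if orb (f y) == orb (g x') then morb f y else 0.
Proof.
case: ifPn => [/eqP/orbP[a e]|/negP h].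
  rewrite -(morb_act f a^-1%g) -(@morb_base0 _ x'); first by rewrite orb_act.
  by rewrite gfunP e gactK.
rewrite big_pred0 // => t; apply/negP => /andP[/eqP e1 /eqP e2]; apply: h.
by rewrite -(orb_map f e2) -(orb_map g e1); case: cart => ->.
Qed.

Lemma ipush_base a : ipull g (ipush f a) = ipush q (ipull p a).
Proof.
apply: invfun_ext => x' /=.
under [RHS]eq_bigr => t _ do
  rewrite -(@sum_pick Y (fun y => a y * morb q t) (p t)) ?big_mkcond => [|? ? /(invfun_orb a)->//].
rewrite exchange_big /= [LHS]big_mkcond; apply: eq_bigr => y _.
have := morb_base y x' => /(congr1 (fun c => a y * c)).
rewrite mulr_sumr [X in _ = X -> _]fun_if mulr0 => <-.
rewrite big_mkcond [RHS]big_mkcond; apply: eq_bigr => t _.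
by rewrite [orb y == _]eq_sym; case: (_ == _); case: (_ == _).
Qed.

End BaseChange.

End Integration.

Section Perm.
Variables (k : fieldType) (G : proOligoGroup) (mu : measure G k).
Local Notation SG := (sgset G).
Implicit Types X Y Z W : SG.

(** [G]-invariant [Y × X] matrices, i.e. morphisms [C(X) ⟶ C(Y)]. *)
Definition gmatrix X Y := invfun k (prodG Y X).

(** The matrix of [f^* : C(X) ⟶ C(Y)]. *)
Definition pullmx X Y (f : gmap Y X) : gmatrix X Y.
Proof.
exists (fun p => (`[< f p.1 = p.2 >])%:R : k) => g p /=; congr (_ %:R); congr nat_of_bool.
apply/asboolP/asboolP => e; last by rewrite gfunP e.
by rewrite -[LHS](gactK g) -gfunP e gactK.
Defined.

Definition trmx_gset X Y (A : gmatrix X Y) : gmatrix Y X :=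
  ipull (gpair (gsnd X Y) (gfst X Y)) A.

Definition pushmx X Y (f : gmap Y X) : gmatrix Y X := trmx_gset (pullmx f).

Definition prj12 Z Y X : gmap (prodG Z (prodG Y X)) (prodG Z Y) :=
  gpair (gfst Z (prodG Y X)) (gcomp (gfst Y X) (gsnd Z (prodG Y X))).
Definition prj13 Z Y X : gmap (prodG Z (prodG Y X)) (prodG Z X) :=
  gpair (gfst Z (prodG Y X)) (gcomp (gsnd Y X) (gsnd Z (prodG Y X))).
Definition prj23 Z Y X : gmap (prodG Z (prodG Y X)) (prodG Y X) := gsnd Z (prodG Y X).

(** The value at [(z, x)] is the sum of [B(z', y) * A(y, x') * μ(T ⟶ W)] over the
    orbits [T] of [(z', y, x')] lying over the orbit [W] of [(z, x)]. *)
Definition mxcomp X Y Z (B : gmatrix Y Z) (A : gmatrix X Y) : gmatrix X Z :=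
  ipush mu (prj13 Z Y X) (imul (ipull (prj12 Z Y X) B) (ipull (prj23 Z Y X) A)).

Lemma mxcompE X Y Z (B : gmatrix Y Z) (A : gmatrix X Y) (z : Z) (x : X) :
  mxcomp B A (z, x) =
  \sum_(t <- orbreps (prodG Z (prodG Y X)) |
      orb (prj13 Z Y X t) == @orb G (prodG Z X) (z, x))
    B (t.1, t.2.1) * A (t.2.1, t.2.2) * morb mu (prj13 Z Y X) t.
Proof. by apply: eq_bigr => -[z' [y x']]. Qed.

Definition kron X Y X' Y' (A : gmatrix X Y) (B : gmatrix X' Y') :
  gmatrix (prodG X X') (prodG Y Y').
Proof.
exists (fun p => A (p.1.1, p.2.1) * B (p.1.2, p.2.2)) => g [[y y'] [x x']].
by congr (_ * _); [rewrite -[RHS](ifunP A g)|rewrite -[RHS](ifunP B g)].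
Defined.

Lemma ipush_ind (V P X : SG) (j : gmap V P) (q : gmap P X) (a b : invfun k P) :
  injective j -> (forall t, a t = (`[< exists v, j v = t >])%:R) ->
  ipush mu q (imul a b) = ipush mu (gcomp q j) (ipull j b).
Proof.
move=> jinj aP; rewrite ipush_comp; congr ipush.
have -> : a = ipush mu j (icst V 1) by apply: invfun_ext => t; rewrite ipush1.
by rewrite -ipush_proj; congr ipush; apply: invfun_ext => v /=; rewrite mul1r.
Qed.

Lemma imulC X (a b : invfun k X) : imul a b = imul b a.
Proof. by apply: invfun_ext => x; exact: mulrC. Qed.

Lemma pullmx_comp W X Y (f : gmap Y X) (A : gmatrix W X) :
  mxcomp (pullmx f) A = ipull (gprod f (gid W)) A.
Proof.
pose j : gmap (prodG Y W) (prodG Y (prodG X W)) := gpair (gfst Y W) (gprod f (gid W)).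
rewrite /mxcomp (@ipush_ind _ _ _ j).
- rewrite -[RHS](@ipush_id _ _ mu); congr (ipush mu _ _); last exact: invfun_ext.
  by apply: gmap_ext => -[].
- by move=> [y w] [y' w'] /= [-> _ ->].
- move=> [y [x w]] /=; congr (_ %:R); congr nat_of_bool.
  apply/asboolP/asboolP => /= [<-|[[y' w'] [<- <- _]]//].
  by exists (y, w).
Qed.

Lemma comp_pullmx X Y Z (f : gmap Y X) (A : gmatrix Y Z) :
  mxcomp A (pullmx f) = ipush mu (gprod (gid Z) f) A.
Proof.
pose j : gmap (prodG Z Y) (prodG Z (prodG Y X)) :=
  gpair (gfst Z Y) (gpair (gsnd Z Y) (gcomp f (gsnd Z Y))).
rewrite /mxcomp imulC (@ipush_ind _ _ _ j).
- congr (ipush mu _ _); last by apply: invfun_ext => -[].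
  by apply: gmap_ext => -[].
- by move=> [z y] [z' y'] /= [-> -> _].
- move=> [z [y x]] /=; congr (_ %:R); congr nat_of_bool.
  apply/asboolP/asboolP => /= [<-|[[z' y'] [_ <- <-]]//].
  by exists (z, y).
Qed.

Lemma pushmx_comp W X Y (f : gmap Y X) (A : gmatrix W Y) :
  mxcomp (pushmx f) A = ipush mu (gprod f (gid W)) A.
Proof.
pose j : gmap (prodG Y W) (prodG X (prodG Y W)) := gpair (gcomp f (gfst Y W)) (gid _).
rewrite /mxcomp (@ipush_ind _ _ _ j).
- congr (ipush mu _ _); last by apply: invfun_ext => -[].
  by apply: gmap_ext => -[].
- by move=> [y w] [y' w'] /= [_ -> ->].
- move=> [x [y w]] /=; congr (_ %:R); congr nat_of_bool.
  apply/asboolP/asboolP => /= [<-|[[y' w'] [<- <- _]]//].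
  by exists (y, w).
Qed.

Lemma comp_pushmx X Y Z (f : gmap Y X) (A : gmatrix X Z) :
  mxcomp A (pushmx f) = ipull (gprod (gid Z) f) A.
Proof.
pose j : gmap (prodG Z Y) (prodG Z (prodG X Y)) :=
  gpair (gfst Z Y) (gpair (gcomp f (gsnd Z Y)) (gsnd Z Y)).
rewrite /mxcomp imulC (@ipush_ind _ _ _ j).
- rewrite -[RHS](@ipush_id _ _ mu); congr (ipush mu _ _); last by apply: invfun_ext => -[].
  by apply: gmap_ext => -[].
- by move=> [z y] [z' y'] /= [-> _ ->].
- move=> [z [x y]] /=; congr (_ %:R); congr nat_of_bool.
  apply/asboolP/asboolP => /= [<-|[[z' y'] [_ <- <-]]//].
  by exists (z, y).
Qed.

Lemma mxcomp1m X Y (A : gmatrix X Y) : mxcomp (pullmx (gid Y)) A = A.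
Proof. by rewrite pullmx_comp; apply: invfun_ext => -[]. Qed.

Lemma mxcompm1 X Y (A : gmatrix X Y) : mxcomp A (pullmx (gid X)) = A.
Proof.
rewrite comp_pullmx -[RHS](@ipush_id _ _ mu); congr (ipush mu _ _).
by apply: gmap_ext => -[].
Qed.

Lemma mxcompA X Y Z W (C : gmatrix Z W) (B : gmatrix Y Z) (A : gmatrix X Y) :
  mxcomp C (mxcomp B A) = mxcomp (mxcomp C B) A.
Proof.
pose P := prodG W (prodG Z (prodG Y X)).
rewrite /mxcomp.
pose q : gmap P (prodG W (prodG Z X)) := gprod (gid W) (prj13 Z Y X).
pose p : gmap P (prodG Z (prodG Y X)) := gsnd _ _.
rewrite (@ipush_base _ _ _ _ _ _ _ (prj13 Z Y X) (prj23 W Z X) p q); last first.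
  split=> [[w [z [y x]]]//|[w [z [y x]]] [w' [z' [y' x']]] /= [-> -> ->] [->]//|].
  by move=> [z [y x]] [w [z' x']] /= [-> ->]; exists (w, (z', (y, x'))).
rewrite -ipush_projl -[LHS]ipush_comp.
pose q' : gmap P (prodG W (prodG Y X)) := gprod (gid W) (gsnd _ _).
pose p' : gmap P (prodG W (prodG Z Y)) :=
  gprod (gid W) (gpair (gfst _ _) (gcomp (gfst _ _) (gsnd _ _))).
rewrite (@ipush_base _ _ _ _ _ _ _ (prj13 W Z Y) (prj12 W Y X) p' q'); last first.
  split=> [[w [z [y x]]]//|[w [z [y x]]] [w' [z' [y' x']]] /= [-> -> ->] [->]//|].
  by move=> [w [z y]] [w' [y' x']] /= [-> ->]; exists (w', (z, (y', x'))).
rewrite -ipush_proj -[RHS]ipush_comp; congr (ipush mu _ _).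
by apply: invfun_ext => -[w [z [y x]]] /=; rewrite mulrA.
Qed.

Lemma mxcomp_linl X Y Z (A : gmatrix X Y) : linear (fun B : gmatrix Y Z => mxcomp B A).
Proof.
move=> c B B'; rewrite /mxcomp -ipush_lin; congr (ipush mu _ _).
by apply: invfun_ext => t /=; rewrite mulrDl mulrA.
Qed.

Lemma mxcomp_linr X Y Z (B : gmatrix Y Z) : linear (fun A : gmatrix X Y => mxcomp B A).
Proof.
move=> c A A'; rewrite /mxcomp -ipush_lin; congr (ipush mu _ _).
by apply: invfun_ext => t /=; rewrite mulrDr mulrCA.
Qed.

Definition perm_linCat : linCat k :=
  @LinCat k SG (fun X Y => gmatrix X Y : lmodType k) (fun X => pullmx (gid X)) mxcomp
    mxcomp1m mxcompm1 mxcompA mxcomp_linl mxcomp_linr.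

Lemma fubini X X' Y Y' (f : gmap Y X) (f' : gmap Y' X') (a : invfun k Y) (a' : invfun k Y') :
  ipush mu (gprod f f') (imul (ipull (gfst Y Y') a) (ipull (gsnd Y Y') a')) =
  imul (ipull (gfst X X') (ipush mu f a)) (ipull (gsnd X X') (ipush mu f' a')).
Proof.
have -> : gprod f f' = gcomp (gprod f (gid X')) (gprod (gid Y) f') by exact: gmap_ext.
rewrite ipush_comp.
have -> : ipull (gfst Y Y') a = ipull (gprod (gid Y) f') (ipull (gfst Y X') a).
  exact: invfun_ext.
rewrite ipush_projl.
rewrite -(@ipush_base _ _ _ _ _ _ _ f' (gsnd Y X')); last first.
  split=> [[y y']//|[y y'] [z z'] /= -> [->]//|].
  by move=> y [x x'] /= <-; exists (x, y).
have -> : ipull (gsnd Y X') (ipush mu f' a') =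
  ipull (gprod f (gid X')) (ipull (gsnd X X') (ipush mu f' a')) by exact: invfun_ext.
rewrite ipush_proj; congr imul.
rewrite -(@ipush_base _ _ _ _ _ _ _ f (gfst X X')) //.
split=> [[y y']//|[y y'] [z z'] /= -> [->]//|].
by move=> y [x x'] /= <-; exists (y, x').
Qed.

Lemma kron_comp X X' Y Y' Z Z' (B : gmatrix Y Z) (A : gmatrix X Y) (B' : gmatrix Y' Z')
    (A' : gmatrix X' Y') :
  kron (mxcomp B A) (mxcomp B' A') = mxcomp (kron B B') (kron A A').
Proof.
pose s : gmap (prodG (prodG Z Z') (prodG X X')) (prodG (prodG Z X) (prodG Z' X')) :=
  gpair (gprod (gfst _ _) (gfst _ _)) (gprod (gsnd _ _) (gsnd _ _)).
pose P := prodG (prodG Z Z') (prodG (prodG Y Y') (prodG X X')).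
pose p : gmap P (prodG (prodG Z (prodG Y X)) (prodG Z' (prodG Y' X'))) :=
  gpair (gprod (gfst _ _) (gprod (gfst _ _) (gfst _ _)))
        (gprod (gsnd _ _) (gprod (gsnd _ _) (gsnd _ _))).
have -> : kron (mxcomp B A) (mxcomp B' A') =
  ipull s (imul (ipull (gfst _ _) (mxcomp B A)) (ipull (gsnd _ _) (mxcomp B' A'))).
  exact: invfun_ext.
rewrite -fubini.
rewrite (@ipush_base _ _ _ _ _ _ _ _ s p (prj13 _ _ _)); last first.
  split=> [[[z z'] [[y y'] [x x']]]//| |].
    by move=> [[? ?] [[? ?] [? ?]]] [[? ?] [[? ?] [? ?]]] /= [-> -> -> -> -> ->].
  move=> [[z [y x]] [z' [y' x']]] [[w w'] [v v']] /= [-> -> -> ->].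
  by exists ((w, w'), ((y, y'), (v, v'))).
congr (ipush mu _ _); apply: invfun_ext => -[[z z'] [[y y'] [x x']]] /=.
by rewrite mulrACA.
Qed.

Lemma kron_linl X X' Y Y' (B : gmatrix X' Y') :
  linear (fun A : gmatrix X Y => kron A B).
Proof. by move=> c A A'; apply: invfun_ext => p /=; rewrite mulrDl mulrA. Qed.

Lemma kron_linr X X' Y Y' (A : gmatrix X Y) :
  linear (fun B : gmatrix X' Y' => kron A B).
Proof. by move=> c B B'; apply: invfun_ext => p /=; rewrite mulrDr mulrCA. Qed.

Lemma pullmx_eq X Y (f g : gmap Y X) : (forall y, f y = g y) -> pullmx f = pullmx g.
Proof. by move=> fg; congr pullmx; exact: gmap_ext. Qed.

Lemma pullmxM X Y Z (f : gmap Y X) (g : gmap Z Y) :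
  mxcomp (pullmx g) (pullmx f) = pullmx (gcomp f g).
Proof. by rewrite pullmx_comp; apply: invfun_ext. Qed.

Lemma kron_pullmx X X' Y Y' (f : gmap Y X) (g : gmap Y' X') :
  kron (pullmx f) (pullmx g) = pullmx (gprod f g).
Proof.
apply: invfun_ext => -[[y y'] [x x']] /=; rewrite -natrM mulnb; congr (_ %:R).
congr nat_of_bool; apply/andP/asboolP => [[/asboolP-> /asboolP->]//|[-> ->]].
by split; apply/asboolP.
Qed.

Lemma pushmx_inv X Y (f : gmap Y X) (g : gmap X Y) :
  (forall x, f (g x) = x) -> (forall y, g (f y) = y) -> pushmx f = pullmx g.
Proof.
move=> fg gf; apply: invfun_ext => -[x y] /=; congr (_ %:R); congr nat_of_bool.
by apply/asboolP/asboolP => <-.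
Qed.

Definition gassoc X Y Z : gmap (prodG X (prodG Y Z)) (prodG (prodG X Y) Z) :=
  gpair (gprod (gid X) (gfst Y Z)) (gcomp (gsnd Y Z) (gsnd X (prodG Y Z))).
Definition gassocV X Y Z : gmap (prodG (prodG X Y) Z) (prodG X (prodG Y Z)) :=
  gpair (gcomp (gfst X Y) (gfst (prodG X Y) Z)) (gprod (gsnd X Y) (gid Z)).
Definition gswap X Y : gmap (prodG Y X) (prodG X Y) := gpair (gsnd Y X) (gfst Y X).

Lemma perm_zero : has_zero_object perm_linCat.
Proof. by exists (emptyG G) => X; split => f; apply: invfun_ext => -[]. Qed.

Lemma perm_biprod : has_biproducts perm_linCat.
Proof.
move=> X Y; exists (sumG X Y), (pushmx (ginl X Y)), (pushmx (ginr X Y)),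
  (pullmx (ginl X Y)), (pullmx (ginr X Y)).
have id_ind (Z : SG) (z z' : Z) : (pullmx (gid Z) : gmatrix Z Z) (z, z') = `[< z = z' >]%:R.
  by [].
have ind_eq (P Q : Prop) : (P <-> Q) -> (`[< P >])%:R = (`[< Q >])%:R :> k.
  by move=> PQ; congr (_ %:R); congr nat_of_bool; apply/asboolP/asboolP => /PQ.
have ind0 (P : Prop) : ~ P -> (`[< P >])%:R = 0 :> k.
  by move=> nP; rewrite asboolF.
split.
- rewrite /comp /= pullmx_comp; apply: invfun_ext => -[x x'] /=.
  by apply: ind_eq; split => [[->]|->].
- rewrite /comp /= pullmx_comp; apply: invfun_ext => -[x x'] /=.
  by apply: ind_eq; split => [[->]|->].
- by rewrite /comp /= pullmx_comp; apply: invfun_ext => -[x y] /=; apply: ind0.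
- by rewrite /comp /= pullmx_comp; apply: invfun_ext => -[x y] /=; apply: ind0.
- rewrite /comp /= !pushmx_comp; apply: invfun_ext => -[s s'].
  set F1 := gprod (ginl X Y) (gid _); set F2 := gprod (ginr X Y) (gid _).
  have F1i : injective F1 by move=> [x t] [x' t'] [-> ->].
  have F2i : injective F2 by move=> [x t] [x' t'] [-> ->].
  rewrite -[LHS]/(ipush mu F1 _ (s, s') + ipush mu F2 _ (s, s')).
  case: s => [x|y].
  + rewrite (ipush_out _ (f := F2)) ?addr0 => [|[y t] //].
    by rewrite -[(inl x, s')]/(F1 (x, s')) ipush_inj.
  + rewrite (ipush_out _ (f := F1)) ?add0r => [|[x t] //].
    by rewrite -[(inr y, s')]/(F2 (y, s')) ipush_inj.
Qed.

Definition mxassoc X Y Z : gmatrix (prodG (prodG X Y) Z) (prodG X (prodG Y Z)) :=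
  pullmx (gassoc X Y Z).
Definition mxassocV X Y Z : gmatrix (prodG X (prodG Y Z)) (prodG (prodG X Y) Z) :=
  pullmx (gassocV X Y Z).
Definition mxbraid X Y : gmatrix (prodG X Y) (prodG Y X) := pullmx (gswap X Y).
Definition mxlunit X : gmatrix (prodG (ptG G) X) X := pullmx (gpair (gterm X) (gid X)).
Definition mxlunitV X : gmatrix X (prodG (ptG G) X) := pullmx (gsnd (ptG G) X).
Definition mxrunit X : gmatrix (prodG X (ptG G)) X := pullmx (gpair (gid X) (gterm X)).
Definition mxrunitV X : gmatrix X (prodG X (ptG G)) := pullmx (gfst X (ptG G)).

Lemma comp_pullmx_iso X Y Z (f : gmap Y X) (g : gmap X Y) (A : gmatrix Y Z) :
  (forall x, f (g x) = x) -> (forall y, g (f y) = y) ->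
  mxcomp A (pullmx f) = ipull (gprod (gid Z) g) A.
Proof. by move=> fg gf; rewrite -(pushmx_inv gf fg) comp_pushmx. Qed.

Lemma kron1 X Y : kron (pullmx (gid X)) (pullmx (gid Y)) = pullmx (gid (prodG X Y)).
Proof. by rewrite kron_pullmx; apply: pullmx_eq => -[]. Qed.

Lemma mxassocK X Y Z : mxcomp (mxassocV X Y Z) (mxassoc X Y Z) = pullmx (gid _).
Proof. by rewrite pullmxM; apply: pullmx_eq => -[[]]. Qed.

Lemma mxassocVK X Y Z : mxcomp (mxassoc X Y Z) (mxassocV X Y Z) = pullmx (gid _).
Proof. by rewrite pullmxM; apply: pullmx_eq => -[? []]. Qed.

Lemma mxlunitK X : mxcomp (mxlunitV X) (mxlunit X) = pullmx (gid _).
Proof. by rewrite pullmxM; apply: pullmx_eq => -[[]]. Qed.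

Lemma mxlunitVK X : mxcomp (mxlunit X) (mxlunitV X) = pullmx (gid _).
Proof. by rewrite pullmxM; exact: pullmx_eq. Qed.

Lemma mxrunitK X : mxcomp (mxrunitV X) (mxrunit X) = pullmx (gid _).
Proof. by rewrite pullmxM; apply: pullmx_eq => -[? []]. Qed.

Lemma mxrunitVK X : mxcomp (mxrunit X) (mxrunitV X) = pullmx (gid _).
Proof. by rewrite pullmxM; exact: pullmx_eq. Qed.

Lemma mxbraidK X Y : mxcomp (mxbraid Y X) (mxbraid X Y) = pullmx (gid _).
Proof. by rewrite pullmxM; apply: pullmx_eq => -[]. Qed.

Lemma mxassoc_nat X X' Y Y' Z Z' (A : gmatrix X X') (B : gmatrix Y Y') (C : gmatrix Z Z') :
  mxcomp (mxassoc X' Y' Z') (kron (kron A B) C) =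
  mxcomp (kron A (kron B C)) (mxassoc X Y Z).
Proof.
rewrite pullmx_comp (@comp_pullmx_iso _ _ _ _ (gassocV X Y Z)); last 2 first.
- by move=> [[]].
- by move=> [? []].
by apply: invfun_ext => -[[x' [y' z']] [[x y] z]] /=; rewrite mulrA.
Qed.

Lemma mxlunit_nat X X' (A : gmatrix X X') :
  mxcomp (mxlunit X') (kron (pullmx (gid (ptG G))) A) = mxcomp A (mxlunit X).
Proof.
rewrite pullmx_comp (@comp_pullmx_iso _ _ _ _ (gsnd (ptG G) X)); last 2 first.
- by move=> [[]].
- by [].
by apply: invfun_ext => -[x' [[] x]] /=; rewrite asboolT // mul1r.
Qed.

Lemma mxrunit_nat X X' (A : gmatrix X X') :
  mxcomp (mxrunit X') (kron A (pullmx (gid (ptG G)))) = mxcomp A (mxrunit X).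
Proof.
rewrite pullmx_comp (@comp_pullmx_iso _ _ _ _ (gfst X (ptG G))); last 2 first.
- by move=> [? []].
- by [].
by apply: invfun_ext => -[x' [x []]] /=; rewrite asboolT // mulr1.
Qed.

Lemma mxbraid_nat X X' Y Y' (A : gmatrix X X') (B : gmatrix Y Y') :
  mxcomp (mxbraid X' Y') (kron A B) = mxcomp (kron B A) (mxbraid X Y).
Proof.
rewrite pullmx_comp (@comp_pullmx_iso _ _ _ _ (gswap Y X)); last 2 first.
- by move=> [].
- by move=> [].
by apply: invfun_ext => -[[y' x'] [x y]] /=; rewrite mulrC.
Qed.

Lemma mxpentagon X Y Z W :
  mxcomp (mxassoc X Y (prodG Z W)) (mxassoc (prodG X Y) Z W) =
  mxcomp (mxcomp (kron (pullmx (gid X)) (mxassoc Y Z W)) (mxassoc X (prodG Y Z) W))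
    (kron (mxassoc X Y Z) (pullmx (gid W))).
Proof.
rewrite /mxassoc !kron_pullmx !pullmxM.
by apply: pullmx_eq; case=> x [y [z w]] /=; exact: erefl.
Qed.

Lemma mxtriangle X Y :
  mxcomp (kron (pullmx (gid X)) (mxlunit Y)) (mxassoc X (ptG G) Y) =
  kron (mxrunit X) (pullmx (gid Y)).
Proof.
rewrite /mxassoc /mxlunit /mxrunit !kron_pullmx !pullmxM.
by apply: pullmx_eq; case=> x y /=; exact: erefl.
Qed.

Lemma mxhexagon X Y Z :
  mxcomp (mxcomp (mxassoc Y Z X) (mxbraid X (prodG Y Z))) (mxassoc X Y Z) =
  mxcomp (mxcomp (kron (pullmx (gid Y)) (mxbraid X Z)) (mxassoc Y X Z))
    (kron (mxbraid X Y) (pullmx (gid Z))).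
Proof.
rewrite /mxassoc /mxbraid !kron_pullmx !pullmxM.
by apply: pullmx_eq; case=> y [z x] /=; exact: erefl.
Qed.

(** The tensor category of permutation modules; [C(X)] is represented by [X]. *)
Definition Perm : tensorCat k :=
  @TensorCat k perm_linCat perm_zero perm_biprod (@prodG G) (@kron) (ptG G)
    mxassoc mxassocV mxlunit mxlunitV mxrunit mxrunitV mxbraid
    kron1 (fun X X' X'' Y Y' Y'' => @kron_comp X Y X' Y' X'' Y'')
    (fun X X' Y Y' B => @kron_linl X Y X' Y' B) 
    (fun X X' Y Y' A => @kron_linr X Y X' Y' A)
    mxassocK mxassocVK mxlunitK mxlunitVK mxrunitK mxrunitVK mxbraidK
    mxassoc_nat mxlunit_nat mxrunit_nat mxbraid_nat mxpentagon mxtriangle mxhexagon.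

End Perm.

Section PermAlgebras.
Variables (k : fieldType) (G : proOligoGroup) (mu : measure G k).
Local Notation SG := (sgset G).
Implicit Types X Y Z W : SG.
Local Notation pull := (@pullmx k G _ _).
Local Notation push := (@pushmx k G _ _).
Local Notation "g \m f" := (mxcomp mu g f) (at level 40, left associativity).

Lemma pushmx_eq X Y (f g : gmap Y X) : (forall y, f y = g y) -> push f = push g.
Proof. by move=> fg; congr pushmx; exact: gmap_ext. Qed.

Lemma pushmxM X Y Z (f : gmap Y X) (g : gmap Z Y) : push f \m push g = push (gcomp f g).
Proof. by rewrite comp_pushmx; apply: invfun_ext => -[]. Qed.

Lemma kron_pushmx X X' Y Y' (f : gmap Y X) (g : gmap Y' X') :
  kron (push f) (push g) = push (gprod f g).
Proof.
apply: invfun_ext => -[[x x'] [y y']].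
by rewrite -[RHS]/(pull (gprod f g) ((y, y'), (x, x'))) -kron_pullmx.
Qed.

Lemma push_gid X : push (gid X) = pull (gid X).
Proof. exact: pushmx_inv. Qed.

Lemma pull_gid X (f : gmap X X) : (forall x, f x = x) -> pull f = pull (gid X).
Proof. by move=> fx; apply: pullmx_eq. Qed.

Lemma pull_push (X Y X' P : SG) (f : gmap Y X) (g : gmap X' X) (p : gmap P Y) (q : gmap P X') :
  cartesian f g p q -> pull g \m push f = push q \m pull p.
Proof.
move=> [sq inj ex]; rewrite pullmx_comp pushmx_comp.
pose j : gmap P (prodG P Y) := gpair (gid P) p.
have -> : pull p = ipush mu j (icst P 1).
  apply: invfun_ext => -[t y]; rewrite ipush1 => [|t1 t2 [] //].
  rewrite /=; congr (_ %:R); congr nat_of_bool.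
  by apply/asboolP/asboolP => [<-|[t' [-> ->]]//]; exists t.
rewrite -ipush_comp; apply: invfun_ext => -[x' y].
rewrite ipush1 => [|t1 t2 [] e1 e2]; last exact: inj.
rewrite /=; congr (_ %:R); congr nat_of_bool.
by apply/asboolP/asboolP => [/ex[t [<- <-]]|[t [<- <-]]]; [exists t|rewrite sq].
Qed.

Lemma perm_mulA X :
  pull (gdiag X) \m kron (pull (gid X)) (pull (gdiag X)) \m pull (gassoc X X X) =
  pull (gdiag X) \m kron (pull (gdiag X)) (pull (gid X)).
Proof. by rewrite !kron_pullmx !pullmxM; exact: pullmx_eq. Qed.

Lemma perm_mulC X : pull (gdiag X) \m pull (gswap X X) = pull (gdiag X).
Proof. by rewrite !pullmxM; exact: pullmx_eq. Qed.

Lemma perm_mul1 X :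
  pull (gdiag X) \m kron (pull (gterm X)) (pull (gid X)) = mxlunit k X.
Proof. by rewrite kron_pullmx pullmxM; exact: pullmx_eq. Qed.

Definition perm_alg X : algebra (Perm mu) :=
  @Algebra k (Perm mu) X (pull (gdiag X)) (pull (gterm X))
    (perm_mulA X) (perm_mulC X) (perm_mul1 X).

Definition perm_ev X : gmatrix k (prodG X X) (ptG G) := push (gterm X) \m pull (gdiag X).
Definition perm_coev X : gmatrix k (ptG G) (prodG X X) := push (gdiag X) \m pull (gterm X).

Lemma kron_id_comp X Y Z W (B : gmatrix k Y Z) (A : gmatrix k X Y) :
  kron (pull (gid W)) (B \m A) = kron (pull (gid W)) B \m kron (pull (gid W)) A.
Proof. by rewrite -kron_comp mxcomp1m. Qed.

Lemma kron_comp_id X Y Z W (B : gmatrix k Y Z) (A : gmatrix k X Y) :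
  kron (B \m A) (pull (gid W)) = kron B (pull (gid W)) \m kron A (pull (gid W)).
Proof. by rewrite -kron_comp mxcomp1m. Qed.

Lemma frobenius1 X :
  kron (pull (gid X)) (pull (gdiag X)) \m pull (gassoc X X X) \m
    kron (push (gdiag X)) (pull (gid X)) = push (gdiag X) \m pull (gdiag X).
Proof.
rewrite -push_gid kron_pushmx push_gid kron_pullmx pullmxM.
apply: pull_push; split=> [//|t t' [-> _] _ //|[a b] [c d] /= [ac ad bd]].
by exists a; rewrite /= -ac -ad bd -ad.
Qed.

Lemma frobenius2 X :
  kron (pull (gdiag X)) (pull (gid X)) \m pull (gassocV X X X) \m
    kron (pull (gid X)) (push (gdiag X)) = push (gdiag X) \m pull (gdiag X).
Proof.
rewrite -push_gid kron_pushmx push_gid kron_pullmx pullmxM.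
apply: pull_push; split=> [//|t t' [-> _] _ //|[a b] [c d] /= [ac bc bd]].
by exists a; rewrite /= bc -ac -bd bc ac.
Qed.

Lemma unitD X :
  pull (gdiag X) \m (kron (pull (gterm X)) (pull (gid X)) \m mxlunitV k X) = pull (gid X).
Proof. by rewrite kron_pullmx !pullmxM; exact: pullmx_eq. Qed.

Lemma unitD2 X :
  pull (gdiag X) \m (kron (pull (gid X)) (pull (gterm X)) \m mxrunitV k X) = pull (gid X).
Proof. by rewrite kron_pullmx !pullmxM; exact: pullmx_eq. Qed.

Lemma perm_snake1 X :
  mxrunit k X \m kron (pull (gid X)) (perm_ev X) \m mxassoc k X X X \m
    kron (perm_coev X) (pull (gid X)) \m mxlunitV k X = pull (gid X).
Proof.
transitivity (mxrunit k X \m kron (pull (gid X)) (push (gterm X)) \m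
  (kron (pull (gid X)) (pull (gdiag X)) \m pull (gassoc X X X) \m
    kron (push (gdiag X)) (pull (gid X))) \m
  kron (pull (gterm X)) (pull (gid X)) \m mxlunitV k X).
  by rewrite kron_id_comp kron_comp_id !mxcompA.
rewrite frobenius1 !mxcompA -[LHS]mxcompA -[LHS]mxcompA.
rewrite unitD mxcompm1.
rewrite /mxrunit -(@pushmx_inv k G _ _ (gfst X (ptG G)) (gpair (gid X) (gterm X))) // -?push_gid;
  last by move=> [? []].
by rewrite kron_pushmx !pushmxM; exact: pushmx_eq.
Qed.

Lemma perm_snake2 X :
  mxlunit k X \m kron (perm_ev X) (pull (gid X)) \m mxassocV k X X X \m
    kron (pull (gid X)) (perm_coev X) \m mxrunitV k X = pull (gid X).
Proof.
transitivity (mxlunit k X \m kron (push (gterm X)) (pull (gid X)) \m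
  (kron (pull (gdiag X)) (pull (gid X)) \m pull (gassocV X X X) \m
    kron (pull (gid X)) (push (gdiag X))) \m
  kron (pull (gid X)) (pull (gterm X)) \m mxrunitV k X).
  by rewrite kron_id_comp kron_comp_id !mxcompA.
rewrite frobenius2 !mxcompA -[LHS]mxcompA -[LHS]mxcompA.
rewrite unitD2 mxcompm1.
rewrite /mxlunit -(@pushmx_inv k G _ _ (gsnd (ptG G) X) (gpair (gterm X) (gid X))) // -?push_gid;
  last by move=> [[]].
by rewrite kron_pushmx !pushmxM; exact: pushmx_eq.
Qed.

Lemma perm_trace X :
  perm_ev X \m pull (gswap X X) \m
    (kron (pull (gdiag X)) (pull (gid X)) \m mxassocV k X X X \m
      kron (pull (gid X)) (perm_coev X) \m mxrunitV k X) = push (gterm X).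
Proof.
transitivity (perm_ev X \m pull (gswap X X) \m
  (kron (pull (gdiag X)) (pull (gid X)) \m pull (gassocV X X X) \m
    kron (pull (gid X)) (push (gdiag X))) \m
  kron (pull (gid X)) (pull (gterm X)) \m mxrunitV k X).
  by rewrite kron_id_comp !mxcompA.
rewrite frobenius2 !mxcompA -[LHS]mxcompA -[LHS]mxcompA.
rewrite unitD2 mxcompm1 /perm_ev.
rewrite -!mxcompA (mxcompA _ (pull (gdiag X))) pullmxM.
rewrite (@pull_push _ _ _ _ _ _ (gid X) (gid X)); last first.
  by split=> [//|//|x y [<- _]]; exists x.
by rewrite push_gid !mxcompm1.
Qed.

Definition perm_dual X : dual (T := Perm mu) X :=
  @Dual k (Perm mu) X X (perm_ev X) (perm_coev X) (conj (perm_snake1 X) (perm_snake2 X)).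

Lemma perm_traceE X : trace_map (A := perm_alg X) (perm_dual X) = push (gterm X).
Proof. exact: perm_trace. Qed.

Lemma perm_etale X : etale (perm_alg X).
Proof.
exists (perm_dual X); exists (perm_coev X); rewrite perm_traceE.
exact: (conj (perm_snake1 X) (perm_snake2 X)).
Qed.

End PermAlgebras.

Section TensorLemmas.
Variables (k : fieldType) (T : tensorCat k).

Lemma tensm_compr (X Y Z W : T) (g : hom Y Z) (f : hom X Y) :
  idm W ⊠ (g ∘ f) = (idm W ⊠ g) ∘ (idm W ⊠ f).
Proof. by rewrite -tensmM comp1m. Qed.

Lemma tensm_compl (X Y Z W : T) (g : hom Y Z) (f : hom X Y) :
  (g ∘ f) ⊠ idm W = (g ⊠ idm W) ∘ (f ⊠ idm W).
Proof. by rewrite -tensmM comp1m. Qed.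

Lemma lunitV_nat (X Y : T) (f : hom X Y) : lunitV Y ∘ f = (idm 𝟙 ⊠ f) ∘ lunitV X.
Proof.
rewrite -[f in LHS]compm1 -(lunitVK X) [f ∘ _]compA -lunit_nat.
by rewrite !compA lunitK comp1m.
Qed.

Lemma dual_iso (A D A' D' : T) (ev : hom (D ⊗ A) 𝟙) (coev : hom 𝟙 (A ⊗ D))
    (ev' : hom (D' ⊗ A') 𝟙) (coev' : hom 𝟙 (A' ⊗ D')) (a : hom A A') (d : hom D D') :
  is_duality ev coev -> is_duality ev' coev' ->
  ev' ∘ (d ⊠ a) = ev -> (a ⊠ d) ∘ coev = coev' -> is_iso a.
Proof.
move=> [s1 _] [s1' _] evE coevE.
exists (runit A ∘ (idm A ⊠ (ev' ∘ (d ⊠ idm A'))) ∘ assoc A D A' ∘ (coev ⊠ idm A') ∘ lunitV A').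
split.
- rewrite -[RHS]s1 -[LHS]compA lunitV_nat !compA; congr (_ ∘ _).
  rewrite -[LHS]compA -tensmM comp1m compm1.
  rewrite -[coev in LHS]comp1m -[a in LHS]compm1 tensmM compA; congr (_ ∘ _).
  rewrite -[LHS]compA -tensm1 assoc_nat !compA; congr (_ ∘ _).
  by rewrite -[LHS]compA -tensm_compr -compA -tensmM compm1 comp1m evE.
- rewrite -[RHS]s1' -coevE !compA -runit_nat; congr (_ ∘ _).
  rewrite tensm_compl compA; congr (_ ∘ _).
  rewrite -[RHS]compA assoc_nat !compA; congr (_ ∘ _).
  rewrite -!compA; congr (_ ∘ _).
  by rewrite -!tensmM !comp1m compm1.
Qed.

End TensorLemmas.

Section Transfer.
Variables (k : fieldType) (P T : tensorCat k) (F : tensor_functor P T).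

Lemma tfun2_natr (X Y Y' : P) (f : hom Y Y') :
  tfun2 F X Y' ∘ (idm (F X) ⊠ fmap F f) = fmap F (idm X ⊠ f) ∘ tfun2 F X Y.
Proof. by rewrite -tfun2_nat fmap1. Qed.

Lemma tfun2_natl (X X' Y : P) (f : hom X X') :
  tfun2 F X' Y ∘ (fmap F f ⊠ idm (F Y)) = fmap F (f ⊠ idm Y) ∘ tfun2 F X Y.
Proof. by rewrite -tfun2_nat fmap1. Qed.

Lemma tfun_runitE (X : P) :
  runit (F X) ∘ (idm (F X) ⊠ tfun0V F) = fmap F (runit X) ∘ tfun2 F X 𝟙.
Proof. by rewrite -tfun_runit -[LHS]compA -tensm_compr tfun0VK tensm1 compm1. Qed.

Lemma tfun_lunitE (X : P) :
  lunit (F X) ∘ (tfun0V F ⊠ idm (F X)) = fmap F (lunit X) ∘ tfun2 F 𝟙 X.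
Proof. by rewrite -tfun_lunit -[LHS]compA -tensm_compl tfun0VK tensm1 compm1. Qed.

Lemma tfun_lunitVE (X : P) :
  tfun2 F 𝟙 X ∘ (tfun0 F ⊠ idm (F X)) ∘ lunitV (F X) = fmap F (lunitV X).
Proof.
rewrite -[LHS]comp1m -fmap1 -lunitK fmapM -[LHS]compA !compA.
by rewrite -!(compA (fmap F (lunitV X))) tfun_lunit lunitVK compm1.
Qed.

Lemma tfun_runitVE (X : P) :
  tfun2 F X 𝟙 ∘ (idm (F X) ⊠ tfun0 F) ∘ runitV (F X) = fmap F (runitV X).
Proof.
rewrite -[LHS]comp1m -fmap1 -runitK fmapM -[LHS]compA !compA.
by rewrite -!(compA (fmap F (runitV X))) tfun_runit runitVK compm1.
Qed.

Lemma tfun_assocVE (X Y Z : P) :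
  tfun2 F (X ⊗ Y) Z ∘ (tfun2 F X Y ⊠ idm (F Z)) ∘ assocV (F X) (F Y) (F Z) =
  fmap F (assocV X Y Z) ∘ tfun2 F X (Y ⊗ Z) ∘ (idm (F X) ⊠ tfun2 F Y Z).
Proof.
rewrite -[LHS]comp1m -fmap1 -assocK fmapM -[LHS]compA !compA.
rewrite -!(compA (fmap F (assocV X Y Z))) tfun_assoc -!compA.
by rewrite assocVK compm1.
Qed.

Lemma tfun_alg_A (A : algebra P) :
  (fmap F (amul A) ∘ tfun2 F A A) ∘ (idm (F A) ⊠ (fmap F (amul A) ∘ tfun2 F A A)) ∘
    assoc (F A) (F A) (F A) =
  (fmap F (amul A) ∘ tfun2 F A A) ∘ ((fmap F (amul A) ∘ tfun2 F A A) ⊠ idm (F A)).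
Proof.
rewrite tensm_compr tensm_compl.
transitivity (fmap F (amul A) ∘ (tfun2 F A A ∘ (idm (F A) ⊠ fmap F (amul A))) ∘
  (idm (F A) ⊠ tfun2 F A A) ∘ assoc (F A) (F A) (F A)); first by rewrite !compA.
rewrite tfun2_natr.
transitivity (fmap F (amul A) ∘ fmap F (idm (A : P) ⊠ amul A) ∘
   (tfun2 F A (A ⊗ A) ∘ (idm (F A) ⊠ tfun2 F A A) ∘ assoc (F A) (F A) (F A))).
  by rewrite !compA.
rewrite -tfun_assoc !compA -!fmapM amulA.
by rewrite -[_ ∘ (fmap F (amul A) ⊠ _)]compA tfun2_natl fmapM !compA.
Qed.

Lemma tfun_alg_C (A : algebra P) :
  fmap F (amul A) ∘ tfun2 F A A ∘ braid (F A) (F A) = fmap F (amul A) ∘ tfun2 F A A.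
Proof. by rewrite -[LHS]compA -tfun_braid compA -fmapM amulC. Qed.

Lemma tfun_alg_1 (A : algebra P) :
  (fmap F (amul A) ∘ tfun2 F A A) ∘ ((fmap F (aone A) ∘ tfun0 F) ⊠ idm (F A)) =
  lunit (F A).
Proof.
rewrite tensm_compl.
transitivity (fmap F (amul A) ∘ (tfun2 F A A ∘ (fmap F (aone A) ⊠ idm (F A))) ∘
  (tfun0 F ⊠ idm (F A))); first by rewrite !compA.
by rewrite tfun2_natl !compA -fmapM amul1 tfun_lunit.
Qed.

Definition tfun_alg (A : algebra P) : algebra T :=
  @Algebra k T (F A) (fmap F (amul A) ∘ tfun2 F A A) (fmap F (aone A) ∘ tfun0 F)
    (tfun_alg_A A) (tfun_alg_C A) (tfun_alg_1 A).

Definition tfun_ev (X D : P) (ev : hom (D ⊗ X) 𝟙) : hom (F D ⊗ F X) 𝟙 :=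
  tfun0V F ∘ fmap F ev ∘ tfun2 F D X.
Definition tfun_coev (X D : P) (coev : hom 𝟙 (X ⊗ D)) : hom 𝟙 (F X ⊗ F D) :=
  tfun2V F X D ∘ fmap F coev ∘ tfun0 F.

Lemma tfun_coevr (W X D : P) (coev : hom 𝟙 (X ⊗ D)) :
  tfun2 F W (X ⊗ D) ∘ (idm (F W) ⊠ tfun2 F X D) ∘ (idm (F W) ⊠ tfun_coev coev) ∘
    runitV (F W) = fmap F (idm W ⊠ coev) ∘ fmap F (runitV W).
Proof.
rewrite -[_ ∘ (_ ⊠ tfun_coev _)]compA -tensm_compr /tfun_coev !compA tfun2VK comp1m.
by rewrite tensm_compr compA tfun2_natr -!compA compA -tfun_runitVE !compA.
Qed.

Lemma tfun_coevl (W X D : P) (coev : hom 𝟙 (X ⊗ D)) :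
  tfun2 F (X ⊗ D) W ∘ (tfun2 F X D ⊠ idm (F W)) ∘ (tfun_coev coev ⊠ idm (F W)) ∘
    lunitV (F W) = fmap F (coev ⊠ idm W) ∘ fmap F (lunitV W).
Proof.
rewrite -[_ ∘ (tfun_coev _ ⊠ _)]compA -tensm_compl /tfun_coev !compA tfun2VK comp1m.
by rewrite tensm_compl compA tfun2_natl -!compA compA -tfun_lunitVE !compA.
Qed.

Lemma tfun_duality (X D : P) (ev : hom (D ⊗ X) 𝟙) (coev : hom 𝟙 (X ⊗ D)) :
  is_duality ev coev -> is_duality (tfun_ev ev) (tfun_coev coev).
Proof.
move=> [s1 s2]; split.
- transitivity (runit (F X) ∘ (idm (F X) ⊠ tfun0V F) ∘ (idm (F X) ⊠ fmap F ev) ∘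
    (idm (F X) ⊠ tfun2 F D X) ∘ assoc (F X) (F D) (F X) ∘ (tfun_coev coev ⊠ idm (F X)) ∘
    lunitV (F X)); first by rewrite /tfun_ev !tensm_compr !compA.
  rewrite tfun_runitE -[_ ∘ (_ ⊠ fmap F ev)]compA tfun2_natr.
  transitivity (fmap F (runit X) ∘ fmap F (idm X ⊠ ev) ∘
    (tfun2 F X (D ⊗ X) ∘ (idm (F X) ⊠ tfun2 F D X) ∘ assoc (F X) (F D) (F X)) ∘
    (tfun_coev coev ⊠ idm (F X)) ∘ lunitV (F X)); first by rewrite !compA.
  rewrite -tfun_assoc.
  transitivity (fmap F (runit X) ∘ fmap F (idm X ⊠ ev) ∘ fmap F (assoc X D X) ∘
    (tfun2 F (X ⊗ D) X ∘ (tfun2 F X D ⊠ idm (F X)) ∘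
    (tfun_coev coev ⊠ idm (F X)) ∘ lunitV (F X))); first by rewrite !compA.
  by rewrite tfun_coevl !compA -!fmapM s1 fmap1.
- transitivity (lunit (F D) ∘ (tfun0V F ⊠ idm (F D)) ∘ (fmap F ev ⊠ idm (F D)) ∘
    (tfun2 F D X ⊠ idm (F D)) ∘ assocV (F D) (F X) (F D) ∘ (idm (F D) ⊠ tfun_coev coev) ∘
    runitV (F D)); first by rewrite /tfun_ev !tensm_compl !compA.
  rewrite tfun_lunitE -[_ ∘ (fmap F ev ⊠ _)]compA tfun2_natl.
  transitivity (fmap F (lunit D) ∘ fmap F (ev ⊠ idm D) ∘
    (tfun2 F (D ⊗ X) D ∘ (tfun2 F D X ⊠ idm (F D)) ∘ assocV (F D) (F X) (F D)) ∘
    (idm (F D) ⊠ tfun_coev coev) ∘ runitV (F D)); first by rewrite !compA.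
  rewrite tfun_assocVE.
  transitivity (fmap F (lunit D) ∘ fmap F (ev ⊠ idm D) ∘ fmap F (assocV D X D) ∘
    (tfun2 F D (X ⊗ D) ∘ (idm (F D) ⊠ tfun2 F X D) ∘
    (idm (F D) ⊠ tfun_coev coev) ∘ runitV (F D))); first by rewrite !compA.
  by rewrite tfun_coevr !compA -!fmapM s2 fmap1.
Qed.

Definition tfun_dual (X : P) (D : dual X) : dual (F X) :=
  Dual (tfun_duality (dualP D)).

Lemma tfun_trace (A : algebra P) (D : dual A) :
  trace_map (A := tfun_alg A) (tfun_dual D) = tfun0V F ∘ fmap F (trace_map D).
Proof.
rewrite /trace_map /= /tfun_ev.
rewrite -[_ ∘ braid _ _]compA -tfun_braid tensm_compl.
set B := dobj D.
transitivity (tfun0V F ∘ fmap F (dev D) ∘ fmap F (braid A B) ∘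
  (tfun2 F A B ∘ (fmap F (amul A) ⊠ idm (F B))) ∘ (tfun2 F A A ⊠ idm (F B)) ∘
  assocV (F A) (F A) (F B) ∘ (idm (F A) ⊠ tfun_coev (dcoev D)) ∘ runitV (F A)).
  by rewrite !compA.
rewrite tfun2_natl.
transitivity (tfun0V F ∘ fmap F (dev D) ∘ fmap F (braid A B) ∘ fmap F (amul A ⊠ idm B) ∘
  (tfun2 F (A ⊗ A) B ∘ (tfun2 F A A ⊠ idm (F B)) ∘
  assocV (F A) (F A) (F B)) ∘ (idm (F A) ⊠ tfun_coev (dcoev D)) ∘ runitV (F A)).
  by rewrite !compA.
rewrite tfun_assocVE.
transitivity (tfun0V F ∘ fmap F (dev D) ∘ fmap F (braid A B) ∘ fmap F (amul A ⊠ idm B) ∘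
  fmap F (assocV A A B) ∘ (tfun2 F A (A ⊗ B) ∘ (idm (F A) ⊠ tfun2 F A B) ∘
  (idm (F A) ⊠ tfun_coev (dcoev D)) ∘ runitV (F A))).
  by rewrite !compA.
by rewrite tfun_coevr !fmapM !compA.
Qed.

Lemma tfun_etale (A : algebra P) : etale A -> etale (tfun_alg A).
Proof.
move=> [D [c cP]]; exists (tfun_dual D); exists (tfun_coev c).
rewrite tfun_trace /=.
have -> : tfun0V F ∘ fmap F (trace_map D) ∘ (fmap F (amul A) ∘ tfun2 F A A) =
  tfun_ev (trace_map D ∘ amul A) by rewrite /tfun_ev fmapM !compA.
exact: tfun_duality.
Qed.

Lemma tfun_algM (A B : algebra P) (f : alg_hom A B) :
  fmap F f ∘ amul (tfun_alg A) = amul (tfun_alg B) ∘ (fmap F f ⊠ fmap F f).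
Proof. by rewrite /= -[RHS]compA tfun2_nat !compA -!fmapM ahomM. Qed.

Lemma tfun_alg1 (A B : algebra P) (f : alg_hom A B) :
  fmap F f ∘ aone (tfun_alg A) = aone (tfun_alg B).
Proof. by rewrite /= compA -fmapM ahom1. Qed.

Definition tfun_alg_hom (A B : algebra P) (f : alg_hom A B) :
  alg_hom (tfun_alg A) (tfun_alg B) :=
  @AlgHom k T (tfun_alg A) (tfun_alg B) (fmap F f) (tfun_algM f) (tfun_alg1 f).

End Transfer.

Section TransferTrans.
Variables (k : fieldType) (P T : tensorCat k) (F F' : tensor_functor P T).
Variable a : monoidal_trans F F'.

Lemma mtrans_iso (X : P) : dual X -> is_iso (a X).
Proof.
move=> D; set B := dobj D.
apply: (dual_iso (d := a B) (tfun_duality F (dualP D)) (tfun_duality F' (dualP D))).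
- rewrite /tfun_ev -[LHS]compA -mtrans2 !compA -[_ ∘ fmap F' _ ∘ _]compA -ntP.
  congr (_ ∘ _); rewrite compA; congr (_ ∘ _).
  rewrite -[LHS]compm1 -(tfun0VK F) compA -[_ ∘ a 𝟙 ∘ _]compA.
  by rewrite (mtrans0 a) tfun0K comp1m.
- rewrite /tfun_coev !compA.
  have -> : (a X ⊠ a B) ∘ tfun2V F X B = tfun2V F' X B ∘ a (X ⊗ B).
    rewrite -[LHS]comp1m -(tfun2K F') -compA [tfun2 F' X B ∘ _]compA -mtrans2.
    by rewrite -[a _ ∘ _ ∘ _]compA tfun2VK compm1.
  by rewrite -[tfun2V _ _ _ ∘ a _ ∘ _]compA ntP -(mtrans0 a) !compA.
Qed.

Lemma mtrans_algM (A : algebra P) :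
  a A ∘ amul (tfun_alg F A) = amul (tfun_alg F' A) ∘ (a A ⊠ a A).
Proof. by rewrite /= compA ntP -!compA mtrans2. Qed.

Lemma mtrans_alg1 (A : algebra P) : a A ∘ aone (tfun_alg F A) = aone (tfun_alg F' A).
Proof. by rewrite /= compA ntP -compA mtrans0. Qed.

Definition mtrans_alg_hom (A : algebra P) : alg_hom (tfun_alg F A) (tfun_alg F' A) :=
  @AlgHom k T (tfun_alg F A) (tfun_alg F' A) (a A) (mtrans_algM A) (mtrans_alg1 A).

End TransferTrans.

Lemma alg_hom_iso (k : fieldType) (T : tensorCat k) (A B : algebra T) (f : alg_hom A B) :
  is_iso (ahom f) -> @is_iso (alg_cat T) A B f.
Proof.
move=> [g [gf fg]].
have gM : g ∘ amul B = amul A ∘ (g ⊠ g).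
  rewrite -[LHS]compm1 -tensm1 -fg tensmM -compA [amul B ∘ _]compA -ahomM.
  by rewrite !compA gf comp1m.
have g1 : g ∘ aone B = aone A by rewrite -(ahom1 f) compA gf comp1m.
by exists (@AlgHom k T B A g gM g1); split; apply: alg_hom_ext.
Qed.

Lemma nat_trans_iso (C D : category) (F F' : functor C D) (a : nat_trans F F') :
  (forall X, is_iso (a X)) -> @is_iso (functor_cat C D) F F' a.
Proof.
move=> aI; pose b X := projT1 (cid (aI X)).
have ba X : b X ∘ a X = idm _ by rewrite /b; case: cid => ? [].
have ab X : a X ∘ b X = idm _ by rewrite /b; case: cid => ? [].
have bP X Y (f : hom X Y) : b Y ∘ fmap F' f = fmap F f ∘ b X.
  by rewrite -[LHS]compm1 -ab compA -[_ ∘ a X]compA -ntP !compA ba comp1m.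
by exists (NatTrans bP); split; apply: nat_trans_ext => X /=.
Qed.

Section Psi.
Variables (k : fieldType) (G : proOligoGroup) (mu : measure G k) (T : tensorCat k).

Lemma perm_pullM (X Y : sgset G) (f : gmap Y X) :
  mxcomp mu (pullmx k f) (pullmx k (gdiag X)) =
  mxcomp mu (pullmx k (gdiag Y)) (kron (pullmx k f) (pullmx k f)).
Proof. by rewrite kron_pullmx !pullmxM; exact: pullmx_eq. Qed.

Lemma perm_pull1 (X Y : sgset G) (f : gmap Y X) :
  mxcomp mu (pullmx k f) (pullmx k (gterm X)) = pullmx k (gterm Y).
Proof. by rewrite pullmxM; exact: pullmx_eq. Qed.

Definition perm_pull (X Y : sgset G) (f : gmap Y X) :
    alg_hom (perm_alg mu X) (perm_alg mu Y) :=
  @AlgHom k (Perm mu) (perm_alg mu X) (perm_alg mu Y) (pullmx k f)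
    (perm_pullM f) (perm_pull1 f).

Section OnObjects.
Variable Phi : tensor_functor (Perm mu) T.

Definition psi_ob (X : op (S_cat G)) : et_cat T :=
  exist _ (tfun_alg Phi (perm_alg mu X)) (tfun_etale Phi (perm_etale mu X)).

Definition psi_map (X Y : op (S_cat G)) (f : hom X Y) : hom (psi_ob X) (psi_ob Y) :=
  tfun_alg_hom Phi (perm_pull f).

Lemma psi_map1 X : psi_map (idm X) = idm (psi_ob X).
Proof. by apply: alg_hom_ext; exact: (fmap1 Phi). Qed.

Lemma psi_mapM X Y Z (g : hom Y Z) (f : hom X Y) : psi_map (g ∘ f) = psi_map g ∘ psi_map f.
Proof.
apply: alg_hom_ext; rewrite /= -(fmapM Phi); congr (fmap Phi _).
by apply/esym; exact: pullmxM.
Qed.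

Definition psi : functor (op (S_cat G)) (et_cat T) := Functor psi_map1 psi_mapM.

End OnObjects.

Section OnMorphisms.
Variables (Phi Phi' : tensor_functor (Perm mu) T) (a : monoidal_trans Phi Phi').

Definition psi_trans : nat_trans (psi Phi) (psi Phi').
Proof.
exists (fun X : op (S_cat G) => mtrans_alg_hom a (perm_alg mu X)) => X Y f.
by apply: alg_hom_ext; exact: (ntP a).
Defined.

Lemma psi_trans_iso :
  @is_iso (functor_cat (op (S_cat G)) (et_cat T)) (psi Phi) (psi Phi') psi_trans.
Proof.
apply: nat_trans_iso => X; apply: (@alg_hom_iso k T).
exact: (mtrans_iso a (perm_dual mu X)).
Qed.

End OnMorphisms.

Definition psi_functor : functor (tensor_functor_cat (Perm mu) T)
    (isom_cat (functor_cat (op (S_cat G)) (et_cat T))).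
Proof.
refine (@Functor (tensor_functor_cat (Perm mu) T)
  (isom_cat (functor_cat (op (S_cat G)) (et_cat T))) psi
  (fun Phi Phi' a => IsoHom (psi_trans_iso a)) _ _).
- by move=> Phi; apply: iso_hom_ext; apply: nat_trans_ext => X; exact: alg_hom_ext.
- move=> Phi Phi' Phi'' b a; apply: iso_hom_ext; apply: nat_trans_ext => X.
  exact: alg_hom_ext.
Defined.

(** [Psi] is given by its opposite; [Psi f] is the map of étale algebras
    [Psi X ⟶ Psi Y] induced by [f : Y ⟶ X]. *)
Definition compatible (Psi : functor (op (S_cat G)) (et_cat T)) : Prop :=
  forall (X Y : sgset G) (f : gmap Y X) (tX : transitive_gset X),
    is_zero_object (Psi X : T) \/
    exists fU : uniform (@fmap (op (S_cat G)) (et_cat T) Psi X Y f),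
      gamma fU = mval_finitary mu tX f.

Definition admissible (Psi : functor (op (S_cat G)) (et_cat T)) : Prop :=
  [/\ left_exact (op_functor Psi), additive_functor (op_functor Psi) & compatible Psi].

End Psi.

(* Main.v *)
From mathcomp Require Import all_boot all_algebra.
From mathcomp Require Import all_classical topology.
Require Import Defs.

(** A map [f : Y ⟶ X] of [G]-sets acts on [C(X)] both by [f^*] and by its transpose [f_*] under
    the trace pairings, and every invariant matrix is a linear combination of composites
    [q_* p^*] (one for each orbit of [Y × X]). A tensor functor [Phi] sends transposes to
    transposes, so it is determined by the algebra maps [Phi f^*], and isomorphisms of
    algebras, which respect traces, commute with all matrices.

    Conversely let [Psi] be left exact, additive and compatible with [mu]. Additivity splits
    [Psi Z] as the direct sum of its orbits, which makes invariant functions act on it by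
    operators [mult a]; compatibility says that [f_* ∘ mult a ∘ f^*] is [mult] of the integral of
    [a] along the fibres of [f]; left exactness gives [Psi (X × Y) = Psi X ⊗ Psi Y], hence base
    change for products. So [A ↦ gfst_* ∘ mult A ∘ gsnd^*] is functorial and monoidal.

    Left exactness of [Phi (C(-))]: a finite limit [L] is a union of orbits of a product [P],
    [Phi (C(P))] is a coproduct of commutative algebras, and an algebra map out of it that is
    compatible with the diagram kills the orbits of [P] outside [L]. *)

Set Implicit Arguments.
Unset Strict Implicit.
Unset Printing Implicit Defensive.

Import GRing.Theory.
Local Open Scope classical_set_scope.
Local Open Scope ring_scope.
Local Open Scope cat_scope.

(** * Coherence in symmetric monoidal categories *)

(** The trace of an étale algebra goes through a chosen dual, and its copairing is chosen too, so
    neither can be computed directly. [etale_form] removes the choice: a form [e] whose dual bases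
    [c] satisfy [m c = 1] must be the trace. The unit algebra, tensor products and finite products
    are shown to be étale by exhibiting such a pair, and transposes are identified by testing
    against the trace pairing.

    Compatibility constrains only the point [f_* 1], and only over a transitive base. The projection
    formula turns it into [f_* f^* = μ(f)] on all of [Psi X], and the splitting into orbits turns
    that scalar into integration along arbitrary maps.

    Composition of matrices needs base change over the middle [G]-set. The fibre product of [Z × Y]
    and [Y × X] over [Y] is [Z × Y × X], so base change along a product projection suffices, and
    this follows from [Psi (Z × Y) = Psi Z ⊗ Psi Y].

    The monoidal categories are not strict. The algebra structure of [A ⊗ B] therefore rests on the
    middle-four interchange [mid], whose coherence is derived from the pentagon, triangle and
    hexagon. *)

Section Whisker.
Variable C : category.

(** Composites are kept nested to the right. In that form an equation between short composites
    applies at any position only after a tail [a] has been attached to both sides. *)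
Lemma whisk2 (X Y Z W : C) (g : hom Y Z) (f : hom X Y) (h : hom X Z) :
  g ∘ f = h -> forall a : hom W X, g ∘ (f ∘ a) = h ∘ a.
Proof. by move=> <- a; rewrite compA. Qed.

Lemma whisk3 (X Y Z V W : C) (g : hom Y Z) (f : hom X Y) (e : hom V X) (h : hom V Z) :
  g ∘ (f ∘ e) = h -> forall a : hom W V, g ∘ (f ∘ (e ∘ a)) = h ∘ a.
Proof. by move=> <- a; rewrite !compA. Qed.

Lemma cancel_epi (X Y Z : C) (f : hom X Y) (f' : hom Y X) (g h : hom Y Z) :
  f ∘ f' = idm Y -> g ∘ f = h ∘ f -> g = h.
Proof. by move=> e gh; rewrite -[g]compm1 -[h]compm1 -e !compA gh. Qed.

Lemma cancel_mono (X Y Z : C) (f : hom Y Z) (f' : hom Z Y) (g h : hom X Y) :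
  f' ∘ f = idm Y -> f ∘ g = f ∘ h -> g = h.
Proof. by move=> e gh; rewrite -[g]comp1m -[h]comp1m -e -!compA gh. Qed.

End Whisker.

Section LinearComposition.
Variables (k : fieldType) (C : linCat k).
Implicit Types X Y Z : C.

Lemma compDr X Y Z (g : hom Y Z) (f f' : hom X Y) : g ∘ (f + f') = g ∘ f + g ∘ f'.
Proof. by have := lcomp_linr g 1 f f'; rewrite !scale1r. Qed.

Lemma compDl X Y Z (g g' : hom Y Z) (f : hom X Y) : (g + g') ∘ f = g ∘ f + g' ∘ f.
Proof. by have := lcomp_linl f 1 g g'; rewrite !scale1r. Qed.

Lemma comp0r X Y Z (g : hom Y Z) : g ∘ (0 : hom X Y) = 0.
Proof. by apply: (addrI (g ∘ 0)); rewrite -compDr !addr0. Qed.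

Lemma comp0l X Y Z (f : hom X Y) : (0 : hom Y Z) ∘ f = 0.
Proof. by apply: (addrI (0 ∘ f)); rewrite -compDl !addr0. Qed.

Lemma compZr X Y Z c (g : hom Y Z) (f : hom X Y) : g ∘ (c *: f) = c *: (g ∘ f).
Proof.
have e : g ∘ (c *: f + 0) = c *: (g ∘ f) + g ∘ 0 := lcomp_linr g c f 0.
by move: e; rewrite comp0r !addr0.
Qed.

Lemma compZl X Y Z c (g : hom Y Z) (f : hom X Y) : (c *: g) ∘ f = c *: (g ∘ f).
Proof.
have e : (c *: g + 0) ∘ f = c *: (g ∘ f) + 0 ∘ f := lcomp_linl f c g 0.
by move: e; rewrite comp0l !addr0.
Qed.

Lemma comp_sumr X Y Z (g : hom Y Z) I (r : seq I) (P : pred I) (F : I -> hom X Y) :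
  g ∘ (\sum_(i <- r | P i) F i) = \sum_(i <- r | P i) g ∘ F i.
Proof. by apply: big_morph => [f f'|]; [exact: compDr | exact: comp0r]. Qed.

Lemma comp_suml X Y Z (f : hom X Y) I (r : seq I) (P : pred I) (F : I -> hom Y Z) :
  (\sum_(i <- r | P i) F i) ∘ f = \sum_(i <- r | P i) F i ∘ f.
Proof. by apply: (big_morph (fun g => g ∘ f)) => [g g'|]; [exact: compDl | exact: comp0l]. Qed.

End LinearComposition.

Section LinearTensor.
Variables (k : fieldType) (T : tensorCat k).
Implicit Types X Y : T.

Lemma tensmDr X X' Y Y' (f : hom X X') (g g' : hom Y Y') : f ⊠ (g + g') = f ⊠ g + f ⊠ g'.
Proof. by have := tensm_linr f 1 g g'; rewrite !scale1r. Qed.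

Lemma tensmDl X X' Y Y' (f f' : hom X X') (g : hom Y Y') : (f + f') ⊠ g = f ⊠ g + f' ⊠ g.
Proof. by have := tensm_linl g 1 f f'; rewrite !scale1r. Qed.

Lemma tensm0r X X' Y Y' (f : hom X X') : f ⊠ (0 : hom Y Y') = 0.
Proof. by apply: (addrI (f ⊠ 0)); rewrite -tensmDr !addr0. Qed.

Lemma tensm0l X X' Y Y' (g : hom Y Y') : (0 : hom X X') ⊠ g = 0.
Proof. by apply: (addrI (0 ⊠ g)); rewrite -tensmDl !addr0. Qed.

Lemma tensmZr X X' Y Y' c (f : hom X X') (g : hom Y Y') : f ⊠ (c *: g) = c *: (f ⊠ g).
Proof. by have := tensm_linr f c g 0; rewrite !addr0 tensm0r addr0. Qed.

Lemma tensmZl X X' Y Y' c (f : hom X X') (g : hom Y Y') : (c *: f) ⊠ g = c *: (f ⊠ g).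
Proof. by have := tensm_linl g c f 0; rewrite !addr0 tensm0l addr0. Qed.

Lemma tensm_sumr X X' Y Y' (f : hom X X') I (r : seq I) (P : pred I) (F : I -> hom Y Y') :
  f ⊠ (\sum_(i <- r | P i) F i) = \sum_(i <- r | P i) f ⊠ F i.
Proof. by apply: big_morph => [g g'|]; [exact: tensmDr | exact: tensm0r]. Qed.

Lemma tensm_suml X X' Y Y' (g : hom Y Y') I (r : seq I) (P : pred I) (F : I -> hom X X') :
  (\sum_(i <- r | P i) F i) ⊠ g = \sum_(i <- r | P i) F i ⊠ g.
Proof. by apply: (big_morph (fun f => f ⊠ g)) => [f f'|]; [exact: tensmDl | exact: tensm0l]. Qed.

End LinearTensor.

Section Coherence.
Variables (k : fieldType) (T : tensorCat k).
Implicit Types X Y Z W V : T.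

Lemma tensm_swap X X' Y Y' (f : hom X X') (g : hom Y Y') :
  (f ⊠ idm Y') ∘ (idm X ⊠ g) = (idm X' ⊠ g) ∘ (f ⊠ idm Y).
Proof. by rewrite -!tensmM !comp1m !compm1. Qed.

Lemma tensm_splitl X X' Y Y' (f : hom X X') (g : hom Y Y') :
  f ⊠ g = (f ⊠ idm Y') ∘ (idm X ⊠ g).
Proof. by rewrite -tensmM comp1m compm1. Qed.

Lemma tensm_splitr X X' Y Y' (f : hom X X') (g : hom Y Y') :
  f ⊠ g = (idm X' ⊠ g) ∘ (f ⊠ idm Y).
Proof. by rewrite -tensmM comp1m compm1. Qed.

Lemma assocV_nat X X' Y Y' Z Z' (f : hom X X') (g : hom Y Y') (h : hom Z Z') :
  assocV X' Y' Z' ∘ (f ⊠ (g ⊠ h)) = ((f ⊠ g) ⊠ h) ∘ assocV X Y Z.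
Proof.
apply: (cancel_mono (assocK X' Y' Z')).
by rewrite !compA assoc_nat assocVK comp1m -compA assocVK compm1.
Qed.

Lemma runitV_nat X Y (f : hom X Y) : runitV Y ∘ f = (f ⊠ idm 𝟙) ∘ runitV X.
Proof.
apply: (cancel_mono (runitK Y)).
by rewrite !compA runit_nat runitVK comp1m -compA runitVK compm1.
Qed.

Lemma tens1_faithful X Y (f g : hom X Y) : f ⊠ idm 𝟙 = g ⊠ idm 𝟙 -> f = g.
Proof.
by move=> e; apply: (cancel_epi (runitVK X)); rewrite -!runit_nat e.
Qed.

Lemma tens1l_faithful X Y (f g : hom X Y) : idm 𝟙 ⊠ f = idm 𝟙 ⊠ g -> f = g.
Proof.
by move=> e; apply: (cancel_epi (lunitVK X)); rewrite -!lunit_nat e.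
Qed.

Lemma tensm_whiskl X Y Z V (g : hom Y Z) (f : hom X Y) (h : hom X Z) :
  g ∘ f = h -> (idm V ⊠ g) ∘ (idm V ⊠ f) = idm V ⊠ h.
Proof. by move=> <-; rewrite tensm_compr. Qed.

Lemma tensm_whiskr X Y Z V (g : hom Y Z) (f : hom X Y) (h : hom X Z) :
  g ∘ f = h -> (g ⊠ idm V) ∘ (f ⊠ idm V) = h ⊠ idm V.
Proof. by move=> <-; rewrite tensm_compl. Qed.

Lemma pentagonE X Y Z W :
  (idm X ⊠ assoc Y Z W) ∘ (assoc X (Y ⊗ Z) W ∘ (assoc X Y Z ⊠ idm W)) =
  assoc X Y (Z ⊗ W) ∘ assoc (X ⊗ Y) Z W.
Proof. by rewrite pentagon !compA. Qed.

(** Kelly's argument: after tensoring with [𝟙] on the left and composing with invertible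
    associators, the identity becomes a pentagon whose unit factors are removed by two triangles. *)
Lemma lunit_tens X Y : lunit (X ⊗ Y) ∘ assoc 𝟙 X Y = lunit X ⊠ idm Y.
Proof.
apply: tens1l_faithful; rewrite tensm_compr.
apply: (cancel_epi (assocVK 𝟙 (𝟙 ⊗ X) Y)).
apply: (@cancel_epi _ _ _ _ (assoc 𝟙 𝟙 X ⊠ idm Y) (assocV 𝟙 𝟙 X ⊠ idm Y)).
  by rewrite (tensm_whiskr _ (assocVK _ _ _)) tensm1.
rewrite -!compA pentagonE compA triangle (whisk2 (esym (assoc_nat _ _ _))) -tensm1.
rewrite -assoc_nat -compA; congr (_ ∘ _).
by rewrite -triangle tensm_compl.
Qed.

Lemma runit_tens X Y : (idm X ⊠ runit Y) ∘ assoc X Y 𝟙 = runit (X ⊗ Y).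
Proof.
apply: tens1_faithful; apply: (cancel_mono (assocK X Y 𝟙)).
rewrite tensm_compl compA assoc_nat -triangle tensm_compr -!compA.
rewrite pentagonE -(triangle (X ⊗ Y)) !compA; congr (_ ∘ _).
by rewrite -[in RHS]tensm1 assoc_nat.
Qed.

(** Naturality of [lunit] at [lunit 𝟙] itself gives [lunit (𝟙 ⊗ 𝟙) = idm 𝟙 ⊠ lunit 𝟙]. This
    identifies the two sides once they are tensored with [𝟙]. *)
Lemma lunit_runit1 : lunit 𝟙 = runit 𝟙 :> hom (𝟙 ⊗ 𝟙 : T) 𝟙.
Proof.
apply: tens1_faithful; rewrite -triangle -lunit_tens; congr (_ ∘ _).
by apply: (cancel_mono (lunitK 𝟙)); rewrite lunit_nat.
Qed.

(** The hexagon for [X], [𝟙], [𝟙] with its unit factors removed; the copy of [braid X 𝟙] left over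
    on both sides is invertible and cancels. *)
Lemma lunit_braid X : lunit X ∘ braid X 𝟙 = runit X.
Proof.
apply: tens1_faithful; apply: (cancel_mono (braidK X 𝟙)).
have := congr1 (fun u => lunit (𝟙 ⊗ X) ∘ u) (hexagon X 𝟙 𝟙).
rewrite -!compA !(whisk2 (lunit_tens _ _)) (whisk2 (lunit_nat _)).
rewrite -!compA (whisk2 (lunit_tens _ _)).
rewrite (whisk2 (esym (braid_nat _ _))) -!compA triangle => ->.
by rewrite tensm_compl.
Qed.

Lemma runit_braid X : runit X ∘ braid 𝟙 X = lunit X.
Proof. by rewrite -lunit_braid -compA braidK compm1. Qed.

(** [exch] and [mid] are locked so that rewriting with [compA] does not see through them. *)
Definition exch X Y W : hom (X ⊗ (Y ⊗ W)) (Y ⊗ (X ⊗ W)) :=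
  locked (assoc Y X W ∘ ((braid X Y ⊠ idm W) ∘ assocV X Y W)).

Lemma exchE X Y W : exch X Y W = assoc Y X W ∘ ((braid X Y ⊠ idm W) ∘ assocV X Y W).
Proof. by rewrite /exch -lock. Qed.

Lemma exch_nat X X' Y Y' W W' (f : hom X X') (g : hom Y Y') (h : hom W W') :
  exch X' Y' W' ∘ (f ⊠ (g ⊠ h)) = (g ⊠ (f ⊠ h)) ∘ exch X Y W.
Proof.
rewrite !exchE -!compA assocV_nat (whisk2 (esym (tensmM _ _ _ _))) braid_nat.
by rewrite comp1m -[h in LHS]compm1 tensmM -!compA (whisk2 (assoc_nat _ _ _)) -!compA.
Qed.

Lemma exchK X Y W : exch Y X W ∘ exch X Y W = idm _.
Proof.
rewrite !exchE -!compA (whisk2 (assocK _ _ _)) comp1m.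
by rewrite (whisk2 (tensm_whiskr _ (braidK _ _))) tensm1 comp1m assocVK.
Qed.

(** The hexagon solved for [braid Y (Z ⊗ Z')], with a spectator factor [W]; the pentagons serve only
    to move the brackets around [W]. *)
Lemma exch_tensr Y Z Z' W :
  assoc Z Z' (Y ⊗ W) ∘ exch Y (Z ⊗ Z') W =
  (idm Z ⊠ exch Y Z' W) ∘ (exch Y Z (Z' ⊗ W) ∘ (idm Y ⊠ assoc Z Z' W)).
Proof.
have hex : braid Y (Z ⊗ Z') = assocV Z Z' Y ∘ ((idm Z ⊠ braid Y Z') ∘
    (assoc Z Y Z' ∘ ((braid Y Z ⊠ idm Z') ∘ assocV Y Z Z'))).
  apply: (cancel_mono (assocK Z Z' Y)); apply: (cancel_epi (assocVK Y Z Z')).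
  by rewrite hexagon -!compA assocK compm1 (whisk2 (assocVK _ _ _)) comp1m.
rewrite !exchE hex !tensm_compl !tensm_compr -!compA.
have p1 : assoc Z Z' (Y ⊗ W) ∘ (assoc (Z ⊗ Z') Y W ∘ (assocV Z Z' Y ⊠ idm W)) =
    (idm Z ⊠ assoc Z' Y W) ∘ assoc Z (Z' ⊗ Y) W.
  apply: (@cancel_epi _ _ _ _ (assoc Z Z' Y ⊠ idm W) (assocV Z Z' Y ⊠ idm W)).
    by rewrite (tensm_whiskr _ (assocVK _ _ _)) tensm1.
  by rewrite -!compA (tensm_whiskr _ (assocK _ _ _)) tensm1 compm1 pentagonE.
rewrite (whisk3 p1) -!compA; congr (_ ∘ _).
rewrite (whisk2 (assoc_nat _ _ _)) -!compA; congr (_ ∘ _).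
have p2 : (idm Z ⊠ assocV Y Z' W) ∘ (assoc Z Y (Z' ⊗ W) ∘ assoc (Z ⊗ Y) Z' W) =
    assoc Z (Y ⊗ Z') W ∘ (assoc Z Y Z' ⊠ idm W).
  by rewrite -pentagonE (whisk2 (tensm_whiskl _ (assocK _ _ _))) tensm1 comp1m.
rewrite (whisk2 (esym p2)) -!compA; do 2!congr (_ ∘ _).
rewrite (whisk2 (assoc_nat _ _ _)) -!compA tensm1; congr (_ ∘ _).
have -> : idm Y ⊠ assoc Z Z' W =
    assoc Y Z (Z' ⊗ W) ∘ (assoc (Y ⊗ Z) Z' W ∘ ((assocV Y Z Z' ⊠ idm W) ∘ assocV Y (Z ⊗ Z') W)).
  apply: (cancel_epi (assocVK Y (Z ⊗ Z') W)).
  rewrite -!compA assocK compm1.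
  apply: (@cancel_epi _ _ _ _ (assoc Y Z Z' ⊠ idm W) (assocV Y Z Z' ⊠ idm W)).
    by rewrite (tensm_whiskr _ (assocVK _ _ _)) tensm1.
  by rewrite -!compA (tensm_whiskr _ (assocK _ _ _)) tensm1 compm1 pentagonE.
by rewrite (whisk2 (assocK _ _ _)) comp1m.
Qed.

(** [exch Y Z] and [exch Z Y] are mutually inverse, so this is [exch_tensr] read backwards. *)
Lemma exch_tensl Y Y' Z W :
  (idm Z ⊠ assoc Y Y' W) ∘ exch (Y ⊗ Y') Z W =
  exch Y Z (Y' ⊗ W) ∘ ((idm Y ⊠ exch Y' Z W) ∘ assoc Y Y' (Z ⊗ W)).
Proof.
apply: (cancel_epi (exchK (Y ⊗ Y') Z W)); rewrite -!compA exchK compm1 exch_tensr.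
rewrite (whisk2 (tensm_whiskl _ (exchK _ _ _))) tensm1 comp1m.
by rewrite (whisk2 (exchK _ _ _)) comp1m.
Qed.

Lemma exch_tens Y Z W V :
  (idm Z ⊠ assoc Y W V) ∘ (assoc Z (Y ⊗ W) V ∘ (exch Y Z W ⊠ idm V)) =
  exch Y Z (W ⊗ V) ∘ ((idm Y ⊠ assoc Z W V) ∘ assoc Y (Z ⊗ W) V).
Proof.
rewrite !exchE !tensm_compl (whisk3 (pentagonE _ _ _ _)) -!compA; congr (_ ∘ _).
rewrite (whisk2 (assoc_nat _ _ _)) tensm1 -!compA; congr (_ ∘ _).
apply: (cancel_mono (assocK Y Z (W ⊗ V))).
rewrite !(whisk2 (assocVK _ _ _)) comp1m (whisk2 (esym (pentagonE _ _ _ _))) -!compA.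
by rewrite (tensm_whiskr _ (assocVK _ _ _)) tensm1 compm1.
Qed.

Lemma exch1l A B : (idm A ⊠ lunit B) ∘ exch 𝟙 A B = lunit (A ⊗ B).
Proof.
rewrite exchE (whisk2 (triangle _ _)) (whisk2 (tensm_whiskr _ (runit_braid _))).
by rewrite -lunit_tens -compA assocVK compm1.
Qed.

Lemma braid_tensr X Z W : (idm Z ⊠ braid X W) ∘ exch X Z W = assoc Z W X ∘ braid X (Z ⊗ W).
Proof.
apply: (cancel_epi (assocVK X Z W)).
by rewrite hexagon exchE -!compA assocK compm1.
Qed.

Lemma braid_tensl X Y Z : braid (X ⊗ Y) Z = exch X Z Y ∘ ((idm X ⊠ braid Y Z) ∘ assoc X Y Z).
Proof.
apply: (cancel_epi (braidK (X ⊗ Y) Z)); rewrite braidK -!compA -braid_tensr.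
rewrite (whisk2 (tensm_whiskl _ (braidK _ _))) tensm1 comp1m.
by rewrite exchK.
Qed.

Definition mid X Y Z W : hom ((X ⊗ Y) ⊗ (Z ⊗ W)) ((X ⊗ Z) ⊗ (Y ⊗ W)) :=
  locked (assocV X Z (Y ⊗ W) ∘ ((idm X ⊠ exch Y Z W) ∘ assoc X Y (Z ⊗ W))).

Lemma midE X Y Z W :
  mid X Y Z W = assocV X Z (Y ⊗ W) ∘ ((idm X ⊠ exch Y Z W) ∘ assoc X Y (Z ⊗ W)).
Proof. by rewrite /mid -lock. Qed.

Lemma assoc_mid X Y Z W :
  assoc X Z (Y ⊗ W) ∘ mid X Y Z W = (idm X ⊠ exch Y Z W) ∘ assoc X Y (Z ⊗ W).
Proof. by rewrite midE (whisk2 (assocVK _ _ _)) comp1m. Qed.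

Lemma mid_nat X X' Y Y' Z Z' W W' (f : hom X X') (g : hom Y Y') (h : hom Z Z') (u : hom W W') :
  mid X' Y' Z' W' ∘ ((f ⊠ g) ⊠ (h ⊠ u)) = ((f ⊠ h) ⊠ (g ⊠ u)) ∘ mid X Y Z W.
Proof.
rewrite !midE -!compA assoc_nat (whisk2 (esym (tensmM _ _ _ _))) comp1m exch_nat.
rewrite -{1}[f]compm1 tensmM -!compA.
by rewrite (whisk2 (assocV_nat _ _ _)) -!compA.
Qed.

Lemma midK X Y Z W : mid X Z Y W ∘ mid X Y Z W = idm _.
Proof.
rewrite !midE -!compA (whisk2 (assocVK _ _ _)) comp1m.
by rewrite (whisk2 (tensm_whiskl _ (exchK _ _ _))) tensm1 comp1m assocK.
Qed.

Lemma mid_braid X Y Z W :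
  mid Z W X Y ∘ braid (X ⊗ Y) (Z ⊗ W) = (braid X Z ⊠ braid Y W) ∘ mid X Y Z W.
Proof.
apply: (cancel_mono (assocK Z X (W ⊗ Y))).
rewrite compA assoc_mid braid_tensl -compA (whisk2 (exch_tensr _ _ _ _)) -!compA.
rewrite (whisk2 (tensm_whiskl _ (exchK _ _ _))) tensm1 comp1m.
rewrite (whisk2 (tensm_whiskl _ (esym (braid_tensr _ _ _)))) tensm_compr.
rewrite !midE -!compA [braid X Z ⊠ _]tensm_splitl -!compA -[idm (X ⊗ Z) in RHS]tensm1.
rewrite (whisk2 (esym (assocV_nat _ _ _))) -!compA.
by rewrite !exchE -!compA.
Qed.

Lemma mid_lunit A B :
  (lunit A ⊠ lunit B) ∘ (mid 𝟙 𝟙 A B ∘ (lunitV 𝟙 ⊠ idm (A ⊗ B))) = lunit (A ⊗ B).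
Proof.
rewrite tensm_splitr -!compA -lunit_tens -!compA (whisk2 (assoc_mid _ _ _ _)) -!compA.
rewrite (whisk2 (esym (lunit_nat _))) -!compA (whisk2 (tensm_whiskl _ (exch1l _ _))).
rewrite (whisk2 (triangle _ _)) -lunit_runit1 (tensm_whiskr _ (lunitVK _)).
by rewrite tensm1 compm1.
Qed.

(** Both sides are brought to right-bracketed form, where they become the same sequence of
    exchanges: [R] moves [Y0] past [X1], then [S] moves [Y1] and [Y0] past [X2]. Associativity of
    [A ⊗ B] and duality for tensor products both reduce to this square. *)
Lemma mid_assoc X0 Y0 X1 Y1 X2 Y2 :
  mid X0 Y0 (X1 ⊗ X2) (Y1 ⊗ Y2) ∘ ((idm (X0 ⊗ Y0) ⊠ mid X1 Y1 X2 Y2) ∘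
    assoc (X0 ⊗ Y0) (X1 ⊗ Y1) (X2 ⊗ Y2)) =
  (assoc X0 X1 X2 ⊠ assoc Y0 Y1 Y2) ∘ (mid (X0 ⊗ X1) (Y0 ⊗ Y1) X2 Y2 ∘
    (mid X0 Y0 X1 Y1 ⊠ idm (X2 ⊗ Y2))).
Proof.
set V := X2 ⊗ Y2.
pose R := (idm X0 ⊠ (exch Y0 X1 (Y1 ⊗ V) ∘ (idm Y0 ⊠ assoc X1 Y1 V))) ∘
  (assoc X0 Y0 ((X1 ⊗ Y1) ⊗ V) ∘ assoc (X0 ⊗ Y0) (X1 ⊗ Y1) V).
pose S := exch Y0 X2 (Y1 ⊗ Y2) ∘ (idm Y0 ⊠ exch Y1 X2 Y2).
apply: (cancel_mono (assocK X0 (X1 ⊗ X2) (Y0 ⊗ (Y1 ⊗ Y2)))).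
apply: (@cancel_mono _ _ _ _ (idm X0 ⊠ assoc X1 X2 (Y0 ⊗ (Y1 ⊗ Y2)))
  (idm X0 ⊠ assocV X1 X2 (Y0 ⊗ (Y1 ⊗ Y2)))).
  by rewrite (tensm_whiskl _ (assocK _ _ _)) tensm1.
transitivity ((idm X0 ⊠ (idm X1 ⊠ S)) ∘ R).
  rewrite (whisk2 (assoc_mid _ _ _ _)) -!compA (whisk2 (tensm_whiskl _ (exch_tensr _ _ _ _))).
  rewrite -[idm (X0 ⊗ Y0)]tensm1 (whisk2 (assoc_nat _ _ _)) -!compA.
  rewrite !tensm_compr -!compA.
  rewrite (whisk2 (tensm_whiskl _ (tensm_whiskl _ (assoc_mid _ _ _ _)))).
  rewrite !tensm_compr -!compA (whisk2 (tensm_whiskl _ (exch_nat _ _ _))).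
  by rewrite /R /S !tensm_compr -!compA.
have p1 : (idm X0 ⊠ assoc X1 X2 (Y0 ⊗ (Y1 ⊗ Y2))) ∘ (assoc X0 (X1 ⊗ X2) (Y0 ⊗ (Y1 ⊗ Y2)) ∘
    (assoc X0 X1 X2 ⊠ assoc Y0 Y1 Y2)) =
  (idm X0 ⊠ (idm X1 ⊠ (idm X2 ⊠ assoc Y0 Y1 Y2))) ∘
    (assoc X0 X1 (X2 ⊗ ((Y0 ⊗ Y1) ⊗ Y2)) ∘ assoc (X0 ⊗ X1) X2 ((Y0 ⊗ Y1) ⊗ Y2)).
  rewrite [assoc X0 _ _ ⊠ _]tensm_splitl (whisk3 (pentagonE _ _ _ _)) -!compA.
  rewrite -[idm ((X0 ⊗ X1) ⊗ X2)]tensm1 assoc_nat -[idm (X0 ⊗ X1)]tensm1.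
  by rewrite (whisk2 (assoc_nat _ _ _)) -!compA.
rewrite (whisk3 p1) -!compA (whisk2 (assoc_mid _ _ _ _)) -!compA.
rewrite -[idm (X0 ⊗ X1)]tensm1 (whisk2 (assoc_nat _ _ _)) -!compA.
rewrite (whisk2 (tensm_whiskl _ (tensm_whiskl _ (exch_tensl _ _ _ _)))).
rewrite /S !tensm_compr -!compA; do 2!congr (_ ∘ _).
rewrite !midE !tensm_compl.
have p2 : (idm X0 ⊠ assocV X1 (Y0 ⊗ Y1) V) ∘ (assoc X0 X1 ((Y0 ⊗ Y1) ⊗ V) ∘
    (assoc (X0 ⊗ X1) (Y0 ⊗ Y1) V ∘ (assocV X0 X1 (Y0 ⊗ Y1) ⊠ idm V))) =
    assoc X0 (X1 ⊗ (Y0 ⊗ Y1)) V.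
  rewrite (whisk2 (esym (pentagonE _ _ _ _))) -!compA.
  rewrite (tensm_whiskr _ (assocVK _ _ _)) tensm1 compm1.
  by rewrite (whisk2 (tensm_whiskl _ (assocK _ _ _))) tensm1 comp1m.
have p3 : assoc X0 X1 ((Y0 ⊗ Y1) ⊗ V) ∘
    (assoc (X0 ⊗ X1) (Y0 ⊗ Y1) V ∘ (assocV X0 X1 (Y0 ⊗ Y1) ⊠ idm V)) =
    (idm X0 ⊠ assoc X1 (Y0 ⊗ Y1) V) ∘ assoc X0 (X1 ⊗ (Y0 ⊗ Y1)) V.
  by rewrite -p2 (whisk2 (tensm_whiskl _ (assocVK _ _ _))) tensm1 comp1m.
rewrite (whisk3 p3) -!compA (whisk2 (assoc_nat _ _ _)) -!compA.
rewrite !(whisk2 (esym (tensm_compr _ _ _))) exch_tens.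
rewrite /R !tensm_compr -!compA; do 2!congr (_ ∘ _).
by rewrite pentagonE.
Qed.

End Coherence.

(** * Étale algebras *)

Section Duality.
Variables (k : fieldType) (T : tensorCat k) (X D : T).
Variables (ev : hom (D ⊗ X) 𝟙) (coev : hom 𝟙 (X ⊗ D)).
Hypothesis dualXD : is_duality ev coev.

Lemma snake1 :
  runit X ∘ ((idm X ⊠ ev) ∘ (assoc X D X ∘ ((coev ⊠ idm X) ∘ lunitV X))) = idm X.
Proof. by case: dualXD => e _; rewrite -[RHS]e -!compA. Qed.

Lemma snake2 :
  lunit D ∘ ((ev ⊠ idm D) ∘ (assocV D X D ∘ ((idm D ⊠ coev) ∘ runitV D))) = idm D.
Proof. by case: dualXD => _ e; rewrite -[RHS]e -!compA. Qed.

(** The adjunction attached to a duality: [bend] turns a pairing with [D] into a map to [X], and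
    [cobend] turns a copairing with [X] into a map out of [D]. [bendK] and [cobendK] recover the
    original data. *)
Definition bend (W : T) (b : hom (D ⊗ W) 𝟙) : hom W X :=
  runit X ∘ ((idm X ⊠ b) ∘ (assoc X D W ∘ ((coev ⊠ idm W) ∘ lunitV W))).

Definition cobend (W : T) (u : hom 𝟙 (X ⊗ W)) : hom D W :=
  lunit W ∘ ((ev ⊠ idm W) ∘ (assocV D X W ∘ ((idm D ⊠ u) ∘ runitV D))).

Lemma bend_comp (W V : T) (b : hom (D ⊗ W) 𝟙) (h : hom V W) :
  bend b ∘ h = bend (b ∘ (idm D ⊠ h)).
Proof.
rewrite /bend -!compA lunitV_nat (whisk2 (tensm_swap _ _)) -!compA -tensm1.
by rewrite (whisk2 (assoc_nat _ _ _)) tensm_compr -!compA.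
Qed.

Lemma bendK (W : T) (b : hom (D ⊗ W) 𝟙) : ev ∘ (idm D ⊠ bend b) = b.
Proof.
have e1 : ev ∘ (idm D ⊠ runit X) = runit 𝟙 ∘ ((ev ⊠ idm 𝟙) ∘ assocV D X 𝟙).
  by rewrite compA runit_nat -compA -runit_tens -!compA assocVK compm1.
rewrite /bend !tensm_compr (whisk2 e1) -!compA (whisk2 (assocV_nat _ _ _)) tensm1 -!compA.
rewrite (whisk2 (tensm_swap _ _)) -!compA -lunit_runit1 (whisk2 (lunit_nat _)) -!compA.
rewrite -[RHS]compm1; congr (_ ∘ _).
have e2 : assocV D X (D ⊗ W) ∘ (idm D ⊠ assoc X D W) =
    assoc (D ⊗ X) D W ∘ ((assocV D X D ⊠ idm W) ∘ assocV D (X ⊗ D) W).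
  apply: (cancel_mono (assocK D X (D ⊗ W))); rewrite (whisk2 (assocVK _ _ _)) comp1m.
  rewrite (whisk2 (esym (pentagonE _ _ _ _))) -!compA.
  rewrite (whisk2 (tensm_whiskr _ (assocVK _ _ _))) tensm1 comp1m.
  by rewrite assocVK compm1.
rewrite (whisk2 e2) -!compA (whisk2 (assocV_nat _ _ _)) -!compA.
have -> : assocV D 𝟙 W ∘ (idm D ⊠ lunitV W) = runitV D ⊠ idm W.
  apply: (cancel_mono (assocK D 𝟙 W)); rewrite (whisk2 (assocVK _ _ _)) comp1m.
  apply: (@cancel_mono _ _ _ _ (idm D ⊠ lunit W) (idm D ⊠ lunitV W)).
    by rewrite (tensm_whiskl _ (lunitK _)) tensm1.
  rewrite (whisk2 (triangle _ _)) (tensm_whiskr _ (runitVK _)).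
  by rewrite (tensm_whiskl _ (lunitVK _)) !tensm1.
rewrite -tensm1 (whisk2 (esym (assoc_nat _ _ _))) -!compA (whisk2 (lunit_tens _ _)).
by rewrite -!tensm_compl snake2 !tensm1.
Qed.

Lemma cobendK (W : T) (u : hom 𝟙 (X ⊗ W)) : (idm X ⊠ cobend u) ∘ coev = u.
Proof.
have e1 : (idm X ⊠ runitV D) ∘ coev = assoc X D 𝟙 ∘ ((coev ⊠ idm 𝟙) ∘ runitV 𝟙).
  rewrite -runitV_nat compA; congr (_ ∘ _).
  apply: (@cancel_mono _ _ _ _ (idm X ⊠ runit D) (idm X ⊠ runitV D)).
    by rewrite (tensm_whiskl _ (runitK _)) tensm1.
  by rewrite compA runit_tens runitVK (tensm_whiskl _ (runitVK _)) tensm1.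
have e3 : runitV 𝟙 = lunitV 𝟙 :> hom (𝟙 : T) _.
  by apply: (cancel_mono (runitK 𝟙)); rewrite runitVK -lunit_runit1 lunitVK.
rewrite /cobend !tensm_compr -!compA e1 (whisk2 (esym (assoc_nat _ _ _))) tensm1.
rewrite -!compA (whisk2 (esym (tensm_swap _ _))) -!compA e3 -lunitV_nat !compA.
rewrite -[RHS]comp1m; congr (_ ∘ _); rewrite -!compA.
have e2 : (idm X ⊠ assocV D X W) ∘ assoc X D (X ⊗ W) =
    assoc X (D ⊗ X) W ∘ ((assoc X D X ⊠ idm W) ∘ assocV (X ⊗ D) X W).
  apply: (@cancel_mono _ _ _ _ (idm X ⊠ assoc D X W) (idm X ⊠ assocV D X W)).
    by rewrite (tensm_whiskl _ (assocK _ _ _)) tensm1.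
  rewrite (whisk2 (tensm_whiskl _ (assocVK _ _ _))) tensm1 comp1m.
  by rewrite (whisk3 (pentagonE _ _ _ _)) -!compA assocVK compm1.
rewrite (whisk2 e2) -!compA -[idm (X ⊗ W)]tensm1 (whisk2 (assocV_nat _ _ _)) -!compA.
have -> : assocV 𝟙 X W ∘ lunitV (X ⊗ W) = lunitV X ⊠ idm W.
  apply: (cancel_mono (assocK 𝟙 X W)); rewrite (whisk2 (assocVK _ _ _)) comp1m.
  apply: (cancel_mono (lunitK (X ⊗ W))).
  by rewrite lunitVK (whisk2 (lunit_tens _ _)) (tensm_whiskr _ (lunitVK _)) tensm1.
rewrite (whisk2 (esym (assoc_nat _ _ _))) -!compA (whisk2 (triangle _ _)).
by rewrite -!tensm_compl snake1 !tensm1.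
Qed.

Lemma duality_inj (W : T) (h h' : hom W X) :
  ev ∘ (idm D ⊠ h) = ev ∘ (idm D ⊠ h') -> h = h'.
Proof.
have bev : bend ev = idm X by exact: snake1.
by move=> e; rewrite -[h]comp1m -[h']comp1m -bev !bend_comp e.
Qed.

End Duality.

Section EtaleTheory.
Variables (k : fieldType) (T : tensorCat k).

Lemma amulAE (A : algebra T) :
  amul A ∘ ((idm (A : T) ⊠ amul A) ∘ assoc A A A) = amul A ∘ (amul A ⊠ idm (A : T)).
Proof. by rewrite -amulA !compA. Qed.

Lemma amulAVE (A : algebra T) :
  amul A ∘ ((amul A ⊠ idm (A : T)) ∘ assocV A A A) = amul A ∘ (idm (A : T) ⊠ amul A).
Proof. by rewrite compA -amulAE -!compA assocVK compm1. Qed.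

Lemma amul1r (A : algebra T) : amul A ∘ (idm (A : T) ⊠ aone A) = runit A.
Proof. by rewrite -amulC -compA braid_nat compA amul1 lunit_braid. Qed.

Lemma trace_mapE (A : algebra T) (D : dual A) :
  trace_map D = dev D ∘ (braid A (dobj D) ∘ ((amul A ⊠ idm (dobj D)) ∘
    (assocV A A (dobj D) ∘ ((idm (A : T) ⊠ dcoev D) ∘ runitV A)))).
Proof. by rewrite /trace_map -!compA. Qed.

(** [d] is the mate of [f^-1]: it carries one coevaluation to the other, and the snake identity
    for [D'] then forces it to carry the evaluations too. *)
Lemma trace_map_iso (A B : algebra T) (D : dual A) (D' : dual B) (f : alg_hom A B)
    (f' : hom (B : T) A) :
  f ∘ f' = idm (B : T) -> f' ∘ f = idm (A : T) -> trace_map D' ∘ f = trace_map D.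
Proof.
move=> ff' f'f.
pose d : hom (dobj D) (dobj D') := cobend (dev D) ((f' ⊠ idm (dobj D')) ∘ dcoev D').
have coevE : (f ⊠ d) ∘ dcoev D = dcoev D'.
  rewrite tensm_splitl -compA (cobendK (dualP D)).
  by rewrite (whisk2 (tensm_whiskr _ ff')) tensm1 comp1m.
have evE : dev D' ∘ (d ⊠ f) = dev D.
  rewrite -[LHS](bendK (dualP D)) -[RHS]compm1 -tensm1; congr (_ ∘ (_ ⊠ _)).
  apply: (cancel_mono f'f); rewrite compm1 /bend (whisk2 (esym (runit_nat _))) -!compA.
  rewrite (whisk2 (tensm_swap _ _)) tensm_compr -!compA.
  rewrite (whisk2 (esym (tensm_splitr (ahom f) (d ⊠ ahom f)))) (whisk2 (esym (assoc_nat _ _ _))).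
  rewrite -!compA (whisk2 (esym (tensmM _ _ _ _))) coevE compm1 [dcoev D' ⊠ _]tensm_splitl -!compA.
  rewrite -lunitV_nat.
  by have := congr1 (fun u => u ∘ ahom f) (snake1 (dualP D')); rewrite comp1m -!compA.
rewrite !trace_mapE -!compA runitV_nat (whisk2 (esym (tensm_swap _ _))) -!compA.
rewrite -{1}coevE tensm_compr -!compA (whisk2 (esym (tensm_splitl _ _))).
rewrite (whisk2 (assocV_nat _ _ _)) -!compA (whisk2 (esym (tensmM _ _ _ _))) comp1m -ahomM.
rewrite -[d]compm1 tensmM -!compA (whisk2 (braid_nat _ _)) -!compA.
by rewrite (whisk2 evE).
Qed.

Lemma trace_map_indep (A : algebra T) (D D' : dual A) : trace_map D = trace_map D'.
Proof.
by rewrite -(@trace_map_iso A A D D' (alg_id A) (idm (A : T))) ?compm1 //= comp1m.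
Qed.

(** With [A] as its own dual, associativity and commutativity collapse the trace loop to
    [x ↦ e(x · m c)]. *)
Lemma trace_map_self (A : algebra T) (e : hom (A : T) 𝟙) (c : hom 𝟙 (A ⊗ A))
    (H : is_duality (e ∘ amul A) c) :
  trace_map (Dual H) = e ∘ (amul A ∘ ((idm (A : T) ⊠ (amul A ∘ c)) ∘ runitV A)).
Proof.
rewrite trace_mapE /= -!compA; congr (_ ∘ _).
rewrite (whisk2 (amulC A)) (whisk3 (amulAVE A)) -!compA.
by rewrite tensm_compr -!compA.
Qed.

(** For an étale algebra, with dual bases [c] for its trace pairing, the trace formula
    [e x = e (x * m c)] and nondegeneracy give [m c = 1]; conversely [m c = 1] makes [e] the trace. *)
Definition etale_form (A : algebra T) (e : hom (A : T) 𝟙) (c : hom 𝟙 (A ⊗ A)) : Prop :=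
  is_duality (e ∘ amul A) c /\ amul A ∘ c = aone A.

Lemma etale_form_trace (A : algebra T) (e : hom (A : T) 𝟙) (c : hom 𝟙 (A ⊗ A)) (D : dual A) :
  etale_form e c -> trace_map D = e.
Proof.
move=> [H mc]; rewrite (trace_map_indep D (Dual H)) trace_map_self mc.
by rewrite (whisk2 (amul1r A)) runitVK compm1.
Qed.

Lemma etale_form_etale (A : algebra T) (e : hom (A : T) 𝟙) (c : hom 𝟙 (A ⊗ A)) :
  etale_form e c -> etale A.
Proof.
move=> fA; case: (fA) => H mc; exists (Dual H); exists c.
by rewrite (etale_form_trace (Dual H) fA).
Qed.

Implicit Types A B C : et_cat T.

Lemma et_form A : etale_form (et_trace A) (trace_copairing A).
Proof.
split; first exact: trace_pairingP.
have := trace_map_indep (et_dual A) (Dual (trace_pairingP A)).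
rewrite (trace_map_self (trace_pairingP A)) -/(et_trace A).
have := trace_pairingP A; rewrite /trace_pairing.
move: (et_trace A) (trace_copairing A) => e c H eE.
apply: (duality_inj H); rewrite -!compA amul1r.
by apply: (cancel_epi (runitK (A : T))); rewrite -!compA runitVK compm1.
Qed.

Lemma et_traceE A (e : hom (A : T) 𝟙) c : etale_form e c -> et_trace A = e.
Proof. exact: etale_form_trace. Qed.

Lemma et_trace_iso A B (f : hom A B) (f' : hom (B : T) A) :
  ahom f ∘ f' = idm (B : T) -> f' ∘ ahom f = idm (A : T) -> et_trace B ∘ ahom f = et_trace A.
Proof. exact: trace_map_iso. Qed.

Lemma pairing_inj A (W : T) (h h' : hom W A) :
  trace_pairing A ∘ (idm (A : T) ⊠ h) = trace_pairing A ∘ (idm (A : T) ⊠ h') -> h = h'.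
Proof. exact: (duality_inj (trace_pairingP A)). Qed.

Lemma et_transposeP A B (f : hom A B) :
  trace_pairing A ∘ (idm (A : T) ⊠ et_transpose f) = trace_pairing B ∘ (ahom f ⊠ idm (B : T)).
Proof.
rewrite -[RHS](bendK (trace_pairingP A)); congr (_ ∘ (_ ⊠ _)).
by rewrite /et_transpose /bend; move: (trace_pairing B) => e; rewrite tensm_compr -!compA.
Qed.

Lemma et_transpose_eq A B (f : hom A B) (h : hom (B : T) A) :
  trace_pairing A ∘ (idm (A : T) ⊠ h) = trace_pairing B ∘ (ahom f ⊠ idm (B : T)) ->
  et_transpose f = h.
Proof. by move=> hE; apply: pairing_inj; rewrite et_transposeP hE. Qed.

Lemma et_transpose_id A : et_transpose (idm A) = idm (A : T).
Proof. exact: et_transpose_eq. Qed.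

Lemma et_transpose_comp A B C (g : hom B C) (f : hom A B) :
  et_transpose (g ∘ f) = et_transpose f ∘ et_transpose g.
Proof.
apply: et_transpose_eq; rewrite tensm_compr compA et_transposeP -compA.
by rewrite tensm_swap compA et_transposeP -compA tensm_compl.
Qed.

Lemma et_transpose_iso A B (f : hom A B) (f' : hom (B : T) A) :
  ahom f ∘ f' = idm (B : T) -> f' ∘ ahom f = idm (A : T) -> et_transpose f = f'.
Proof.
move=> ff' f'f; apply: et_transpose_eq; rewrite /trace_pairing -(et_trace_iso ff' f'f).
by move: (et_trace B) => e; rewrite -!compA (whisk2 (ahomM f)) -!compA -tensmM ff' compm1.
Qed.

(** The projection formula [f^∨(f(a) b) = a f^∨(b)]: paired with any [a'], both sides give
    [ε_B(f(a' a) b)]. *)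
Lemma et_transpose_proj A B (f : hom A B) :
  et_transpose f ∘ (amul B ∘ (ahom f ⊠ idm (B : T))) =
  amul A ∘ (idm (A : T) ⊠ et_transpose f).
Proof.
apply: pairing_inj; have := et_transposeP f; rewrite /trace_pairing.
move: (et_trace A) (et_trace B) (et_transpose f) => a b h; rewrite -!compA => H.
rewrite tensm_compr (whisk3 H) -!compA -tensm_splitl.
rewrite tensm_compr (whisk2 (esym (amulAVE A))) -!compA assocV_nat tensm1.
rewrite (whisk2 (tensm_swap _ _)) -!compA (whisk3 H) -!compA.
rewrite (whisk2 (tensm_whiskr _ (ahomM f))) tensm_compl -!compA.
rewrite -assocV_nat (whisk3 (amulAVE B)) -!compA -tensmM comp1m.
by [].
Qed.

(** Writing [f(a) = f(a) · 1], the projection formula gives [f^∨(f(a)) = a · f^∨(1)], so the value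
    at [1] controls the whole composite. *)
Lemma et_transpose_scalar A B (f : hom A B) (c : k) :
  gamma_tilde f = c *: aone A -> et_transpose f ∘ ahom f = c *: idm (A : T).
Proof.
rewrite /gamma_tilde => fc.
have fE : ahom f = amul B ∘ ((ahom f ⊠ idm (B : T)) ∘ ((idm (A : T) ⊠ aone B) ∘ runitV A)).
  rewrite (whisk2 (tensm_swap _ _)) -!compA (whisk2 (amul1r B)) -runitV_nat.
  by rewrite (whisk2 (runitVK _)) comp1m.
rewrite fE (whisk3 (et_transpose_proj f)) -!compA (whisk2 (tensm_whiskl _ fc)).
by rewrite tensmZr compZl compZr (whisk2 (amul1r A)) runitVK.
Qed.

End EtaleTheory.

Section Coherence2.
Variables (k : fieldType) (T : tensorCat k).
Implicit Types A B X D : T.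

Lemma lunitV_runitV1 : lunitV 𝟙 = runitV 𝟙 :> hom (𝟙 : T) _.
Proof. by apply: (cancel_mono (runitK 𝟙)); rewrite runitVK -lunit_runit1 lunitVK. Qed.

Lemma mid_lunitV A B :
  mid 𝟙 𝟙 A B ∘ ((lunitV 𝟙 ⊠ idm (A ⊗ B)) ∘ lunitV (A ⊗ B)) = lunitV A ⊠ lunitV B.
Proof.
apply: (@cancel_mono _ _ _ _ (lunit A ⊠ lunit B) (lunitV A ⊠ lunitV B)).
  by rewrite -tensmM !lunitK tensm1.
by rewrite (whisk3 (mid_lunit _ _)) lunitVK -tensmM !lunitVK tensm1.
Qed.

Lemma mid_runit A B :
  (runit A ⊠ runit B) ∘ (mid A B 𝟙 𝟙 ∘ (idm (A ⊗ B) ⊠ lunitV 𝟙)) = runit (A ⊗ B).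
Proof.
apply: (cancel_epi (braidK (A ⊗ B) 𝟙)); rewrite runit_braid -mid_lunit -!compA.
rewrite -braid_nat (whisk2 (mid_braid _ _ _ _)) -!compA.
by rewrite (whisk2 (esym (tensmM _ _ _ _))) !runit_braid.
Qed.

Lemma mid_runitV A B :
  mid A B 𝟙 𝟙 ∘ ((idm (A ⊗ B) ⊠ lunitV 𝟙) ∘ runitV (A ⊗ B)) = runitV A ⊠ runitV B.
Proof.
apply: (@cancel_mono _ _ _ _ (runit A ⊠ runit B) (runitV A ⊠ runitV B)).
  by rewrite -tensmM !runitK tensm1.
by rewrite (whisk3 (mid_runit _ _)) runitVK -tensmM !runitVK tensm1.
Qed.

Lemma mid_runit' A B :
  runit (A ⊗ B) ∘ ((idm (A ⊗ B) ⊠ lunit 𝟙) ∘ mid A 𝟙 B 𝟙) = runit A ⊠ runit B.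
Proof.
rewrite -mid_runit -!compA (whisk2 (tensm_whiskl _ (lunitK _))) tensm1 comp1m.
by rewrite midK compm1.
Qed.

Lemma mid_lunit' A B :
  lunit (A ⊗ B) ∘ ((lunit 𝟙 ⊠ idm (A ⊗ B)) ∘ mid 𝟙 A 𝟙 B) = lunit A ⊠ lunit B.
Proof.
rewrite -mid_lunit -!compA (whisk2 (tensm_whiskr _ (lunitK _))) tensm1 comp1m.
by rewrite midK compm1.
Qed.

Lemma mid_unit A B : mid A 𝟙 𝟙 B = idm _.
Proof.
have b1 : braid 𝟙 𝟙 = idm (𝟙 ⊗ 𝟙 : T).
  by apply: (cancel_mono (lunitK 𝟙)); rewrite lunit_braid compm1 lunit_runit1.
by rewrite midE exchE b1 tensm1 comp1m assocVK tensm1 comp1m assocK.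
Qed.

Lemma mid_assocV X0 Y0 X1 Y1 X2 Y2 :
  mid (X0 ⊗ X1) (Y0 ⊗ Y1) X2 Y2 ∘ ((mid X0 Y0 X1 Y1 ⊠ idm (X2 ⊗ Y2)) ∘
    assocV (X0 ⊗ Y0) (X1 ⊗ Y1) (X2 ⊗ Y2)) =
  (assocV X0 X1 X2 ⊠ assocV Y0 Y1 Y2) ∘ (mid X0 Y0 (X1 ⊗ X2) (Y1 ⊗ Y2) ∘
    (idm (X0 ⊗ Y0) ⊠ mid X1 Y1 X2 Y2)) :> hom (_ : T) _.
Proof.
apply: (@cancel_mono _ _ _ _ (assoc X0 X1 X2 ⊠ assoc Y0 Y1 Y2)
  (assocV X0 X1 X2 ⊠ assocV Y0 Y1 Y2)); first by rewrite -tensmM !assocK tensm1.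
rewrite (whisk3 (esym (mid_assoc _ _ _ _ _ _))) -!compA assocVK compm1.
by rewrite (whisk2 (esym (tensmM _ _ _ _))) !assocVK tensm1 comp1m.
Qed.

Lemma mid_natV X X' Y Y' Z Z' W W' (f : hom X X') (g : hom Y Y') (h : hom Z Z') (u : hom W W') :
  ((f ⊠ g) ⊠ (h ⊠ u)) = mid X' Z' Y' W' ∘ (((f ⊠ h) ⊠ (g ⊠ u)) ∘ mid X Y Z W) :> hom (_ : T) _.
Proof. by rewrite -mid_nat (whisk2 (midK _ _ _ _)) comp1m. Qed.

(** Moving [mid] through the associators and unitors turns each snake of the product into the tensor
    product of the two given snakes. *)
Lemma tens_duality X D X' D' (b : hom (D ⊗ X) 𝟙) c (b' : hom (D' ⊗ X') 𝟙) c' :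
  is_duality b c -> is_duality b' c' ->
  is_duality (lunit 𝟙 ∘ ((b ⊠ b') ∘ mid D D' X X')) (mid X D X' D' ∘ ((c ⊠ c') ∘ lunitV 𝟙)).
Proof.
move=> H H'; split; rewrite -!compA.
- rewrite !tensm_compr !tensm_compl -!compA -[Z in Z ⊠ (b ⊠ b')]tensm1.
  rewrite mid_natV -!compA.
  rewrite (whisk3 (mid_assoc _ _ _ _ _ _)) -!compA.
  rewrite (whisk2 (tensm_whiskr _ (midK _ _ _ _))) tensm1 comp1m.
  rewrite -[Z in (c ⊠ c') ⊠ Z]tensm1 (whisk2 (mid_nat c c' _ _)) -!compA mid_lunitV.
  rewrite (whisk3 (mid_runit' _ _)) -!tensmM.
  by rewrite (snake1 H) (snake1 H') tensm1.
- rewrite !tensm_compr !tensm_compl -!compA -[Z in (b ⊠ b') ⊠ Z]tensm1.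
  rewrite mid_natV -!compA.
  rewrite (whisk3 (mid_assocV _ _ _ _ _ _)) -!compA.
  rewrite (whisk2 (tensm_whiskl _ (midK _ _ _ _))) tensm1 comp1m.
  rewrite -[Z in Z ⊠ (c ⊠ c')]tensm1 (whisk2 (mid_nat _ _ c c')) -!compA mid_runitV.
  rewrite (whisk3 (mid_lunit' _ _)) -!tensmM.
  by rewrite (snake2 H) (snake2 H') tensm1.
Qed.

End Coherence2.

(** * Tensor products of commutative algebras as coproducts *)

Section TensorAlgebra.
Variables (k : fieldType) (T : tensorCat k).
Implicit Types A B C : algebra T.

Lemma unit_initM A : aone A ∘ lunit 𝟙 = amul A ∘ (aone A ⊠ aone A).
Proof. by rewrite tensm_splitl compA amul1 lunit_nat. Qed.

Section Def.
Variables A B : algebra T.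

Definition tens_amul : hom ((A ⊗ B) ⊗ (A ⊗ B)) (A ⊗ B) := (amul A ⊠ amul B) ∘ mid A B A B.
Definition tens_aone : hom 𝟙 (A ⊗ B) := (aone A ⊠ aone B) ∘ lunitV 𝟙.

Lemma tens_amulA :
  tens_amul ∘ (idm (A ⊗ B) ⊠ tens_amul) ∘ assoc (A ⊗ B) (A ⊗ B) (A ⊗ B) =
  tens_amul ∘ (tens_amul ⊠ idm (A ⊗ B)).
Proof.
rewrite /tens_amul !tensm_compr !tensm_compl -!compA -tensm1.
rewrite (whisk2 (mid_nat _ _ _ _)) -!compA tensm1 mid_assoc.
rewrite (whisk2 (esym (tensmM _ _ _ _))) (whisk2 (esym (tensmM _ _ _ _))).
rewrite -!compA !amulAE tensmM -!compA; congr (_ ∘ _).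
by rewrite (whisk2 (esym (mid_nat _ _ _ _))) tensm1 -!compA.
Qed.

Lemma tens_amulC : tens_amul ∘ braid (A ⊗ B) (A ⊗ B) = tens_amul.
Proof.
by rewrite /tens_amul -!compA mid_braid (whisk2 (esym (tensmM _ _ _ _))) !amulC.
Qed.

Lemma tens_amul1 : tens_amul ∘ (tens_aone ⊠ idm (A ⊗ B)) = lunit (A ⊗ B).
Proof.
rewrite /tens_amul /tens_aone tensm_compl -!compA -[Z in (_ ⊠ aone B) ⊠ Z]tensm1.
rewrite (whisk2 (mid_nat _ _ _ _)).
by rewrite -!compA (whisk2 (esym (tensmM _ _ _ _))) !amul1 mid_lunit.
Qed.

Definition tens_alg : algebra T := Algebra tens_amulA tens_amulC tens_amul1.

Lemma tens_etale_form (e : hom (A : T) 𝟙) c (e' : hom (B : T) 𝟙) c' :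
  etale_form e c -> etale_form e' c' ->
  @etale_form k T tens_alg (lunit 𝟙 ∘ (e ⊠ e')) (mid A A B B ∘ ((c ⊠ c') ∘ lunitV 𝟙)).
Proof.
move=> [H mc] [H' mc']; split.
- have -> : lunit 𝟙 ∘ (e ⊠ e') ∘ amul tens_alg =
      lunit 𝟙 ∘ (((e ∘ amul A) ⊠ (e' ∘ amul B)) ∘ mid A B A B).
    by rewrite /= /tens_amul tensmM -!compA.
  exact: tens_duality.
- rewrite /= /tens_amul -!compA (whisk2 (midK _ _ _ _)) comp1m.
  by rewrite (whisk2 (esym (tensmM _ _ _ _))) mc mc'.
Qed.

Lemma tens_inlM : ((idm (A : T) ⊠ aone B) ∘ runitV A) ∘ amul A =
  tens_amul ∘ (((idm (A : T) ⊠ aone B) ∘ runitV A) ⊠ ((idm (A : T) ⊠ aone B) ∘ runitV A)).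
Proof.
rewrite /tens_amul tensmM -!compA (whisk2 (mid_nat _ _ _ _)) -mid_runitV -!compA.
rewrite (whisk2 (midK _ _ _ _)) comp1m (whisk2 (esym (tensmM _ _ _ _))).
rewrite tensm1 compm1 (whisk2 (esym (tensmM _ _ _ _))) compm1.
rewrite -unit_initM -compA lunitVK compm1.
by rewrite runitV_nat (whisk2 (esym (tensm_splitr _ _))).
Qed.

Lemma tens_inl1 : ((idm (A : T) ⊠ aone B) ∘ runitV A) ∘ aone A = tens_aone.
Proof.
rewrite /tens_aone -!compA runitV_nat (whisk2 (esym (tensm_splitr _ _))).
by rewrite lunitV_runitV1.
Qed.

Definition tens_inl : alg_hom A tens_alg := @AlgHom k T A tens_alg _ tens_inlM tens_inl1.

Lemma tens_inrM : ((aone A ⊠ idm (B : T)) ∘ lunitV B) ∘ amul B =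
  tens_amul ∘ (((aone A ⊠ idm (B : T)) ∘ lunitV B) ⊠ ((aone A ⊠ idm (B : T)) ∘ lunitV B)).
Proof.
rewrite /tens_amul tensmM -!compA (whisk2 (mid_nat _ _ _ _)) -mid_lunitV -!compA.
rewrite (whisk2 (midK _ _ _ _)) comp1m (whisk2 (esym (tensmM _ _ _ _))).
rewrite tensm1 compm1 (whisk2 (esym (tensmM _ _ _ _))) compm1.
rewrite -unit_initM -compA lunitVK compm1.
by rewrite lunitV_nat (whisk2 (esym (tensm_splitl _ _))).
Qed.

Lemma tens_inr1 : ((aone A ⊠ idm (B : T)) ∘ lunitV B) ∘ aone B = tens_aone.
Proof. by rewrite /tens_aone -!compA lunitV_nat (whisk2 (esym (tensm_splitl _ _))). Qed.

Definition tens_inr : alg_hom B tens_alg := @AlgHom k T B tens_alg _ tens_inrM tens_inr1.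

(** [(a ⊗ 1)(1 ⊗ b) = a ⊗ b]: the two inclusions generate the tensor product, so an algebra map out
    of it is determined by its restrictions to them. *)
Lemma amul_inl_inr : amul tens_alg ∘ (ahom tens_inl ⊠ ahom tens_inr) = idm (A ⊗ B).
Proof.
rewrite /= /tens_amul tensmM -!compA (whisk2 (mid_nat _ _ _ _)) -!compA mid_unit comp1m.
rewrite (whisk2 (esym (tensmM _ _ _ _))) amul1r amul1 -tensmM.
by rewrite runitVK lunitVK tensm1.
Qed.

Variables (C : algebra T) (f : alg_hom A C) (g : alg_hom B C).

Lemma amul_exch : amul C ∘ ((idm (C : T) ⊠ amul C) ∘ exch C C C) =
  amul C ∘ (idm (C : T) ⊠ amul C).
Proof.
rewrite exchE (whisk3 (amulAE C)) -!compA (whisk2 (tensm_whiskr _ (amulC C))).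
by rewrite amulAVE.
Qed.

(** [(ac)(bd) = (ab)(cd)], where commutativity of [C] enters; it makes the copairing of two algebra
    maps multiplicative. *)
Lemma amul_mid : amul C ∘ ((amul C ⊠ amul C) ∘ mid C C C C) = amul C ∘ (amul C ⊠ amul C).
Proof.
have mm : amul C ∘ (amul C ⊠ amul C) =
    amul C ∘ ((idm (C : T) ⊠ (amul C ∘ (idm (C : T) ⊠ amul C))) ∘ assoc C C (C ⊗ C)).
  rewrite tensm_splitl compA -amulAE -!compA -tensm1 assoc_nat.
  by rewrite (whisk2 (esym (tensm_compr _ _ _))).
rewrite compA mm -!compA assoc_mid.
by rewrite (whisk2 (esym (tensm_compr _ _ _))) -!compA amul_exch.
Qed.

Lemma tens_copairM : (amul C ∘ (f ⊠ g)) ∘ tens_amul =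
  amul C ∘ ((amul C ∘ (f ⊠ g)) ⊠ (amul C ∘ (f ⊠ g))).
Proof.
rewrite /tens_amul -!compA (whisk2 (esym (tensmM _ _ _ _))) !ahomM !tensmM -!compA.
by rewrite -mid_nat (whisk3 amul_mid) -!compA.
Qed.

Lemma amul_aone : amul C ∘ ((aone C ⊠ aone C) ∘ lunitV 𝟙) = aone C.
Proof.
by rewrite compA -unit_initM -compA lunitVK compm1.
Qed.

Lemma tens_copair1 : (amul C ∘ (f ⊠ g)) ∘ tens_aone = aone C.
Proof.
by rewrite /tens_aone -!compA (whisk2 (esym (tensmM _ _ _ _))) !ahom1 amul_aone.
Qed.

Definition tens_copair : alg_hom tens_alg C :=
  @AlgHom k T tens_alg C _ tens_copairM tens_copair1.

Lemma tens_copair_inl : ahom tens_copair ∘ ahom tens_inl = f.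
Proof.
rewrite /= -!compA (whisk2 (esym (tensmM _ _ _ _))) compm1 ahom1 tensm_splitr -!compA.
by rewrite (whisk2 (amul1r C)) -runitV_nat (whisk2 (runitVK _)) comp1m.
Qed.

Lemma tens_copair_inr : ahom tens_copair ∘ ahom tens_inr = g.
Proof.
rewrite /= -!compA (whisk2 (esym (tensmM _ _ _ _))) compm1 ahom1 tensm_splitl -!compA.
by rewrite (whisk2 (amul1 C)) -lunitV_nat (whisk2 (lunitVK _)) comp1m.
Qed.

End Def.

Lemma tens_homM A A' B B' (f : alg_hom A A') (g : alg_hom B B') :
  (f ⊠ g) ∘ tens_amul A B = tens_amul A' B' ∘ ((f ⊠ g) ⊠ (f ⊠ g)).
Proof.
by rewrite /tens_amul -!compA mid_nat (whisk2 (esym (tensmM _ _ _ _))) !ahomM tensmM -!compA.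
Qed.

Lemma tens_hom1 A A' B B' (f : alg_hom A A') (g : alg_hom B B') :
  (f ⊠ g) ∘ tens_aone A B = tens_aone A' B'.
Proof. by rewrite /tens_aone (whisk2 (esym (tensmM _ _ _ _))) !ahom1. Qed.

Definition tens_hom A A' B B' (f : alg_hom A A') (g : alg_hom B B') :
  alg_hom (tens_alg A B) (tens_alg A' B') :=
  @AlgHom k T (tens_alg A B) (tens_alg A' B') _ (tens_homM f g) (tens_hom1 f g).

End TensorAlgebra.

Section TensorEtale.
Variables (k : fieldType) (T : tensorCat k).
Implicit Types A B : et_cat T.

Definition tens_et A B : et_cat T :=
  exist _ (tens_alg A B) (etale_form_etale (tens_etale_form (et_form A) (et_form B))).

Lemma tens_pairing A B : trace_pairing (tens_et A B) =
  lunit 𝟙 ∘ ((trace_pairing A ⊠ trace_pairing B) ∘ mid A B A B).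
Proof.
rewrite /trace_pairing.
have -> : et_trace (tens_et A B) = lunit 𝟙 ∘ (et_trace A ⊠ et_trace B).
  exact: (@et_traceE _ _ (tens_et A B) _ _ (tens_etale_form (et_form A) (et_form B))).
move: (et_trace A) (et_trace B) => a b.
by rewrite /= /tens_amul tensmM -!compA.
Qed.

Lemma tens_transpose A A' B B' (f : hom A A') (g : hom B B') :
  @et_transpose k T (tens_et A B) (tens_et A' B') (tens_hom f g) =
  et_transpose f ⊠ et_transpose g.
Proof.
apply: et_transpose_eq; rewrite !tens_pairing.
have := et_transposeP f; have := et_transposeP g.
move: (trace_pairing A) (trace_pairing B) (trace_pairing A') (trace_pairing B').
move: (et_transpose f) (et_transpose g) => h h' a b a' b' H' H.
rewrite -!compA /= -!tensm1 !mid_nat.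
by rewrite !(whisk2 (esym (tensmM _ _ _ _))) H H'.
Qed.

End TensorEtale.

Section UnitAlgebra.
Variables (k : fieldType) (T : tensorCat k).

Lemma unit_amulA : lunit 𝟙 ∘ (idm 𝟙 ⊠ lunit 𝟙) ∘ assoc 𝟙 𝟙 𝟙 =
  lunit 𝟙 ∘ (lunit 𝟙 ⊠ idm 𝟙) :> hom (_ : T) _.
Proof. by rewrite -compA triangle lunit_runit1. Qed.

Lemma unit_amulC : lunit 𝟙 ∘ braid 𝟙 𝟙 = lunit 𝟙 :> hom (_ : T) _.
Proof. by rewrite lunit_braid lunit_runit1. Qed.

Lemma unit_amul1 : lunit 𝟙 ∘ (idm 𝟙 ⊠ idm 𝟙) = lunit 𝟙 :> hom (_ : T) _.
Proof. by rewrite tensm1 compm1. Qed.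

Definition unit_alg : algebra T := @Algebra k T 𝟙 _ _ unit_amulA unit_amulC unit_amul1.

Lemma unit_etale : etale unit_alg.
Proof.
apply: (@etale_form_etale k T unit_alg (idm (𝟙 : T)) (lunitV (𝟙 : T))); split; last exact: lunitVK.
rewrite comp1m /=; split; rewrite -!compA.
- rewrite (whisk2 (triangle _ _)) -lunit_runit1 (whisk2 (tensm_whiskr _ (lunitVK _))).
  by rewrite tensm1 comp1m lunitVK.
- rewrite lunit_runit1 -triangle -!compA (whisk2 (assocVK _ _ _)) comp1m.
  by rewrite (whisk2 (tensm_whiskl _ (lunitVK _))) tensm1 comp1m runitVK.
Qed.

Definition unit_et : et_cat T := exist _ unit_alg unit_etale.

Definition unit_init (A : algebra T) : alg_hom unit_alg A :=
  @AlgHom k T unit_alg A (aone A) (unit_initM A) (compm1 _).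

End UnitAlgebra.

(** * Finite biproducts and finite products of étale algebras *)

Section FiniteBiproducts.
Variables (k : fieldType) (T : tensorCat k).

Definition is_biproduct (I : finType) (X : I -> T) (S : T) (inj : forall i, hom (X i) S)
    (pr : forall i, hom S (X i)) : Prop :=
  [/\ forall i, pr i ∘ inj i = idm (X i),
      forall i j, i != j -> pr i ∘ inj j = 0 &
      \sum_i inj i ∘ pr i = idm S].

Lemma finite_biproduct (I : finType) (X : I -> T) :
  exists (S : T) (inj : forall i, hom (X i) S) (pr : forall i, hom S (X i)),
    is_biproduct inj pr.
Proof.
(* Induction along the enumeration of [I]: an intermediate [S] contains only the summands listed so
   far, so the first identity is claimed for listed indices only. The empty list gives a zero
   object. *)
suff [S [inj [pr [i1 i0 s1]]]] : exists (S : T) (inj : forall i, hom (X i) S)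
    (pr : forall i, hom S (X i)),
    [/\ forall i, i \in enum I -> pr i ∘ inj i = idm (X i),
        forall i j, i != j -> pr i ∘ inj j = 0 &
        \sum_(i <- enum I) inj i ∘ pr i = idm S].
  exists S, inj, pr; split=> [i||]; [|exact: i0|by rewrite -big_enum].
  by apply: i1; rewrite mem_enum.
have := enum_uniq I; elim: (enum I) => [_|x s IH /= /andP[xs /IH[S [inj [pr [i1 i0 s1]]]]]].
  have [Z ZP] := tens_zero T; exists Z, (fun=> 0), (fun=> 0); split=> // [i j _|].
    by rewrite comp0l.
  by rewrite big_nil; apply/esym; exact: (ZP Z).1.
have [S' [j1 [j2 [p1 [p2 [p1j1 p2j2 p1j2 p2j1 jp]]]]]] := tens_biprod (X x) S.
(* The type of the injection depends on [i], so [j1] has to be transported along the equality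
   [x = i]; [eq_axiomK] removes the transport at [i = x]. *)
pose inj' i : hom (X i) S' := match x =P i with
  | ReflectT e => match e in _ = i return hom (X i) S' with erefl => j1 end
  | ReflectF _ => j2 ∘ inj i end.
pose pr' i : hom S' (X i) := match x =P i with
  | ReflectT e => match e in _ = i return hom S' (X i) with erefl => p1 end
  | ReflectF _ => pr i ∘ p2 end.
have inj'x : inj' x = j1 by rewrite /inj'; case: eqP => // e; rewrite (eq_axiomK e).
have pr'x : pr' x = p1 by rewrite /pr'; case: eqP => // e; rewrite (eq_axiomK e).
have inj'n i : i != x -> inj' i = j2 ∘ inj i.
  by rewrite eq_sym /inj'; case: eqP => // /eqP ->.
have pr'n i : i != x -> pr' i = pr i ∘ p2.
  by rewrite eq_sym /pr'; case: eqP => // /eqP ->.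
exists S', inj', pr'; split.
- move=> i; rewrite inE; have [->|ix /= si] := eqVneq i x; first by rewrite inj'x pr'x.
  by rewrite inj'n // pr'n // -compA (whisk2 p2j2) comp1m i1.
- move=> i j ij; have [ix|ix] := eqVneq i x.
    subst i; rewrite pr'x inj'n 1?eq_sym // compA p1j2.
    by rewrite comp0l.
  have [jx|jx] := eqVneq j x; first by subst j; rewrite inj'x pr'n // -compA p2j1 comp0r.
  by rewrite inj'n // pr'n // -compA (whisk2 p2j2) comp1m i0.
- rewrite big_cons inj'x pr'x -jp; congr (_ + _).
  rewrite -[p2 in RHS]comp1m -s1 comp_suml comp_sumr.
  rewrite [LHS]big_seq_cond [RHS]big_seq_cond; apply: eq_bigr => i /andP[si _].
  have ix : i != x by apply: contraNneq xs => <-.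
  by rewrite inj'n // pr'n // -!compA.
Qed.

Section Theory.
Variables (I : finType) (X : I -> T) (S : T).
Variables (inj : forall i, hom (X i) S) (pr : forall i, hom S (X i)).
Hypothesis bip : is_biproduct inj pr.

Lemma biproduct_monic (W : T) (f g : hom W S) : (forall i, pr i ∘ f = pr i ∘ g) -> f = g.
Proof.
case: bip => _ _ s1 fg; rewrite -[f]comp1m -[g]comp1m -s1 !comp_suml.
by apply: eq_bigr => i _; rewrite -!compA fg.
Qed.

Lemma biproduct_pr_sum (W : T) i (F : forall j, hom W (X j)) :
  pr i ∘ (\sum_j inj j ∘ F j) = F i.
Proof.
case: bip => i1 i0 _; rewrite comp_sumr (bigD1 i) //= compA i1 comp1m big1 ?addr0 // => j ji.
by rewrite compA i0 1?eq_sym // comp0l.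
Qed.

(** The pairing and copairing are block diagonal: by [Cl], [Cr], [Bl] and [Br], the component at [i]
    of each snake for [S] is the snake for [X i]. *)
Lemma biproduct_duality (b : forall i, hom (X i ⊗ X i) 𝟙) (c : forall i, hom 𝟙 (X i ⊗ X i)) :
  (forall i, is_duality (b i) (c i)) ->
  is_duality (\sum_i b i ∘ (pr i ⊠ pr i)) (\sum_i (inj i ⊠ inj i) ∘ c i).
Proof.
case: bip => i1 i0 s1 H.
set B := \sum_i _; set C := \sum_i _.
have Cl i : (pr i ⊠ idm S) ∘ C = (idm (X i) ⊠ inj i) ∘ c i.
  rewrite comp_sumr (bigD1 i) //= compA -tensmM i1 comp1m big1 ?addr0 // => j ji.
  by rewrite compA -tensmM i0 1?eq_sym // tensm0l comp0l.
have Cr i : (idm S ⊠ pr i) ∘ C = (inj i ⊠ idm (X i)) ∘ c i.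
  rewrite comp_sumr (bigD1 i) //= compA -tensmM i1 comp1m big1 ?addr0 // => j ji.
  by rewrite compA -tensmM i0 1?eq_sym // tensm0r comp0l.
have Bl i : B ∘ (inj i ⊠ idm S) = b i ∘ (idm (X i) ⊠ pr i).
  rewrite comp_suml (bigD1 i) //= -compA -tensmM i1 compm1 big1 ?addr0 // => j ji.
  by rewrite -compA -tensmM i0 // tensm0l comp0r.
have Br i : B ∘ (idm S ⊠ inj i) = b i ∘ (pr i ⊠ idm (X i)).
  rewrite comp_suml (bigD1 i) //= -compA -tensmM i1 compm1 big1 ?addr0 // => j ji.
  by rewrite -compA -tensmM i0 // tensm0r comp0r.
split; apply: biproduct_monic => i; rewrite -!compA compm1.
- rewrite (whisk2 (esym (runit_nat _))) -!compA (whisk2 (tensm_swap _ _)) -!compA -tensm1.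
  rewrite (whisk2 (esym (assoc_nat _ _ _))) -!compA (whisk2 (tensm_whiskr _ (Cl i))).
  rewrite tensm_compl -!compA (whisk2 (assoc_nat _ _ _)) -!compA.
  rewrite (whisk2 (tensm_whiskl _ (Bl i))) tensm_compr -!compA.
  rewrite (whisk2 (esym (assoc_nat _ _ _))) tensm1 -!compA.
  rewrite (whisk2 (esym (tensm_swap _ _))) -!compA -lunitV_nat.
  by have := congr1 (fun u => u ∘ pr i) (snake1 (H i)); rewrite comp1m -!compA.
- rewrite (whisk2 (esym (lunit_nat _))) -!compA (whisk2 (esym (tensm_swap _ _))) -!compA -tensm1.
  rewrite (whisk2 (esym (assocV_nat _ _ _))) -!compA (whisk2 (tensm_whiskl _ (Cr i))).
  rewrite tensm_compr -!compA (whisk2 (assocV_nat _ _ _)) -!compA.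
  rewrite (whisk2 (tensm_whiskr _ (Br i))) tensm_compl -!compA.
  rewrite (whisk2 (esym (assocV_nat _ _ _))) tensm1 -!compA.
  rewrite (whisk2 (tensm_swap _ _)) -!compA -runitV_nat.
  by have := congr1 (fun u => u ∘ pr i) (snake2 (H i)); rewrite comp1m -!compA.
Qed.

End Theory.

End FiniteBiproducts.

Section SumAlgebra.
Variables (k : fieldType) (T : tensorCat k) (I : finType) (A : I -> et_cat T) (S : T).
Variables (inj : forall i, hom (A i : T) S) (pr : forall i, hom S (A i : T)).
Hypothesis bip : @is_biproduct k T I (fun i => A i : T) S inj pr.

(** A direct sum in [T] with componentwise multiplication is the product of the algebras [A i]: the
    projections [sum_pr] are algebra maps, while the inclusions [inj] are their transposes. *)
Definition sum_amul : hom (S ⊗ S) S := \sum_i inj i ∘ (amul (A i) ∘ (pr i ⊠ pr i)).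
Definition sum_aone : hom 𝟙 S := \sum_i inj i ∘ aone (A i).

Lemma pr_sum_amul i : pr i ∘ sum_amul = amul (A i) ∘ (pr i ⊠ pr i).
Proof. exact: (biproduct_pr_sum bip). Qed.

Lemma pr_sum_aone i : pr i ∘ sum_aone = aone (A i).
Proof. exact: (biproduct_pr_sum bip). Qed.

Lemma sum_amulA : sum_amul ∘ (idm S ⊠ sum_amul) ∘ assoc S S S = sum_amul ∘ (sum_amul ⊠ idm S).
Proof.
apply: (biproduct_monic bip) => i; rewrite -!compA !(whisk2 (pr_sum_amul i)) -!compA.
rewrite (whisk2 (esym (tensmM _ _ _ _))) -tensmM !pr_sum_amul compm1.
have -> : pr i ⊠ (amul (A i) ∘ (pr i ⊠ pr i)) =
    (idm (A i : T) ⊠ amul (A i)) ∘ (pr i ⊠ (pr i ⊠ pr i)) by rewrite -tensmM comp1m.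
have -> : (amul (A i) ∘ (pr i ⊠ pr i)) ⊠ pr i =
    (amul (A i) ⊠ idm (A i : T)) ∘ ((pr i ⊠ pr i) ⊠ pr i) by rewrite -tensmM comp1m.
by rewrite -!compA -assoc_nat (whisk3 (amulAE (A i))) -!compA.
Qed.

Lemma sum_amulC : sum_amul ∘ braid S S = sum_amul.
Proof.
apply: (biproduct_monic bip) => i; rewrite compA pr_sum_amul -compA -braid_nat compA.
by rewrite amulC.
Qed.

Lemma sum_amul1 : sum_amul ∘ (sum_aone ⊠ idm S) = lunit S.
Proof.
apply: (biproduct_monic bip) => i; rewrite compA pr_sum_amul -compA -tensmM pr_sum_aone compm1.
by rewrite tensm_splitl compA amul1 lunit_nat.
Qed.

Definition sum_alg : algebra T := Algebra sum_amulA sum_amulC sum_amul1.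

Lemma sum_etale_form (e : forall i, hom (A i : T) 𝟙) c : (forall i, etale_form (e i) (c i)) ->
  @etale_form k T sum_alg (\sum_i e i ∘ pr i) (\sum_i (inj i ⊠ inj i) ∘ c i).
Proof.
move=> H; split.
- have -> : (\sum_i e i ∘ pr i) ∘ amul sum_alg = \sum_i (e i ∘ amul (A i)) ∘ (pr i ⊠ pr i).
    by rewrite comp_suml; apply: eq_bigr => i _; rewrite -!compA pr_sum_amul.
  by apply: (biproduct_duality bip) => i; exact: (H i).1.
- apply: (biproduct_monic bip) => i /=; rewrite compA pr_sum_amul pr_sum_aone -(H i).2.
  rewrite -compA; congr (_ ∘ _); case: bip => i1 i0 _.
  rewrite comp_sumr (bigD1 i) //= compA -tensmM i1 tensm1 comp1m big1 ?addr0 // => j ji.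
  by rewrite compA -tensmM i0 1?eq_sym // tensm0l comp0l.
Qed.

Definition sum_et : et_cat T :=
  exist _ sum_alg (etale_form_etale (sum_etale_form (fun i => et_form (A i)))).

Definition sum_pr i : hom sum_et (A i) :=
  @AlgHom k T sum_alg (A i) (pr i) (pr_sum_amul i) (pr_sum_aone i).

Lemma sum_pr_transpose i : et_transpose (sum_pr i) = inj i.
Proof.
apply: et_transpose_eq.
have -> : trace_pairing sum_et = \sum_i trace_pairing (A i) ∘ (pr i ⊠ pr i).
  rewrite /trace_pairing.
  rewrite (@et_traceE _ _ sum_et _ _ (sum_etale_form (fun i => et_form (A i)))).
  rewrite comp_suml; apply: eq_bigr => j _; move: (et_trace (A j)) => e.
  by rewrite -!compA pr_sum_amul.
move: (fun i => trace_pairing (A i)) => b; case: bip => i1 i0 _.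
rewrite comp_suml (bigD1 i) //= -compA -tensmM i1 compm1 big1 ?addr0 // => j ji.
by rewrite -compA -tensmM i0 // tensm0r comp0r.
Qed.

Section Tuple.
Variables (M : algebra T) (q : forall i, alg_hom M (A i)).

Lemma sum_tupleM : (\sum_i inj i ∘ q i) ∘ amul M =
  sum_amul ∘ ((\sum_i inj i ∘ q i) ⊠ (\sum_i inj i ∘ q i)).
Proof.
apply: (biproduct_monic bip) => i; rewrite !compA pr_sum_amul (biproduct_pr_sum bip).
by rewrite ahomM -compA -tensmM (biproduct_pr_sum bip).
Qed.

Lemma sum_tuple1 : (\sum_i inj i ∘ q i) ∘ aone M = sum_aone.
Proof.
apply: (biproduct_monic bip) => i; rewrite compA (biproduct_pr_sum bip) pr_sum_aone.
exact: ahom1.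
Qed.

Definition sum_tuple : alg_hom M sum_alg := @AlgHom k T M sum_alg _ sum_tupleM sum_tuple1.

Lemma sum_pr_tuple i : pr i ∘ ahom sum_tuple = q i.
Proof. exact: (biproduct_pr_sum bip). Qed.

End Tuple.

End SumAlgebra.

(** * Matrices of permutation modules *)

Section PermCalculus.
Variables (k : fieldType) (G : proOligoGroup) (mu : measure G k).
Local Notation SG := (sgset G).
Implicit Types X Y Z W : SG.
Local Notation "g \m f" := (mxcomp mu g f) (at level 40, left associativity).

Lemma invfun_sumE X I (r : seq I) (P : pred I) (F : I -> invfun k X) x :
  (\sum_(i <- r | P i) F i : invfun k X) x = \sum_(i <- r | P i) F i x.
Proof.
by elim: r => [|i r IH]; rewrite ?big_nil // !big_cons; case: (P i); rewrite -IH.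
Qed.

(** The indicator of an orbit as the push-forward of [1], so that functoriality and base change of
    [ipush] apply to it directly. *)
Definition orb_ind X (t : X) : invfun k X := ipush mu (orbG_incl t) (icst _ 1).

Lemma orb_indE X (t x : X) : orb_ind t x = (orb t == orb x)%:R.
Proof.
rewrite ipush1 => [|y z]; last exact: sub_ext.
congr (_ %:R); congr nat_of_bool; apply/asboolP/eqP => [[[y yt] /= <-]|e].
  exact/esym/orb_eq.
have tx : orb t x by rewrite e; exact: orb_refl.
by exists (exist _ x tx).
Qed.

Lemma invfun_decomp X (a : invfun k X) : a = \sum_(t <- orbreps X) a t *: orb_ind t.
Proof.
apply: invfun_ext => x; rewrite invfun_sumE -(sum_pick x (@invfun_orb _ _ _ a)) big_mkcond /=.
apply: eq_bigr => t _; rewrite -[RHS]/(a t * orb_ind t x) orb_indE.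
by case: (_ == _); rewrite ?mulr1 ?mulr0.
Qed.

Definition rowscale X Y (a : invfun k Y) (B : gmatrix k X Y) : gmatrix k X Y :=
  imul (ipull (gfst Y X) a) B.

Definition diagmx X (a : invfun k X) : gmatrix k X X := rowscale a (pullmx k (gid X)).

Lemma rowscale_comp X Y Z (a : invfun k Z) (B : gmatrix k Y Z) (A : gmatrix k X Y) :
  rowscale a B \m A = rowscale a (B \m A).
Proof.
rewrite /rowscale /mxcomp -ipush_projl; congr (ipush mu _ _).
by apply: invfun_ext => t /=; rewrite mulrA.
Qed.

Lemma diagmx_comp X Y (a : invfun k Y) (A : gmatrix k X Y) : diagmx a \m A = rowscale a A.
Proof. by rewrite rowscale_comp mxcomp1m. Qed.

Lemma diagmxM X (a b : invfun k X) : diagmx a \m diagmx b = diagmx (imul a b).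
Proof. by rewrite diagmx_comp; apply: invfun_ext => x; exact: mulrA. Qed.

Lemma diagmx1 X : diagmx (icst X 1) = pullmx k (gid X).
Proof. by apply: invfun_ext => x; exact: mul1r. Qed.

Lemma diagmx_sum X I (r : seq I) (P : pred I) (F : I -> invfun k X) :
  diagmx (\sum_(i <- r | P i) F i) = \sum_(i <- r | P i) diagmx (F i).
Proof.
by apply: invfun_ext => x; rewrite /= !invfun_sumE mulr_suml.
Qed.

Lemma rowscale_pull X Y (a : invfun k Y) (f : gmap Y X) :
  rowscale a (pullmx k f) = ipush mu (gpair (gid Y) f) a.
Proof.
have finj : injective (gpair (gid Y) f) by move=> y y' [].
have -> : pullmx k f = ipush mu (gpair (gid Y) f) (icst _ 1).
  apply: invfun_ext => -[y x]; rewrite ipush1 //=; congr (_ %:R); congr nat_of_bool.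
  by apply/asboolP/asboolP => [<-|[z [-> ->]]//]; exists y.
rewrite /rowscale -ipush_projl; congr (ipush mu _ _).
by apply: invfun_ext => y; exact: mulr1.
Qed.

(** A correspondence [Y ⟵ Z ⟶ X] with weight [a] acts as the matrix obtained by integrating [a]
    along [Z ⟶ Y × X]. With [Z] an orbit of [Y × X] and weight [1] this is the indicator matrix of
    that orbit. *)
Lemma push_diag_pull X Y Z (q : gmap Z Y) (p : gmap Z X) (a : invfun k Z) :
  pushmx k q \m diagmx a \m pullmx k p = ipush mu (gpair q p) a.
Proof.
rewrite -mxcompA diagmx_comp rowscale_pull pushmx_comp -ipush_comp; congr (ipush mu _ _).
exact: gmap_ext.
Qed.

Lemma push_pull X Y Z (q : gmap Z Y) (p : gmap Z X) :
  pushmx k q \m pullmx k p = ipush mu (gpair q p) (icst Z 1).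
Proof. by rewrite -push_diag_pull diagmx1 mxcompm1. Qed.

Lemma diagmxE X (a : invfun k X) : diagmx a = ipush mu (gdiag X) a.
Proof. exact: rowscale_pull. Qed.

Lemma diagmx_push X Z (i : gmap Z X) (a : invfun k Z) :
  diagmx (ipush mu i a) = pushmx k i \m diagmx a \m pullmx k i.
Proof.
rewrite diagmxE push_diag_pull -ipush_comp; congr (ipush mu _ _).
exact: gmap_ext.
Qed.

Lemma diagmx_push1 X Z (i : gmap Z X) :
  diagmx (ipush mu i (icst Z 1)) = pushmx k i \m pullmx k i.
Proof. by rewrite diagmx_push diagmx1 mxcompm1. Qed.

Lemma gmatrix_decomp X Y (A : gmatrix k X Y) :
  A = \sum_(t <- orbreps (prodG Y X)) A t *:
    (pushmx k (gcomp (gfst Y X) (orbG_incl t)) \m pullmx k (gcomp (gsnd Y X) (orbG_incl t))).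
Proof.
rewrite [LHS](invfun_decomp A); apply: eq_bigr => t _; congr (_ *: _).
rewrite push_pull /orb_ind.
suff -> : gpair (gcomp (gfst Y X) (orbG_incl t)) (gcomp (gsnd Y X) (orbG_incl t)) =
  orbG_incl t :> gmap _ (prodG Y X) by [].
by apply: gmap_ext => -[[y x] p].
Qed.

Definition vecmx X (a : invfun k X) : gmatrix k (ptG G) X := ipull (gfst X (ptG G)) a.

Lemma vecmx1 X : vecmx (icst X 1) = pullmx k (gterm X).
Proof. by apply: invfun_ext => -[x []] /=; rewrite asboolT. Qed.

Lemma vecmx_pull X Y (f : gmap Y X) (a : invfun k X) :
  pullmx k f \m vecmx a = vecmx (ipull f a).
Proof. by rewrite pullmx_comp; apply: invfun_ext => -[]. Qed.

Lemma vecmx_push X Y (f : gmap Y X) (a : invfun k Y) :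
  pushmx k f \m vecmx a = vecmx (ipush mu f a).
Proof.
rewrite pushmx_comp /vecmx.
rewrite (@ipush_base _ _ mu _ _ _ _ f (gfst X (ptG G)) (gfst Y (ptG G)) (gprod f (gid _))) //.
split=> [//|[y []] [y' []] /= -> //|y [x []] /= <-].
by exists (y, tt).
Qed.

(** A diagonal matrix is multiplication by the point [vecmx a] of [C(X)], a description that a
    tensor functor preserves. *)
Lemma diagmx_vec X (a : invfun k X) :
  diagmx a = pullmx k (gdiag X) \m (kron (vecmx a) (pullmx k (gid X)) \m mxlunitV k X).
Proof.
rewrite pullmx_comp (@comp_pullmx_iso _ _ mu _ _ _ (gsnd (ptG G) X) (gpair (gterm X) (gid X))) //.
- exact: invfun_ext.
- by move=> [[] x].
Qed.

Lemma pull_push_inj X Y (f : gmap Y X) : injective f ->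
  pullmx k f \m pushmx k f = pullmx k (gid Y).
Proof.
move=> finj; rewrite (@pull_push _ _ mu _ _ _ _ f f (gid Y) (gid Y)).
  by rewrite push_gid mxcompm1.
by split=> // y y' /finj ->; exists y'.
Qed.

Lemma pull_push_disj X Y Z (f : gmap Y X) (g : gmap Z X) : (forall y z, f y <> g z) ->
  pullmx k g \m pushmx k f = icst _ 0.
Proof.
move=> fg; rewrite pullmx_comp; apply: invfun_ext => -[z y] /=.
by rewrite asboolF //; exact: fg.
Qed.

Lemma ipush_transitive X Y (tX : transitive_gset X) (f : gmap Y X) :
  ipush mu f (icst Y 1) = icst X (mval_finitary mu tX f).
Proof.
apply: invfun_ext => x /=; rewrite /mval_finitary big_mkcond; apply: eq_bigr => y _.
rewrite (orb_eq (trans_from tX x (f y))) eqxx mul1r.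
by apply/esym; apply: (@mval_morb k G mu _ _ _ _ _ _ _ f (orbG_incl y) (gid X)
  (exist _ y (orb_refl y))) => // u v; exact: sub_ext.
Qed.

(** The fibre product of the diagonal of [X] with [id × f] is the graph of [f]; base change along
    this square shows that [f_*] is the transpose of [f^*] for the trace pairings. *)
Lemma perm_pairing_push X Y (f : gmap Y X) :
  pushmx k (gterm X) \m pullmx k (gdiag X) \m kron (pullmx k (gid X)) (pushmx k f) =
  pushmx k (gterm Y) \m pullmx k (gdiag Y) \m kron (pullmx k f) (pullmx k (gid Y)).
Proof.
rewrite -push_gid kron_pushmx kron_pullmx -!mxcompA pullmxM.
have e1 : gcomp (gterm X) f = gterm Y by exact: gmap_ext.
have e2 : gcomp (gprod f (gid Y)) (gdiag Y) = gpair f (gid Y) by exact: gmap_ext.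
rewrite e2 (@pull_push _ _ mu _ _ _ _ _ _ (gpair f (gid Y)) f) ?mxcompA ?pushmxM ?e1 //.
split=> [//|y y' []//|[x y] x' /= [-> <-]].
by exists y.
Qed.

End PermCalculus.

(** * Coproducts in the category of [G]-sets are disjoint unions *)

Section Coproducts.
Variable G : proOligoGroup.
Variables (I : finType) (X : I -> S_cat G) (S : S_cat G) (inj : forall i, hom (X i) S).
Hypothesis cop : is_coproduct inj.

Lemma coproduct_sep i (x : gcar (X i)) :
  (forall x', gfun (inj i) x' = gfun (inj i) x -> x' = x) /\
  (forall j y, j != i -> gfun (inj j) y <> gfun (inj i) x).
Proof.
(* The test object is [X i ⊔ pt]: [X i] maps to itself and every other summand to the point. The
   induced map on [S] separates points of [X i] from each other and from the other summands. *)
pose q j : @hom (S_cat G) (X j) (sumG (X i) (ptG G)) := match i =P j with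
  | ReflectT e => match e in _ = j return gmap (X j) (sumG (X i) (ptG G)) with
      erefl => ginl (X i) (ptG G) end
  | ReflectF _ => gcomp (ginr (X i) (ptG G)) (gterm (X j)) end.
have qi : q i = ginl _ _ by rewrite /q; case: eqP => // e; rewrite (eq_axiomK e).
have [u [uP _]] := cop q.
have uE j y : gfun u (gfun (inj j) y) = gfun (q j) y by rewrite -uP.
split=> [x' /(congr1 (gfun u))|j y ji /(congr1 (gfun u))]; rewrite !uE qi; first by case.
by rewrite /q; case: eqP => [e|_] //; rewrite e eqxx in ji.
Qed.

Lemma coproduct_inj i : injective (gfun (inj i)).
Proof. by move=> x y e; apply: (coproduct_sep y).1. Qed.

Lemma coproduct_cover (s : gcar S) : exists i x, gfun (inj i) x = s.
Proof.
(* [A] marks the union of the images. Its characteristic map to [pt ⊔ pt] and the constant map [u1]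
   agree on every summand, hence on all of [S]. *)
pose A (s : gcar S) := `[< exists i x, gfun (inj i) x = s >].
have AP g t : A (gact g t) = A t.
  apply/asboolP/asboolP => -[i [x e]].
    by exists i, (gact g^-1%g x); rewrite gfunP e gactK.
  by exists i, (gact g x); rewrite gfunP e.
pose u1 : @hom (S_cat G) S (sumG (ptG G) (ptG G)) := gcomp (ginl _ _) (gterm S).
pose h2 t : sumG (ptG G) (ptG G) := if A t then inl tt else inr tt.
have u2P g t : h2 (gact g t) = gact g (h2 t).
  by rewrite /h2 AP; case: (A t).
pose u2 : @hom (S_cat G) S (sumG (ptG G) (ptG G)) := @GMap G S (sumG (ptG G) (ptG G)) h2 u2P.
have [u [_ uU]] := cop (fun i => gcomp (ginl (ptG G) (ptG G)) (gterm (X i))).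
have e1 : u = u1 by apply: uU => i; exact: gmap_ext.
have e2 : u = u2.
  apply: uU => i; apply: gmap_ext => x; rewrite /= /h2 /A asboolT //.
  by exists i, x.
suff : A s by move/asboolP.
have : gfun u1 s = gfun u2 s by rewrite -e1 -e2.
by rewrite /= /h2; case: (A s).
Qed.

End Coproducts.

(** * Compatibility with the measure as an equation *)

Section Compatible.
Variables (k : fieldType) (G : proOligoGroup) (mu : measure G k) (T : tensorCat k).

Lemma aone_neq0 (A : algebra T) : ~ is_zero_object (A : T) -> aone A != 0.
Proof.
move=> nzA; apply: contra_notN nzA => /eqP a0 W.
have id0 : idm (A : T) = 0.
  apply: (cancel_epi (lunitVK _)).
  by rewrite comp0l comp1m -amul1 a0 tensm0l comp0r.
by split=> h; [rewrite -[h]comp1m id0 comp0l | rewrite -[h]compm1 id0 comp0r].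
Qed.

(** When [Psi X] is zero both sides vanish. Otherwise [aone] is nonzero, so the scalar in the
    definition of uniformity is unique, and the case distinction turns into a single equation. *)
Lemma compatibleP (Psi : functor (op (S_cat G)) (et_cat T)) :
  compatible mu Psi <->
  forall (X Y : sgset G) (f : gmap Y X) (tX : transitive_gset X),
    gamma_tilde (@fmap (op (S_cat G)) (et_cat T) Psi X Y f) =
    mval_finitary mu tX f *: aone (fobj Psi X : et_cat T).
Proof.
split=> [Pcomp X Y f tX|gE X Y f tX].
  have [zX|[fU <-]] := Pcomp X Y f tX; first by rewrite [LHS](zX _).1 [RHS](zX _).1.
  by rewrite /gamma; case: cid.
have [zX|nzX] := pselect (is_zero_object (Psi X : T)); [by left|right].
have fU : uniform (@fmap (op (S_cat G)) (et_cat T) Psi X Y f).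
  by split=> //; exists (mval_finitary mu tX f); exact: gE.
exists fU; rewrite /gamma; case: cid => c /= cE.
apply/eqP; rewrite -subr_eq0; have := aone_neq0 nzX; apply: contraNT => c0.
have : (c - mval_finitary mu tX f) *: aone (fobj Psi X : et_cat T) = 0.
  by rewrite scalerBl -cE -gE subrr.
by move=> /eqP; rewrite scaler_eq0 (negPf c0).
Qed.

End Compatible.

(** * Traces and transposes under a tensor functor; compatibility and additivity *)

Section Forward.
Variables (k : fieldType) (G : proOligoGroup) (mu : measure G k) (T : tensorCat k).
Variable Phi : tensor_functor (Perm mu) T.
Local Notation SG := (sgset G).
Implicit Types X Y Z : SG.

Definition pull_hom X Y (f : gmap Y X) : @hom (Perm mu) X Y := pullmx k f.
Definition push_hom X Y (f : gmap Y X) : @hom (Perm mu) Y X := pushmx k f.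
Definition diag_hom X (a : invfun k X) : @hom (Perm mu) X X := diagmx a.
Definition vec_hom X (a : invfun k X) : @hom (Perm mu) 𝟙 X := vecmx a.

Lemma psi_trace X : et_trace (psi_ob Phi X) = tfun0V Phi ∘ fmap Phi (push_hom (gterm X)).
Proof.
rewrite /et_trace.
rewrite (@trace_map_indep _ _ (psi_ob Phi X) _ (tfun_dual Phi (perm_dual mu X))).
by rewrite (tfun_trace Phi (A := perm_alg mu X)) perm_traceE.
Qed.

Lemma psi_pairing X : trace_pairing (psi_ob Phi X) = tfun0V Phi ∘
  fmap Phi (push_hom (gterm X) ∘ pull_hom (gdiag X)) ∘ tfun2 Phi X X.
Proof. by rewrite /trace_pairing psi_trace /= fmapM -!compA. Qed.

Lemma psi_transpose X Y (f : gmap Y X) :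
  et_transpose (psi_map Phi f) = fmap Phi (push_hom f).
Proof.
apply: et_transpose_eq; rewrite !psi_pairing.
rewrite -!compA tfun2_natr tfun2_natl !compA; congr (_ ∘ _).
rewrite -!(compA (tfun0V Phi)) -!fmapM; congr (_ ∘ fmap Phi _).
exact: perm_pairing_push.
Qed.

Lemma tfunD X Y (f g : @hom (Perm mu) X Y) : fmap Phi (f + g) = fmap Phi f + fmap Phi g.
Proof. by have := tfun_linear Phi 1 f g; rewrite !scale1r. Qed.

Lemma tfun_sum X Y I (r : seq I) (P : pred I) (F : I -> @hom (Perm mu) X Y) :
  fmap Phi (\sum_(i <- r | P i) F i) = \sum_(i <- r | P i) fmap Phi (F i).
Proof.
apply: big_morph => [f g|]; first exact: tfunD.
by apply: (addrI (fmap Phi 0)); rewrite -tfunD !addr0.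
Qed.

Lemma tfunZ X Y c (f : @hom (Perm mu) X Y) : fmap Phi (c *: f) = c *: fmap Phi f.
Proof.
have z : fmap Phi (0 : @hom (Perm mu) X Y) = 0.
  by have := tfun_sum [::] xpredT (fun _ : nat => (0 : @hom (Perm mu) X Y)); rewrite !big_nil.
by have := tfun_linear Phi c f 0; rewrite !addr0 z addr0.
Qed.

Lemma tfun0E X Y : fmap Phi (0 : @hom (Perm mu) X Y) = 0.
Proof. by rewrite -(scale0r 0) tfunZ scale0r. Qed.

Lemma psi_aone : aone (psi_ob Phi (ptG G)) = tfun0 Phi.
Proof.
rewrite /= -[RHS]comp1m -fmap1; congr (fmap Phi _ ∘ _).
by apply: pullmx_eq => -[].
Qed.

Lemma psi_compatible : compatible mu (psi Phi).
Proof.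
apply/compatibleP => X Y f tX.
rewrite [LHS]/gamma_tilde (psi_transpose f) /= compA -fmapM -compZl -tfunZ.
congr (fmap Phi _ ∘ _); rewrite -vecmx1 [LHS]vecmx_push (ipush_transitive _ tX) -vecmx1.
by apply: invfun_ext => x /=; rewrite mulr1.
Qed.

(** The maps [f_*] and [f^*] of the inclusions make [Phi S] a biproduct in [T]. A map into it is an
    algebra map as soon as its components are, so it is the product of the algebras as well. *)
Lemma psi_additive : additive_functor (op_functor (psi Phi)).
Proof.
move=> I X S inj cop M q.
pose pr i : hom (Phi S) (Phi (X i)) := fmap Phi (pull_hom (inj i)).
pose jn i : hom (Phi (X i)) (Phi S) := fmap Phi (push_hom (inj i)).
have bip : is_biproduct jn pr.
  split=> [i|i j ij|].
  - rewrite /pr /jn -fmapM -fmap1; congr (fmap Phi _).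
    by apply: pull_push_inj; exact: coproduct_inj.
  - rewrite /pr /jn -fmapM -(tfun0E (X j) (X i)); congr (fmap Phi _).
    apply: pull_push_disj => y x; apply: (coproduct_sep cop x).2.
    by rewrite eq_sym.
  - under eq_bigr => i _ do rewrite /pr /jn -fmapM.
    rewrite -tfun_sum -fmap1; congr (fmap Phi _).
    transitivity (diag_hom (icst S (1 : k))); last exact: diagmx1.
    under eq_bigr => i _ do rewrite -[_ ∘ _]/(mxcomp mu _ _) -diagmx_push1.
    rewrite -[LHS]diagmx_sum; congr diagmx; apply: invfun_ext => s.
    rewrite invfun_sumE; have [i [x <-]] := coproduct_cover cop s.
    rewrite (bigD1 i) // (ipush_inj mu (icst _ 1) x (coproduct_inj cop (i:=i))).
    rewrite big1 => [|j ji]; first exact: addr0.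
    by rewrite ipush_out // => y; exact: (coproduct_sep cop x).2.
pose u : hom (M : T) (Phi S) := \sum_i jn i ∘ ahom (q i).
have uE i : pr i ∘ u = ahom (q i) by exact: (biproduct_pr_sum bip).
have prM i : pr i ∘ amul (psi_ob Phi S) = amul (psi_ob Phi (X i)) ∘ (pr i ⊠ pr i).
  exact: (ahomM (psi_map Phi (inj i))).
have pr1 i : pr i ∘ aone (psi_ob Phi S) = aone (psi_ob Phi (X i)).
  exact: (ahom1 (psi_map Phi (inj i))).
have uM : u ∘ amul M = amul (psi_ob Phi S) ∘ (u ⊠ u).
  apply: (biproduct_monic bip) => i.
  by rewrite (whisk2 (uE i)) (whisk2 (prM i)) (ahomM (q i)) -(uE i) tensmM; exact: compA.
have u1 : u ∘ aone M = aone (psi_ob Phi S).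
  apply: (biproduct_monic bip) => i.
  by rewrite (whisk2 (uE i)) (pr1 i); exact: (ahom1 (q i)).
exists (@AlgHom k T M (psi_ob Phi S) u uM u1); split=> [i|v vP].
  by apply: alg_hom_ext; exact: uE.
apply: alg_hom_ext => /=; apply: (biproduct_monic bip) => i.
by rewrite uE -vP.
Qed.

End Forward.

(** * From tensor functors to functors on G-sets *)

Section TensorCoproduct.
Variables (k : fieldType) (T : tensorCat k) (A B P : algebra T).
Variables (i1 : alg_hom A P) (i2 : alg_hom B P) (V : hom (P : T) (A ⊗ B)).
Hypothesis VK : (amul P ∘ (i1 ⊠ i2)) ∘ V = idm (P : T).

(** [u ∘ m ∘ (i1 ⊠ i2) = m ∘ (u i1 ⊠ u i2)], so a section of [m ∘ (i1 ⊠ i2)] is enough for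
    uniqueness. *)
Lemma copair_unique (M : algebra T) (u v : alg_hom P M) :
  ahom u ∘ i1 = ahom v ∘ i1 -> ahom u ∘ i2 = ahom v ∘ i2 -> ahom u = ahom v.
Proof.
move=> e1 e2; apply: (cancel_epi VK).
by rewrite !(whisk2 (ahomM _)) -!compA -!tensmM e1 e2.
Qed.

Hypothesis KV : V ∘ (amul P ∘ (i1 ⊠ i2)) = idm (A ⊗ B).

Lemma copair_exists (M : algebra T) (a : alg_hom A M) (b : alg_hom B M) :
  exists u : alg_hom P M, ahom u ∘ i1 = a /\ ahom u ∘ i2 = b.
Proof.
have [V' [V'K KV']] : @is_iso (alg_cat T) (tens_alg A B) P (tens_copair i1 i2).
  by apply: alg_hom_iso; exists V.
have {}V'K : ahom V' ∘ ahom (tens_copair i1 i2) = idm _.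
  exact: (congr1 (@ahom _ _ _ _) V'K).
have e1 : ahom V' ∘ i1 = tens_inl A B.
  by rewrite -[RHS]comp1m -V'K -[RHS]compA tens_copair_inl.
have e2 : ahom V' ∘ i2 = tens_inr A B.
  by rewrite -[RHS]comp1m -V'K -[RHS]compA tens_copair_inr.
exists (alg_comp (tens_copair a b) V'); split.
- by rewrite -[LHS]compA e1; exact: tens_copair_inl.
- by rewrite -[LHS]compA e2; exact: tens_copair_inr.
Qed.

End TensorCoproduct.

(** * Finite products, equalizers and finite limits *)

Section PsiLimits.
Variables (k : fieldType) (G : proOligoGroup) (mu : measure G k) (T : tensorCat k).
Variable Phi : tensor_functor (Perm mu) T.
Local Notation SG := (sgset G).
Implicit Types X Y Z : SG.
Local Notation pull f := (fmap Phi (pull_hom mu f)).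

Lemma pullM X Y Z (f : gmap Y X) (g : gmap Z Y) : pull g ∘ pull f = pull (gcomp f g).
Proof. by rewrite -fmapM; congr (fmap Phi _); exact: pullmxM. Qed.

(** The tensor constraint of [Phi] is read off from the algebras and the two projections. Hence the
    image functor determines it, and isomorphisms of image functors respect it. *)
Lemma psi_prod X Y :
  amul (psi_ob Phi (prodG X Y)) ∘ (pull (gfst X Y) ⊠ pull (gsnd X Y)) = tfun2 Phi X Y.
Proof.
rewrite /= -compA (tfun2_nat Phi (pull_hom mu (gfst X Y)) (pull_hom mu (gsnd X Y))) compA.
rewrite -fmapM -[RHS]comp1m -fmap1.
congr (fmap Phi _ ∘ _); rewrite -[LHS]/(mxcomp mu _ (kron _ _)) kron_pullmx pullmxM.
by apply: pullmx_eq => -[].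
Qed.

Lemma psi_pair X Y Z (f : gmap Z X) (g : gmap Z Y) :
  pull (gpair f g) ∘ tfun2 Phi X Y = amul (psi_ob Phi Z) ∘ (pull f ⊠ pull g).
Proof.
rewrite -psi_prod; have := ahomM (psi_map Phi (gpair f g)) => /= /whisk2 ->.
rewrite -[LHS]compA -tensmM; congr (_ ∘ _).
by congr (_ ⊠ _); rewrite -[LHS]/(pull _ ∘ pull _) pullM; congr (fmap Phi _); exact: pullmx_eq.
Qed.

Lemma psi_diag X (a : invfun k X) : fmap Phi (diag_hom mu a) =
  amul (psi_ob Phi X) ∘ (((fmap Phi (vec_hom mu a) ∘ tfun0 Phi) ⊠ idm (Phi X)) ∘ lunitV (Phi X)).
Proof.
rewrite /= tensm_compl -!compA (whisk2 (tfun2_natl Phi X (vec_hom mu a))) -!compA.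
have := tfun_lunitVE Phi X; rewrite -!compA => ->; rewrite -!fmapM; congr (fmap Phi _).
exact: diagmx_vec.
Qed.

(** [u] does not distinguish [(g, h)] from [(g, g)] on [X × X]; the indicator of the orbit of
    [(g t, h t)] pulls back to [0] along the second, and to [1] at [t] along the first. *)
Lemma psi_equalizer (M : algebra T) X P (g h : gmap P X) (u : alg_hom (psi_ob Phi P) M) (t : P) :
  ahom u ∘ pull g = ahom u ∘ pull h -> g t <> h t ->
  ahom u ∘ fmap Phi (diag_hom mu (orb_ind mu t)) = 0.
Proof.
move=> gh ght.
have pairE : ahom u ∘ pull (gpair g h) = ahom u ∘ pull (gpair g g).
  apply: (cancel_epi (tfun2VK Phi X X)); rewrite -!compA !psi_pair !(whisk2 (ahomM u)).
  by rewrite -!compA -!tensmM gh.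
pose a := orb_ind mu ((g t, h t) : prodG X X).
have vecE (f : gmap P (prodG X X)) :
    fmap Phi (vec_hom mu (ipull f a)) = pull f ∘ fmap Phi (vec_hom mu a).
  by rewrite -fmapM; congr (fmap Phi _); exact/esym/vecmx_pull.
pose b := ipull (gpair g h) a.
have b0 : ahom u ∘ fmap Phi (vec_hom mu b) = 0.
  rewrite vecE compA pairE -compA -vecE.
  have -> : vec_hom mu (ipull (gpair g g) a) = 0.
    apply: invfun_ext => -[x c]; rewrite -[LHS]/(orb_ind mu _ (gpair g g x)) orb_indE.
    by case: eqP => // /orbP[z [e1 e2]]; case: ght; rewrite e1 e2.
  by rewrite tfun0E comp0r.
have -> : diag_hom mu (orb_ind mu t) = diag_hom mu b ∘ diag_hom mu (orb_ind mu t).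
  rewrite -[RHS]/(mxcomp mu _ _) diagmxM; congr diagmx; apply: invfun_ext => x.
  rewrite -[RHS]/(orb_ind mu _ (gpair g h x) * orb_ind mu t x) !orb_indE.
  have [e|_] := eqVneq (orb t) (orb x); last by rewrite mulr0.
  by rewrite -(orb_map (gpair g h) e) eqxx mulr1.
(* [diag_hom mu b] is multiplication by a point that the algebra map [u] kills, so [u] kills all
   multiples of that point. *)
rewrite fmapM compA psi_diag (whisk2 (ahomM u)) -!compA (whisk2 (esym (tensmM _ _ _ _))).
by rewrite (whisk2 b0) comp0l tensm0l !comp0l comp0r.
Qed.

End PsiLimits.

Section LeftExact.
Variables (k : fieldType) (G : proOligoGroup) (mu : measure G k) (T : tensorCat k).
Variable Phi : tensor_functor (Perm mu) T.
Local Notation SG := (sgset G).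
Local Notation pull f := (fmap Phi (pull_hom mu f)).

Lemma psi_pt (M : algebra T) : exists u : alg_hom (psi_ob Phi (ptG G)) M,
  forall v : alg_hom (psi_ob Phi (ptG G)) M, ahom v = ahom u.
Proof.
have [V [_ _]] : @is_iso (alg_cat T) (unit_alg T) _ (unit_init (psi_ob Phi (ptG G))).
  apply: alg_hom_iso; exists (tfun0V Phi).
  by rewrite -[ahom (unit_init _)]/(aone (psi_ob Phi (ptG G))) psi_aone tfun0K tfun0VK.
exists (alg_comp (unit_init M) V) => v; apply: (cancel_epi (tfun0VK Phi)).
have h (w : alg_hom (psi_ob Phi (ptG G)) M) : ahom w ∘ tfun0 Phi = aone M.
  by rewrite -psi_aone; exact: ahom1.
by rewrite !h.
Qed.

(** The product of the [D j], [j \in s], together with the universal property of its image under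
    [psi Phi]. It is stated for lists because a diagram of finite type has no chosen [finType]
    structure on its objects. *)
Lemma psi_finite_product (J : eqType) (D : J -> SG) (s : seq J) :
  exists (P : SG) (pr : forall j, j \in s -> gmap P (D j)),
  [/\ forall x y, (forall j (h : j \in s), pr j h x = pr j h y) -> x = y,
      forall (Z : SG) (f : forall j, gmap Z (D j)),
        exists u : gmap Z P, forall j (h : j \in s) z, pr j h (u z) = f j z,
      forall (M : algebra T) (u v : alg_hom (psi_ob Phi P) M),
        (forall j (h : j \in s), ahom u ∘ pull (pr j h) = ahom v ∘ pull (pr j h)) ->
        ahom u = ahom v &
      forall (M : algebra T) (q : forall j, alg_hom (psi_ob Phi (D j)) M),
        exists u : alg_hom (psi_ob Phi P) M,
        forall j (h : j \in s), ahom u ∘ pull (pr j h) = q j].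
Proof.
elim: s => [|j0 s [P [pr [sep ex psep pex]]]].
  exists (ptG G), (fun j (h : j \in [::]) => False_rect _ (notF h)).
  split=> [[] []//|Z f|M u v _|M q]; first by exists (gterm Z).
    by have [w wP] := psi_pt M; rewrite (wP u) (wP v).
  by have [w _] := psi_pt M; exists w.
have [j0s|j0s] := boolP (j0 \in s).
  have sE j : j \in j0 :: s -> j \in s by rewrite inE => /orP[/eqP->|].
  have sI j : j \in s -> j \in j0 :: s by rewrite inE orbC => ->.
  exists P, (fun j h => pr j (sE j h)); split=> [x y xy|Z f|M u v uv|M q].
  - by apply: sep => j h; rewrite (bool_irrelevance h (sE j (sI j h))).
  - by have [u uP] := ex Z f; exists u => j h z; exact: uP.
  - by apply: psep => j h; rewrite (bool_irrelevance h (sE j (sI j h))).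
  - by have [u uP] := pex M q; exists u => j h; exact: uP.
have sE j : j \in j0 :: s -> j0 <> j -> j \in s.
  by rewrite inE => /orP[/eqP->|].
pose pr' j (h : j \in j0 :: s) : gmap (prodG (D j0) P) (D j) := match j0 =P j with
  | ReflectT e => match e in _ = j return gmap (prodG (D j0) P) (D j) with
      erefl => gfst (D j0) P end
  | ReflectF ne => gcomp (pr j (sE j h ne)) (gsnd (D j0) P) end.
have pr'0 (h : j0 \in j0 :: s) : pr' j0 h = gfst (D j0) P.
  by rewrite /pr'; case: eqP => // e; rewrite (eq_axiomK e).
have pr's j (h : j \in j0 :: s) (h' : j \in s) : pr' j h = gcomp (pr j h') (gsnd (D j0) P).
  rewrite /pr'; case: eqP => [e|ne]; first by exfalso; case/negP: j0s; rewrite e.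
  by rewrite (bool_irrelevance (sE j h ne) h').
have mem0 : j0 \in j0 :: s by rewrite mem_head.
have memS j : j \in s -> j \in j0 :: s by rewrite inE orbC => ->.
exists (prodG (D j0) P), pr'; split=> [[x x'] [y y'] xy|Z f|M u v uv|M q].
- congr (_, _); first by have := xy j0 mem0; rewrite pr'0.
  by apply: sep => j h; have := xy j (memS j h); rewrite (pr's _ _ h).
- have [u uP] := ex Z f; exists (gpair (f j0) u) => j h z.
  case/orP: (h) => [/eqP e|js]; first by subst j; rewrite pr'0.
  by rewrite (pr's _ _ js) /= uP.
- apply: (@copair_unique k T _ _ (psi_ob Phi (prodG (D j0) P))
    (psi_map Phi (gfst _ _)) (psi_map Phi (gsnd _ _)) (tfun2V Phi (D j0) P)).
  + by rewrite -[RHS](tfun2VK Phi) -psi_prod.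
  + by have := uv j0 mem0; rewrite pr'0.
  + apply: (psep M (alg_comp u (psi_map Phi (gsnd (D j0) P)))
      (alg_comp v (psi_map Phi (gsnd (D j0) P)))) => j h.
    have := uv j (memS j h); rewrite (pr's _ _ h) -pullM => e.
    by rewrite /= -[LHS]compA -[RHS]compA.
- have [u uP] := pex M q.
  have [w [w1 w2]] := @copair_exists k T _ _ (psi_ob Phi (prodG (D j0) P))
    (psi_map Phi (gfst _ _)) (psi_map Phi (gsnd _ _)) (tfun2V Phi (D j0) P)
    (etrans (congr1 (fun x => x ∘ _) (psi_prod Phi (D j0) P)) (tfun2VK Phi _ _))
    (etrans (congr1 (fun x => _ ∘ x) (psi_prod Phi (D j0) P)) (tfun2K Phi _ _))
    M (q j0) u.
  exists w => j h; case/orP: (h) => [/eqP e|js]; first by subst j; rewrite pr'0.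
  by rewrite (pr's _ _ js) -pullM compA -(uP j js) -w2.
Qed.

Lemma psi_left_exact : left_exact (op_functor (psi Phi)).
Proof.
move=> J [Jfin _] D L p lim M q.
have [s sP] : exists s : seq {classic J}, forall j : {classic J}, j \in s.
  have /finite_seqP[s sE] : finite_set [set: {classic J}] by exact: Jfin.
  by exists s => j; have : [set: {classic J}] j by []; rewrite sE.
have [P [pr0 [sep ex psep pex]]] := psi_finite_product (fun j : {classic J} => D j) s.
pose pr (j : J) : gmap P (D j) := pr0 j (sP j).
have pr0E j h : pr0 j h = pr j by rewrite (bool_irrelevance h (sP j)).
have [i iP] : exists i : gmap L P, forall j z, pr j (i z) = gfun (p j) z.
  by have [i iP] := ex L p; exists i => j z; exact: iP.
have iinj : injective i.
  (* Uniqueness in the limit is tested on the orbit of [(x, y)] in [L × L], whose two projections to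
     [L] have the same components. *)
  move=> x y xy; pose xyL : prodG L L := (x, y).
  pose f1 : gmap (orbG xyL) L := gcomp (gfst L L) (orbG_incl xyL).
  pose f2 : gmap (orbG xyL) L := gcomp (gsnd L L) (orbG_incl xyL).
  have f12 j : p j ∘ f1 = p j ∘ f2 :> @hom (S_cat G) _ _.
    apply: gmap_ext => z /=; have [g ->] := svalP z.
    by rewrite -!iP /= !gfunP xy.
  pose c1 j : @hom (S_cat G) (orbG xyL) (D j) := p j ∘ f1.
  have c1P a b (w : hom a b) : fmap D w ∘ c1 a = c1 b by rewrite compA cproj_nat.
  have [u [_ uU]] := lim _ (Cone c1P).
  have e1 : u = f1 by apply: uU.
  have e2 : u = f2 by apply: uU => j; rewrite -f12.
  exact: (congr1 (fun f : gmap (orbG xyL) L => f (exist _ xyL (orb_refl xyL)))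
    (etrans (esym e1) e2)).
have icover (t : P) : (forall a b (w : hom a b), gfun (fmap D w) (pr a t) = pr b t) ->
    exists x, i x = t.
  move=> ht.
  (* Invariance spreads the equations from [t] to its orbit, which thus carries a cone; the induced
     map to [L] provides the preimage of [t]. *)
  pose c1 j : @hom (S_cat G) (orbG t) (D j) := gcomp (pr j) (orbG_incl t).
  have c1P a b (w : hom a b) : fmap D w ∘ c1 a = c1 b.
    by apply: gmap_ext => z /=; have [g ->] := svalP z; rewrite !gfunP ht.
  have [u [uP _]] := lim _ (Cone c1P).
  exists (gfun u (exist (orb t) t (orb_refl t))); apply: sep => j h.
  rewrite pr0E iP.
  exact: (congr1 (fun f : gmap (orbG t) (D j) => f (exist _ t (orb_refl t))) (uP j)).
(* [L] is cut out of the product [P] by the equations [D w (pr a t) = pr b t]. *)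
have fixL (u : alg_hom (psi_ob Phi P) M) :
    (forall a b (w : hom a b), ahom u ∘ pull (gcomp (fmap D w) (pr a)) = ahom u ∘ pull (pr b)) ->
    ahom u ∘ (fmap Phi (push_hom mu i) ∘ pull i) = ahom u.
  move=> uw; rewrite -fmapM.
  have -> : push_hom mu i ∘ pull_hom mu i = diag_hom mu (ipush mu i (icst L 1)).
    exact/esym/diagmx_push1.
  (* The indicator of the complement of the image of [i]. Each orbit in its support violates some
     equation of the diagram, so [u] kills it by [psi_equalizer]. *)
  pose e := icst P 1 - ipush mu i (icst L 1).
  have ue : ahom u ∘ fmap Phi (diag_hom mu e) = 0.
    rewrite (invfun_decomp mu e) /diag_hom diagmx_sum.
    rewrite tfun_sum comp_sumr big1 // => t _.
    have -> : diagmx (e t *: orb_ind mu t) = e t *: diag_hom mu (orb_ind mu t).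
      by apply: invfun_ext => z /=; rewrite mulrA.
    rewrite tfunZ compZr.
    have [[x xt]|nt] := pselect (exists x, i x = t).
      rewrite -[e t]/(1 - ipush mu i (icst L 1) t) -xt ipush_inj // subrr.
      exact: scale0r.
    have [a [b [w ne]]] : exists a b (w : hom a b), gfun (fmap D w) (pr a t) <> pr b t.
      apply: contra_notP nt => nw; apply: icover => a b w.
      by apply: contra_notP nw => ne; exists a, b, w.
    by rewrite (psi_equalizer (uw a b w) ne) scaler0.
  rewrite -[RHS]compm1 -fmap1 -[LHS]addr0 -ue -compDr -tfunD; congr (_ ∘ fmap Phi _).
  transitivity (diagmx (icst P (1 : k))); last exact: diagmx1.
  by apply: invfun_ext => z /=; rewrite -mulrDl addrC subrK.
have qw a b (w : hom a b) : ahom (q a) ∘ pull (fmap D w) = ahom (q b).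
  exact: (congr1 (@ahom _ _ _ _) (cproj_nat q w)).
have piE j : pull i ∘ pull (pr j) = pull (p j).
  by rewrite pullM; congr (fmap Phi _); apply: pullmx_eq => z /=; exact: iP.
have [u uP] := pex M q.
have {}uP j : ahom u ∘ pull (pr j) = ahom (q j) by rewrite -uP pr0E.
have uL : ahom u ∘ (fmap Phi (push_hom mu i) ∘ pull i) = ahom u.
  by apply: fixL => a b w; rewrite -pullM compA !uP qw.
have ipK : pull i ∘ fmap Phi (push_hom mu i) = idm (Phi L).
  by rewrite -fmapM -fmap1; congr (fmap Phi _); exact: pull_push_inj.
(* Since [u] absorbs [i_* i^*], it factors through [i^*] with quotient [u ∘ i_*]. *)
pose v := ahom u ∘ fmap Phi (push_hom mu i).
have vi : v ∘ ahom (psi_map Phi i) = ahom u by rewrite -compA.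
(* The push-forward along [i] need not be unital, so multiplicativity of [v] is checked after
   composing with the split epimorphism [i^*], where [v] becomes [u]. *)
have vM : v ∘ amul (psi_ob Phi L) = amul M ∘ (v ⊠ v).
  apply: (@cancel_epi _ _ _ _ (pull i ⊠ pull i) (fmap Phi (push_hom mu i) ⊠ fmap Phi (push_hom mu i))).
    by rewrite -tensmM ipK tensm1.
  transitivity (v ∘ (ahom (psi_map Phi i) ∘ amul (psi_ob Phi P))).
    by rewrite -[LHS]compA; congr (_ ∘ _); exact/esym/(ahomM (psi_map Phi i)).
  by rewrite [LHS]compA vi ahomM -[RHS]compA -tensmM vi.
have v1 : v ∘ aone (psi_ob Phi L) = aone M.
  by rewrite -(ahom1 (psi_map Phi i)) compA vi ahom1.
exists (@AlgHom k T (psi_ob Phi L) M v vM v1); split=> [j|v' v'P]; apply: alg_hom_ext.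
  by rewrite -[LHS]/(v ∘ pull (p j)) -piE compA vi uP.
apply: (cancel_epi ipK); rewrite -[LHS]/(v ∘ ahom (psi_map Phi i)) vi.
rewrite -[RHS]/(ahom (alg_comp v' (psi_map Phi i))).
apply: psep => j h; rewrite pr0E uP -[RHS]/((ahom v' ∘ pull i) ∘ pull (pr j)).
by rewrite -[RHS]compA piE; exact: (congr1 (@ahom _ _ _ _) (esym (v'P j))).
Qed.

End LeftExact.

Lemma conj_square (C : category) (X X' Y Y' : C) (a : hom X X') (a' : hom X' X) (b : hom Y Y')
    (b' : hom Y' Y) (f : hom Y X) (g : hom Y' X') :
  a ∘ a' = idm X' -> b' ∘ b = idm Y -> f ∘ b' = a' ∘ g -> a ∘ f = g ∘ b.
Proof.
by move=> aa bb e; rewrite -[f]compm1 -bb (whisk2 e) -[a' ∘ g ∘ b]compA (whisk2 aa) comp1m.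
Qed.

(** * Full faithfulness *)

Section FullyFaithful.
Variables (k : fieldType) (G : proOligoGroup) (mu : measure G k) (T : tensorCat k).
Local Notation SG := (sgset G).

Section Extension.
Variables Phi Phi' : tensor_functor (Perm mu) T.
Variable b : @iso_hom (functor_cat (op (S_cat G)) (et_cat T)) (psi Phi) (psi Phi').

Definition iso_comp (X : SG) : hom (Phi X) (Phi' X) := ahom (ntc (ihom b) X).

Lemma iso_comp_inv X : exists c : hom (psi_ob Phi' X) (psi_ob Phi X),
  ahom c ∘ iso_comp X = idm _ /\ iso_comp X ∘ ahom c = idm _.
Proof.
have [c [cb bc]] := ihomP b; exists (ntc c X); split.
- by have := congr1 (fun a : nat_trans (psi Phi) (psi Phi) => ahom (ntc a X)) cb.
- by have := congr1 (fun a : nat_trans (psi Phi') (psi Phi') => ahom (ntc a X)) bc.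
Qed.

Lemma iso_comp_pull (X Y : SG) (f : gmap Y X) :
  iso_comp Y ∘ fmap Phi (pull_hom mu f) = fmap Phi' (pull_hom mu f) ∘ iso_comp X.
Proof. exact: (congr1 (@ahom _ _ _ _) (ntP (ihom b) (f : @hom (op (S_cat G)) X Y))). Qed.

(** An isomorphism of étale algebras has its inverse as transpose, so transposing the naturality
    square for [f^*] gives the square for [f_*] with the vertical maps inverted. *)
Lemma iso_comp_push (X Y : SG) (f : gmap Y X) :
  iso_comp X ∘ fmap Phi (push_hom mu f) = fmap Phi' (push_hom mu f) ∘ iso_comp Y.
Proof.
rewrite -!psi_transpose.
have [cX [cbX bcX]] := iso_comp_inv X; have [cY [cbY bcY]] := iso_comp_inv Y.
pose bX : @hom (et_cat T) (psi_ob Phi X) (psi_ob Phi' X) := ntc (ihom b) X.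
pose bY : @hom (et_cat T) (psi_ob Phi Y) (psi_ob Phi' Y) := ntc (ihom b) Y.
have e : @comp (et_cat T) _ _ _ bY (psi_map Phi f) = @comp (et_cat T) _ _ _ (psi_map Phi' f) bX.
  exact: (ntP (ihom b) (f : @hom (op (S_cat G)) X Y)).
have := congr1 (@et_transpose _ _ _ _) e; rewrite !et_transpose_comp.
rewrite (@et_transpose_iso _ _ _ _ bX (ahom cX) bcX cbX).
rewrite (@et_transpose_iso _ _ _ _ bY (ahom cY) bcY cbY) => e'.
exact: (@conj_square T _ _ _ _ (iso_comp X) (ahom cX) (iso_comp Y) (ahom cY) _ _ bcX cbY e').
Qed.

Lemma iso_comp_nat (X Y : Perm mu) (A : hom X Y) :
  iso_comp Y ∘ fmap Phi A = fmap Phi' A ∘ iso_comp X.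
Proof.
have -> : A = \sum_(t <- orbreps (prodG Y X)) (A : gmatrix k X Y) t *:
    (push_hom mu (gcomp (gfst Y X) (orbG_incl t)) ∘ pull_hom mu (gcomp (gsnd Y X) (orbG_incl t))).
  exact: gmatrix_decomp.
rewrite !tfun_sum comp_sumr comp_suml; apply: eq_bigr => t _.
rewrite !tfunZ compZr compZl; congr (_ *: _).
by rewrite !fmapM compA iso_comp_push -!compA iso_comp_pull.
Qed.

Lemma iso_comp_tens (X Y : Perm mu) :
  iso_comp (X ⊗ Y) ∘ tfun2 Phi X Y = tfun2 Phi' X Y ∘ (iso_comp X ⊠ iso_comp Y).
Proof.
rewrite -!psi_prod; have := ahomM (ntc (ihom b) (prodG X Y)) => /= /whisk2 ->.
by rewrite -[LHS]compA -[RHS]compA -!tensmM -!iso_comp_pull.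
Qed.

Lemma iso_comp_unit : iso_comp (ptG G) ∘ tfun0 Phi = tfun0 Phi'.
Proof.
by rewrite -!psi_aone; exact: (ahom1 (ntc (ihom b) (ptG G))).
Qed.

Definition iso_extend : monoidal_trans Phi Phi' :=
  @MonoidalTrans k (Perm mu) T Phi Phi' (NatTrans iso_comp_nat) iso_comp_tens iso_comp_unit.

End Extension.

Lemma psi_fully_faithful : fully_faithful (psi_functor mu T).
Proof.
move=> Phi Phi'; exists (@iso_extend Phi Phi') => [a|b].
  exact: monoidal_trans_ext.
apply: iso_hom_ext; apply: nat_trans_ext => X; exact: alg_hom_ext.
Qed.

End FullyFaithful.

(** * Reconstruction of the tensor functor *)

Section Orbits.
Variable G : proOligoGroup.
Local Notation SG := (sgset G).

(** Additivity and biproducts are indexed by a [finType], so the orbits are numbered by ordinals. *)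
Definition orbrep (Z : SG) (i : 'I_(size (orbreps Z))) : Z := tnth (in_tuple (orbreps Z)) i.

Lemma orbrep_inj (Z : SG) (i j : 'I_(size (orbreps Z))) :
  orb (orbrep i) = orb (orbrep j) -> i = j.
Proof.
move=> e; apply: val_inj => /=; have z := orbrep i.
have := orbreps_uniq Z => /(nth_uniq (orb z)) => /(_ i j).
rewrite !size_map !ltn_ord !(nth_map z) ?ltn_ord // => /(_ isT isT) ij.
by apply/eqP; rewrite -ij -!(tnth_nth z (in_tuple (orbreps Z))) -e.
Qed.

Lemma orbrep_cover (Z : SG) (z : Z) : exists i : 'I_(size (orbreps Z)), orb (orbrep i) = orb z.
Proof.
have iP : (index (orb z) (map (@orb G Z) (orbreps Z)) < size (orbreps Z))%N.
  by rewrite -(size_map (@orb G Z)) index_mem mem_orbreps.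
exists (Ordinal iP); rewrite /orbrep (tnth_nth z) /= -(nth_map z (orb z)) //.
by rewrite nth_index ?mem_orbreps.
Qed.

Lemma orbit_coproduct (Z : SG) :
  @is_coproduct (S_cat G) 'I_(size (orbreps Z)) (fun i => orbG (orbrep i)) Z
    (fun i => orbG_incl (orbrep i)).
Proof.
move=> M q.
have /choice[c cP] : forall z : Z, exists i, orb (orbrep i) z.
  by move=> z; have [i e] := orbrep_cover z; exists i; rewrite e; exact: orb_refl.
pose u z : gcar M := gfun (q (c z)) (exist _ z (cP z)).
have uE i z (h : orb (orbrep i) z) : u z = gfun (q i) (exist _ z h).
  have ic : c z = i by apply: orbrep_inj; rewrite -(orb_eq (cP z)) -(orb_eq h).
  rewrite /u; move: (cP z); rewrite ic => h'.
  by rewrite (Prop_irrelevance h' h).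
have uP g z : u (gact g z) = gact g (u z).
  rewrite (uE (c z) _ (orb_inv g (cP z))).
  by rewrite -[RHS](gfunP (q (c z)) g); congr gfun; exact: sub_ext.
exists (@GMap G Z M u uP : @hom (S_cat G) Z M); split=> [i|v vP]; apply: gmap_ext.
  by move=> [z h] /=; rewrite (uE i z h).
by move=> z /=; rewrite /u -vP.
Qed.

End Orbits.

Section Backward.
Variables (k : fieldType) (G : proOligoGroup) (mu : measure G k) (T : tensorCat k).
Variable Psi : functor (op (S_cat G)) (et_cat T).
Local Notation SG := (sgset G).
Implicit Types X Y Z W : SG.

Definition efib X : et_cat T := fobj Psi X.

Definition et_pull X Y (f : gmap Y X) : hom (efib X) (efib Y) :=
  @fmap (op (S_cat G)) (et_cat T) Psi X Y f.

Definition pb X Y (f : gmap Y X) : hom (efib X : T) (efib Y) := ahom (et_pull f).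

(** The push-forward [f_*]. It is locked because [et_transpose] is itself a long composite, which
    rewriting with [compA] would take apart. *)
Definition tr X Y (f : gmap Y X) : hom (efib Y : T) (efib X) :=
  locked (et_transpose (et_pull f)).

Lemma trE X Y (f : gmap Y X) : tr f = et_transpose (et_pull f).
Proof. by rewrite /tr -lock. Qed.

Lemma et_pull_id X : et_pull (gid X) = idm (efib X).
Proof. exact: (fmap1 Psi X). Qed.

Lemma et_pull_comp X Y Z (f : gmap Y X) (g : gmap Z Y) :
  et_pull (gcomp f g) = et_pull g ∘ et_pull f.
Proof. exact: (@fmapM _ _ Psi X Y Z g f). Qed.

Lemma pb_id X : pb (gid X) = idm (efib X : T).
Proof. by rewrite /pb et_pull_id. Qed.

Lemma tr_id X : tr (gid X) = idm (efib X : T).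
Proof. by rewrite trE et_pull_id et_transpose_id. Qed.

Lemma pb_comp X Y Z (f : gmap Y X) (g : gmap Z Y) : pb (gcomp f g) = pb g ∘ pb f.
Proof. by rewrite /pb et_pull_comp. Qed.

Lemma tr_comp X Y Z (f : gmap Y X) (g : gmap Z Y) : tr (gcomp f g) = tr f ∘ tr g.
Proof. by rewrite !trE et_pull_comp et_transpose_comp. Qed.

Lemma pb_eq X Y (f g : gmap Y X) : (forall y, f y = g y) -> pb f = pb g.
Proof. by move=> fg; congr pb; exact: gmap_ext. Qed.

Lemma tr_eq X Y (f g : gmap Y X) : (forall y, f y = g y) -> tr f = tr g.
Proof. by move=> fg; congr tr; exact: gmap_ext. Qed.

Hypothesis Padd : additive_functor (op_functor Psi).

(** The direct sum of the étale algebras [Psi (X i)] is their product, so it is [Psi S]. *)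
Lemma coproduct_biproduct (I : finType) (X : I -> SG) (S : SG) (inj : forall i, gmap (X i) S) :
  @is_coproduct (S_cat G) I X S inj ->
  is_biproduct (fun i => tr (inj i)) (fun i => pb (inj i)).
Proof.
move=> cop; have pc := Padd cop.
have [S' [jn [p bip]]] := finite_biproduct (fun i => efib (X i) : T).
pose A i := efib (X i); pose D : et_cat T := @sum_et k T I A S' jn p bip.
(* Additivity gives [psi] from the product algebra [D] to [Psi S], and the product property of [D]
   gives [phi] back. They are mutually inverse because both commute with the projections. *)
have [psi [psiP _]] := pc D (@sum_pr k T I A S' jn p bip).
pose phi : hom (efib S) D := @sum_tuple k T I A S' jn p bip (efib S) (fun i => et_pull (inj i)).
have prphi i : p i ∘ ahom phi = pb (inj i) by exact: (@sum_pr_tuple k T I A S' jn p bip).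
have pbpsi i : pb (inj i) ∘ ahom (psi : hom D (efib S)) = p i.
  exact: (congr1 (@ahom _ _ _ _) (psiP i)).
have phipsi : ahom phi ∘ ahom (psi : hom D (efib S)) = idm _.
  by apply: (biproduct_monic bip) => i; rewrite compA prphi pbpsi compm1.
have psiphi : ahom (psi : hom D (efib S)) ∘ ahom phi = idm _.
  have [w [_ wU]] := pc (efib S) (fun i => et_pull (inj i)).
  have e1 : w = idm (efib S) by apply: wU => i; exact: (compm1 (et_pull (inj i))).
  have e2 : w = @comp (et_cat T) _ _ _ psi phi.
    apply: wU => i; apply: alg_hom_ext.
    by rewrite -[LHS]/(pb (inj i) ∘ (ahom (psi : hom D (efib S)) ∘ ahom phi)) compA pbpsi prphi.
  by have := congr1 (fun v : hom (efib S) (efib S) => ahom v) (etrans (esym e2) e1).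
have trinj i : tr (inj i) = ahom (psi : hom D (efib S)) ∘ jn i.
  have e : et_pull (inj i) = @comp (et_cat T) _ _ _ (@sum_pr k T I A S' jn p bip i) phi.
    by apply: alg_hom_ext; rewrite -[LHS]/(pb (inj i)) -prphi.
  rewrite trE e et_transpose_comp sum_pr_transpose; congr (_ ∘ _).
  exact: et_transpose_iso.
case: (bip) => i1 i0 s1; split=> [i|i j ij|].
- by rewrite trinj compA pbpsi i1.
- by rewrite trinj compA pbpsi i0.
- under eq_bigr => i _ do rewrite trinj -prphi -compA [jn i ∘ _]compA.
  by rewrite -comp_sumr -comp_suml s1 comp1m.
Qed.

Lemma orbit_biproduct Z : is_biproduct (fun i => tr (orbG_incl (@orbrep G Z i)))
  (fun i => pb (orbG_incl (@orbrep G Z i))).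
Proof. exact: (coproduct_biproduct (@orbit_coproduct G Z)). Qed.

Hypothesis Pcomp : compatible mu Psi.

Lemma mval_finitary_transitive X Y (tX : transitive_gset X) (tY : transitive_gset Y)
  (f : gmap Y X) : mval_finitary mu tX f = mval mu tY tX f.
Proof.
have [y0 y0P] := tY.
have mE : mval mu tY tX f = morb mu f y0.
  by apply: (@mval_morb k G mu _ _ _ _ _ _ _ f (gid Y) (gid X) y0).
rewrite mE -(@sum_pick k G Y (morb mu f) y0) => [|y y' yy']; last exact: morb_orb.
rewrite [RHS]big_mkcond; apply: eq_bigr => y _.
rewrite (orb_eq (y0P y)) eqxx.
by apply: (@mval_morb k G mu _ _ _ _ _ _ _ f (orbG_incl y) (gid X)
  (exist _ y (orb_refl y))) => // u v; exact: sub_ext.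
Qed.

Lemma tr_pb_transitive X Y (tX : transitive_gset X) (tY : transitive_gset Y) (f : gmap Y X) :
  tr f ∘ pb f = mval mu tY tX f *: idm (efib X : T).
Proof.
rewrite -(mval_finitary_transitive tX tY f).
by rewrite trE; apply: et_transpose_scalar; exact: (proj1 (compatibleP mu Psi) Pcomp).
Qed.

Definition proj_orb Z (z : Z) : hom (efib Z : T) (efib Z) :=
  tr (orbG_incl z) ∘ pb (orbG_incl z).

Section SameOrbit.
Variables (Z : SG) (z t : Z).
Hypothesis zt : orb t = orb z.

Lemma same_orbit_sub x : orb z x -> orb t x.
Proof. by rewrite zt. Qed.

Definition same_orbit_fun (x : orbG z) : orbG t := exist _ (sval x) (same_orbit_sub (svalP x)).

Lemma same_orbit_act g x : same_orbit_fun (gact g x) = gact g (same_orbit_fun x).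
Proof. exact: sub_ext. Qed.

Definition same_orbit : gmap (orbG z) (orbG t) := GMap same_orbit_act.

Lemma same_orbit_incl : gcomp (orbG_incl t) same_orbit = orbG_incl z.
Proof. exact: gmap_ext. Qed.

(** Changing the representative is an isomorphism of orbits; it has measure [1], so its [tr ∘ pb] is
    the identity. *)
Lemma proj_orb_eq : proj_orb z = proj_orb t.
Proof.
rewrite /proj_orb -same_orbit_incl tr_comp pb_comp -compA (compA (tr same_orbit)).
rewrite (tr_pb_transitive (orbG_trans t) (orbG_trans z)) mval_iso ?scale1r ?comp1m //.
apply: bij_is_iso => [x y xy|[x tx]]; first by apply: sub_ext; exact: (congr1 sval xy).
have zx : orb z x by rewrite -zt.
by exists (exist _ x zx); exact: sub_ext.
Qed.

End SameOrbit.

Lemma pb_proj_orb Z (x z : Z) :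
  pb (orbG_incl x) ∘ proj_orb z = (orb z == orb x)%:R *: pb (orbG_incl x).
Proof.
have [i ix] := orbrep_cover x; have [j jz] := orbrep_cover z.
have [i1 i0 _] := orbit_biproduct Z.
rewrite (proj_orb_eq jz) -(same_orbit_incl ix) pb_comp -compA -ix -jz /proj_orb.
rewrite [pb (orbG_incl (orbrep i)) ∘ _]compA.
have [ij|ij] := eqVneq i j; first by subst j; rewrite i1 comp1m eqxx scale1r.
rewrite i0 // comp0l comp0r; case: eqP => [/orbrep_inj ji|_]; last by rewrite scale0r.
by rewrite ji eqxx in ij.
Qed.

Lemma proj_orb_tr Z (x z : Z) :
  proj_orb z ∘ tr (orbG_incl x) = (orb z == orb x)%:R *: tr (orbG_incl x).
Proof.
have [i ix] := orbrep_cover x; have [j jz] := orbrep_cover z.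
have [i1 i0 _] := orbit_biproduct Z.
rewrite (proj_orb_eq jz) -(same_orbit_incl ix) tr_comp compA -ix -jz /proj_orb.
rewrite -[tr (orbG_incl (orbrep j)) ∘ _ ∘ _]compA.
have [ij|ij] := eqVneq i j; first by subst j; rewrite i1 compm1 eqxx scale1r.
rewrite i0 1?eq_sym // comp0r comp0l; case: eqP => [/orbrep_inj ji|_]; last by rewrite scale0r.
by rewrite ji eqxx in ij.
Qed.

Lemma pb_orb_monic Z (W : T) (f g : hom W (efib Z)) :
  (forall x : Z, pb (orbG_incl x) ∘ f = pb (orbG_incl x) ∘ g) -> f = g.
Proof. by move=> fg; apply: (biproduct_monic (orbit_biproduct Z)) => i; exact: fg. Qed.

Lemma tr_orb_epic Z (W : T) (f g : hom (efib Z : T) W) :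
  (forall x : Z, f ∘ tr (orbG_incl x) = g ∘ tr (orbG_incl x)) -> f = g.
Proof.
move=> fg; have [_ _ s1] := orbit_biproduct Z.
rewrite -[f]compm1 -[g]compm1 -s1 !comp_sumr; apply: eq_bigr => i _.
by rewrite [LHS]compA [RHS]compA fg.
Qed.

(** [mult a] is multiplication by the point of [Psi Z] that corresponds to [a]; [proj_orb z] is
    the idempotent cutting out the summand [Psi (orbG z)]. *)
Definition mult Z (a : invfun k Z) : hom (efib Z : T) (efib Z) :=
  \sum_(t <- orbreps Z) a t *: proj_orb t.

Lemma pb_mult Z (a : invfun k Z) (x : Z) :
  pb (orbG_incl x) ∘ mult a = a x *: pb (orbG_incl x).
Proof.
rewrite /mult comp_sumr -(@sum_pick k G Z a x) => [|y z]; last exact: invfun_orb.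
rewrite scaler_suml [RHS]big_mkcond; apply: eq_bigr => t _.
rewrite compZr pb_proj_orb; case: eqP => _; last by rewrite scale0r scaler0.
by rewrite scale1r.
Qed.

Lemma mult_tr Z (a : invfun k Z) (x : Z) :
  mult a ∘ tr (orbG_incl x) = a x *: tr (orbG_incl x).
Proof.
rewrite /mult comp_suml -(@sum_pick k G Z a x) => [|y z]; last exact: invfun_orb.
rewrite scaler_suml [RHS]big_mkcond; apply: eq_bigr => t _.
rewrite compZl proj_orb_tr; case: eqP => _; last by rewrite scale0r scaler0.
by rewrite scale1r.
Qed.

Lemma multM Z (a b : invfun k Z) : mult (imul a b) = mult a ∘ mult b.
Proof.
apply: pb_orb_monic => x; rewrite pb_mult compA pb_mult compZl pb_mult scalerA.
by [].
Qed.

Lemma mult1 Z : mult (icst Z 1) = idm (efib Z : T).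
Proof. by apply: pb_orb_monic => x; rewrite pb_mult scale1r compm1. Qed.

Lemma mult_lin Z : linear (@mult Z).
Proof.
move=> c a b; apply: pb_orb_monic => x.
by rewrite pb_mult compDr compZr !pb_mult scalerA -scalerDl.
Qed.

Lemma orb_restr_incl X Y (f : gmap Y X) y :
  gcomp f (orbG_incl y) = gcomp (orbG_incl (f y)) (orb_restr f y).
Proof. exact: gmap_ext. Qed.

Lemma mult_pb X Y (f : gmap Y X) (a : invfun k X) : mult (ipull f a) ∘ pb f = pb f ∘ mult a.
Proof.
apply: pb_orb_monic => y; rewrite !compA pb_mult compZl -pb_comp orb_restr_incl pb_comp.
by rewrite -[RHS]compA pb_mult compZr.
Qed.

Lemma tr_mult X Y (f : gmap Y X) (a : invfun k X) : tr f ∘ mult (ipull f a) = mult a ∘ tr f.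
Proof.
apply: tr_orb_epic => y; rewrite -!compA mult_tr compZr -tr_comp orb_restr_incl tr_comp.
by rewrite [RHS]compA mult_tr compZl.
Qed.

(** On the orbit of [y] the map [f] is a map of transitive sets, where [tr ∘ pb] is the scalar
    [morb mu f y]. This carries the projector of [y] to that multiple of the projector of [f y], and
    summing over orbits yields the integral. *)
Lemma tr_mult_pb X Y (f : gmap Y X) (a : invfun k Y) :
  tr f ∘ (mult a ∘ pb f) = mult (ipush mu f a).
Proof.
apply: pb_orb_monic => x; rewrite pb_mult /= scaler_suml.
rewrite /mult comp_suml comp_sumr comp_sumr [RHS]big_mkcond; apply: eq_bigr => y _.
transitivity ((a y * morb mu f y) *: (pb (orbG_incl x) ∘ proj_orb (f y))).
  rewrite compZl !compZr -scalerA; congr (_ *: _).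
  rewrite -compZr; congr (_ ∘ _).
  rewrite /proj_orb -(compA (tr (orbG_incl y))) -pb_comp (compA (tr f)) -tr_comp.
  rewrite orb_restr_incl tr_comp pb_comp -(compA (tr (orbG_incl (f y)))).
  rewrite (compA (tr (orb_restr f y))).
  by rewrite (tr_pb_transitive (orbG_trans (f y)) (orbG_trans y)) compZl comp1m compZr.
rewrite pb_proj_orb; case: eqP => _; last by rewrite scale0r scaler0.
by rewrite scale1r.
Qed.

End Backward.

(** * Finite products and the tensor structure of [Psi] *)

Section DiscreteLimits.

(** Arrows are equalities, so hom-types have at most one element and the category is finite when [I]
    is. Indexing by [bool] gives binary products, and by [void] the terminal object. *)
Definition discrete_cat (I : Type) : category :=
  @Category I (fun i j => i = j) (fun i => erefl i) (fun i j l g f => etrans f g)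
    (fun i j f => Prop_irrelevance _ _) (fun i j f => Prop_irrelevance _ _)
    (fun i j l m h g f => Prop_irrelevance _ _).

Lemma discrete_finite (I : finType) : finite_category (discrete_cat I).
Proof.
split; first exact: finite_finset.
move=> i j; have [e|ne] := pselect (i = j).
  by apply: (sub_finite_set (B := [set e])) => [e' _|]; [exact: Prop_irrelevance|exact: finite_set1].
by apply: (sub_finite_set (B := set0)) => // e; case: (ne e).
Qed.

Variable C : category.

Definition is_product (I : Type) (X : I -> C) (L : C) (p : forall i, hom L (X i)) : Prop :=
  forall (M : C) (q : forall i, hom M (X i)), exists! u : hom M L, forall i, p i ∘ u = q i.

Definition discrete_map (I : Type) (X : I -> C) (i j : I) (e : i = j) : hom (X i) (X j) :=
  match e in _ = j return hom (X i) (X j) with erefl => idm (X i) end.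

Lemma discrete_mapM (I : Type) (X : I -> C) (i j l : I) (g : j = l) (f : i = j) :
  discrete_map X (etrans f g) = discrete_map X g ∘ discrete_map X f.
Proof. by case: l / g; case: j / f; rewrite /= comp1m. Qed.

Definition discrete_diagram (I : Type) (X : I -> C) : functor (discrete_cat I) C :=
  @Functor (discrete_cat I) C X (@discrete_map I X) (fun i => erefl) (@discrete_mapM I X).

Lemma left_exact_product (C' : category) (F : functor C C') :
  left_exact F -> forall (I : finType) (X : I -> C) (L : C) (p : forall i, hom L (X i)),
    is_product p -> forall (M : C') (q : forall i, hom M (F (X i))),
    exists! u : hom M (F L), forall i, fmap F (p i) ∘ u = q i.
Proof.
move=> lF I X L p pP M q.
have cP (i j : I) (e : i = j) :
    fmap (discrete_diagram X) (e : @hom (discrete_cat I) i j) ∘ p i = p j.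
  by case: j / e; exact: comp1m.
have lim : is_limit (@Cone (discrete_cat I) C (discrete_diagram X) L p cP).
  by move=> N r; exact: (pP N r).
have cP' (i j : I) (e : i = j) :
    fmap (comp_functor F (discrete_diagram X)) (e : @hom (discrete_cat I) i j) ∘ q i = q j.
  by case: j / e; rewrite /= fmap1 comp1m.
have [u [uP uU]] := lF _ (discrete_finite I) _ _ _ lim M
  (@Cone (discrete_cat I) C' (comp_functor F (discrete_diagram X)) M q cP').
by exists u; split=> [i|v vP]; [exact: (uP i) | exact: uU].
Qed.

End DiscreteLimits.

Section BackwardTensor.
Variables (k : fieldType) (G : proOligoGroup) (mu : measure G k) (T : tensorCat k).
Variable Psi : functor (op (S_cat G)) (et_cat T).
Local Notation SG := (sgset G).
Local Notation efib := (efib Psi).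
Local Notation et_pull := (et_pull Psi).
Local Notation pb := (pb Psi).
Local Notation tr := (tr Psi).
Local Notation mult := (mult Psi).
Implicit Types X Y Z W : SG.

Hypothesis Pleft : left_exact (op_functor Psi).

Lemma prodG_product X Y : @is_product (S_cat G) bool (fun b => if b then X else Y) (prodG X Y)
  (fun b => if b return @hom (S_cat G) (prodG X Y) (if b then X else Y) then gfst X Y else gsnd X Y).
Proof.
move=> M q; exists (gpair (q true) (q false)); split=> [[]|u uP]; try exact: gmap_ext.
apply: gmap_ext => z /=; rewrite -(uP true) -(uP false) /=.
by case: (gfun u z).
Qed.

Definition box_hom X Y : hom (tens_et (efib X) (efib Y)) (efib (prodG X Y)) :=
  tens_copair (et_pull (gfst X Y)) (et_pull (gsnd X Y)).

(** The inverse comes from the universal property of [Psi (X × Y)] applied to the two inclusions.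
    One composite is the identity because the inclusions generate the tensor product, the other by
    uniqueness in [prodE]. *)
Lemma box_inv X Y : exists V : hom (efib (prodG X Y)) (tens_et (efib X) (efib Y)),
  ahom V ∘ ahom (box_hom X Y) = idm _ /\ ahom (box_hom X Y) ∘ ahom V = idm _.
Proof.
have prodE := left_exact_product Pleft (@prodG_product X Y).
pose q b : hom (efib (if b then X else Y)) (tens_et (efib X) (efib Y)) :=
  if b return hom (efib (if b then X else Y)) (tens_et (efib X) (efib Y)) then
    (tens_inl _ _ : hom (efib X) (tens_et (efib X) (efib Y)))
  else (tens_inr _ _ : hom (efib Y) (tens_et (efib X) (efib Y))).
have [V [VP _]] := prodE (tens_et (efib X) (efib Y)) q.
have V1 : ahom (V : hom (efib (prodG X Y)) (tens_et (efib X) (efib Y))) ∘ pb (gfst X Y) =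
    tens_inl (efib X) (efib Y) by exact: (congr1 (@ahom _ _ _ _) (VP true)).
have V2 : ahom (V : hom (efib (prodG X Y)) (tens_et (efib X) (efib Y))) ∘ pb (gsnd X Y) =
    tens_inr (efib X) (efib Y) by exact: (congr1 (@ahom _ _ _ _) (VP false)).
have J1 : ahom (box_hom X Y) ∘ ahom (tens_inl (efib X) (efib Y)) = pb (gfst X Y).
  exact: tens_copair_inl.
have J2 : ahom (box_hom X Y) ∘ ahom (tens_inr (efib X) (efib Y)) = pb (gsnd X Y).
  exact: tens_copair_inr.
exists V; split.
- apply: (@copair_unique k T _ _ (tens_alg (efib X) (efib Y)) (tens_inl (efib X) (efib Y))
    (tens_inr (efib X) (efib Y)) (idm _) _ _
    (alg_comp (V : hom (efib (prodG X Y)) (tens_et (efib X) (efib Y))) (box_hom X Y))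
    (alg_id (tens_alg (efib X) (efib Y)))).
  + by rewrite amul_inl_inr compm1.
  + by rewrite -[LHS]compA J1 V1 [RHS]comp1m.
  + by rewrite -[LHS]compA J2 V2 [RHS]comp1m.
- pose q' b : hom (efib (if b then X else Y)) (efib (prodG X Y)) :=
    if b return hom (efib (if b then X else Y)) (efib (prodG X Y)) then
      et_pull (gfst X Y) else et_pull (gsnd X Y).
  have [w [_ wU]] := prodE (efib (prodG X Y)) q'.
  have e1 : w = idm (efib (prodG X Y)) by apply: wU => -[];
    [exact: (comp1m (et_pull (gfst X Y))) | exact: (comp1m (et_pull (gsnd X Y)))].
  have e2 : w = @comp (et_cat T) _ _ _ (box_hom X Y) V.
    apply: wU => -[]; apply: alg_hom_ext.
      by rewrite -[LHS]/((ahom (box_hom X Y) ∘ ahom (V : hom (efib (prodG X Y))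
        (tens_et (efib X) (efib Y)))) ∘ pb (gfst X Y)) -compA V1 J1.
    by rewrite -[LHS]/((ahom (box_hom X Y) ∘ ahom (V : hom (efib (prodG X Y))
        (tens_et (efib X) (efib Y)))) ∘ pb (gsnd X Y)) -compA V2 J2.
  by have := congr1 (fun v : hom (efib (prodG X Y)) (efib (prodG X Y)) => ahom v)
    (etrans (esym e2) e1).
Qed.

Definition boxV_hom X Y : hom (efib (prodG X Y)) (tens_et (efib X) (efib Y)) :=
  projT1 (cid (box_inv X Y)).

Definition box X Y : hom ((efib X : T) ⊗ (efib Y : T)) (efib (prodG X Y)) :=
  locked (ahom (box_hom X Y)).
Definition boxV X Y : hom (efib (prodG X Y) : T) ((efib X : T) ⊗ (efib Y : T)) :=
  ahom (boxV_hom X Y).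

Lemma boxE X Y : box X Y = amul (efib (prodG X Y)) ∘ (pb (gfst X Y) ⊠ pb (gsnd X Y)).
Proof. by rewrite /box -lock. Qed.

Lemma box_homE X Y : ahom (box_hom X Y) = box X Y.
Proof. by rewrite /box -lock. Qed.

Lemma boxK X Y : boxV X Y ∘ box X Y = idm _.
Proof. by rewrite /box -lock /boxV /boxV_hom; case: cid => V []. Qed.

Lemma boxVK X Y : box X Y ∘ boxV X Y = idm _.
Proof. by rewrite /box -lock /boxV /boxV_hom; case: cid => V []. Qed.

Lemma pb_pair X Y Z (f : gmap Z X) (g : gmap Z Y) :
  pb (gpair f g) ∘ box X Y = amul (efib Z) ∘ (pb f ⊠ pb g).
Proof.
rewrite boxE (whisk2 (ahomM (et_pull (gpair f g)))) -[LHS]compA -tensmM.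
by rewrite -!pb_comp; congr (_ ∘ (_ ⊠ _)); exact: pb_eq.
Qed.

Lemma pb_box X Y Z (h : gmap Z (prodG X Y)) :
  pb h ∘ box X Y = amul (efib Z) ∘ (pb (gcomp (gfst X Y) h) ⊠ pb (gcomp (gsnd X Y) h)).
Proof.
rewrite -pb_pair; congr (_ ∘ _); apply: pb_eq => z /=.
by case: (h z).
Qed.

Lemma pb_gprod X X' Y Y' (f : gmap X' X) (g : gmap Y' Y) :
  pb (gprod f g) ∘ box X Y = box X' Y' ∘ (pb f ⊠ pb g).
Proof. by rewrite pb_pair boxE -compA -tensmM -!pb_comp. Qed.

(** The transpose of [pb_gprod]: [box] is an isomorphism of étale algebras, so its transpose is
    [boxV], and transposition commutes with tensor products. *)
Lemma tr_gprod X X' Y Y' (f : gmap X' X) (g : gmap Y' Y) :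
  tr (gprod f g) ∘ box X' Y' = box X Y ∘ (tr f ⊠ tr g).
Proof.
have trbox Z W : et_transpose (box_hom Z W) = boxV Z W.
  by apply: et_transpose_iso; rewrite box_homE ?boxK ?boxVK.
have e : @comp (et_cat T) _ _ _ (et_pull (gprod f g)) (box_hom X Y) =
    @comp (et_cat T) _ _ _ (box_hom X' Y')
      (tens_hom (et_pull f) (et_pull g) :
        hom (tens_et (efib X) (efib Y)) (tens_et (efib X') (efib Y'))).
  apply: alg_hom_ext.
  by rewrite -[LHS]/(pb (gprod f g) ∘ ahom (box_hom X Y)) box_homE pb_gprod -box_homE.
have := congr1 (@et_transpose _ _ _ _) e.
rewrite !et_transpose_comp tens_transpose !trbox -!trE => e'.
exact/esym/(conj_square (boxVK X Y) (boxK X' Y') (esym e')).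
Qed.

(** Base change along a projection: under [box], [pb (gsnd Z _)] is [x ↦ 1 ⊗ x] and
    [tr (gprod (gid Z) f)] is [id ⊗ f_*], and these act on different factors. *)
Lemma pb_snd_tr X Y Z (f : gmap Y X) :
  pb (gsnd Z X) ∘ tr f = tr (gprod (gid Z) f) ∘ pb (gsnd Z Y).
Proof.
have sndE W : pb (gsnd Z W) = box Z W ∘ ((aone (efib Z) ⊠ idm (efib W : T)) ∘ lunitV (efib W)).
  by rewrite -[RHS]/(box Z W ∘ ahom (tens_inr (efib Z) (efib W))) -box_homE tens_copair_inr.
rewrite !sndE [RHS]compA tr_gprod tr_id -!compA lunitV_nat (whisk2 (tensm_swap _ _)).
by rewrite -!compA.
Qed.

Hypothesis Padd : additive_functor (op_functor Psi).
Hypothesis Pcomp : compatible mu Psi.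

Lemma multD Z (a b : invfun k Z) : mult (a + b) = mult a + mult b.
Proof. by have := mult_lin Padd Pcomp 1 a b; rewrite !scale1r. Qed.

Lemma multZ Z c (a : invfun k Z) : mult (c *: a) = c *: mult a.
Proof.
have m0 : mult (0 : invfun k Z) = 0 by apply: (addrI (mult 0)); rewrite -multD !addr0.
by have := mult_lin Padd Pcomp c a 0; rewrite m0 !addr0.
Qed.

Lemma mult_decomp Z W (h : gmap W Z) (a : invfun k Z) :
  mult (ipull h a) = \sum_(t <- orbreps Z) a t *: mult (ipull h (orb_ind mu t)).
Proof.
have pD (b c : invfun k Z) : mult (ipull h (b + c)) = mult (ipull h b) + mult (ipull h c).
  by rewrite -multD; congr mult; exact: invfun_ext.
have p0 : mult (ipull h 0) = 0 by apply: (addrI (mult (ipull h 0))); rewrite -pD !addr0.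
rewrite {1}(invfun_decomp mu a) (big_morph (fun b => mult (ipull h b)) pD p0).
by apply: eq_bigr => t _; rewrite -multZ; congr mult; exact: invfun_ext.
Qed.

Lemma tr_pb X Y (f : gmap Y X) : tr f ∘ pb f = mult (ipush mu f (icst Y 1)).
Proof. by rewrite -(tr_mult_pb Padd Pcomp) (mult1 Padd Pcomp) comp1m. Qed.

(** By linearity [a] may be taken to be the indicator of an orbit; then [mult a] is [tr ∘ pb] of the
    inclusion, and each of the two maps commutes with [box]. *)
Lemma mult_boxl X Y (a : invfun k X) :
  mult (ipull (gfst X Y) a) ∘ box X Y = box X Y ∘ (mult a ⊠ idm (efib Y : T)).
Proof.
rewrite mult_decomp {2}/mult comp_suml tensm_suml comp_sumr; apply: eq_bigr => t _.
rewrite compZl tensmZl compZr; congr (_ *: _); rewrite /proj_orb tensm_compl compA.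
rewrite -{1}(tr_id Psi Y) -tr_gprod -compA -(pb_id Psi Y) -pb_gprod [RHS]compA tr_pb.
congr (mult _ ∘ _); rewrite /orb_ind.
rewrite (@ipush_base _ _ mu _ _ _ _ _ _ (gfst (orbG t) Y) (gprod (orbG_incl t) (gid Y))) //.
split=> [//|[x y] [x' y'] /= -> [->] //|x [x' y] /= <-].
by exists (x, y).
Qed.

Lemma mult_boxr X Y (b : invfun k Y) :
  mult (ipull (gsnd X Y) b) ∘ box X Y = box X Y ∘ (idm (efib X : T) ⊠ mult b).
Proof.
rewrite mult_decomp {2}/mult comp_suml tensm_sumr comp_sumr; apply: eq_bigr => t _.
rewrite compZl tensmZr compZr; congr (_ *: _); rewrite /proj_orb tensm_compr compA.
rewrite -{1}(tr_id Psi X) -tr_gprod -compA -(pb_id Psi X) -pb_gprod [RHS]compA tr_pb.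
congr (mult _ ∘ _); rewrite /orb_ind.
rewrite (@ipush_base _ _ mu _ _ _ _ _ _ (gsnd X (orbG t)) (gprod (gid X) (orbG_incl t))) //.
split=> [//|[x y] [x' y'] /= -> [->] //|y [x y'] /= <-].
by exists (x, y).
Qed.

Lemma mult_box X Y (a : invfun k X) (b : invfun k Y) :
  mult (imul (ipull (gfst X Y) a) (ipull (gsnd X Y) b)) ∘ box X Y =
  box X Y ∘ (mult a ⊠ mult b).
Proof.
rewrite (multM Padd Pcomp) -compA mult_boxr compA mult_boxl -[LHS]compA.
by rewrite -tensm_splitl.
Qed.

End BackwardTensor.

Lemma amul_tens3 (k : fieldType) (T : tensorCat k) (A : algebra T) (X Y Z : T) (p : hom X A)
    (q : hom Y A) (r : hom Z A) :
  amul A ∘ ((amul A ∘ (p ⊠ q)) ⊠ r) =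
  amul A ∘ ((p ⊠ (amul A ∘ (q ⊠ r))) ∘ assoc X Y Z).
Proof.
have -> : p ⊠ (amul A ∘ (q ⊠ r)) = (idm (A : T) ⊠ amul A) ∘ (p ⊠ (q ⊠ r)).
  by rewrite -tensmM comp1m.
rewrite -!compA -assoc_nat (whisk3 (amulAE A)) -!compA -tensmM comp1m.
by [].
Qed.

(** * The tensor functor attached to [Psi] *)

Section Reconstruction.
Variables (k : fieldType) (G : proOligoGroup) (mu : measure G k) (T : tensorCat k).
Variable Psi : functor (op (S_cat G)) (et_cat T).
Local Notation SG := (sgset G).
Local Notation efib := (efib Psi).
Local Notation pb := (pb Psi).
Local Notation tr := (tr Psi).
Local Notation mult := (mult Psi).
Local Notation box := (box Psi).
Implicit Types X Y Z W : SG.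

Hypothesis Pleft : left_exact (op_functor Psi).
Hypothesis Padd : additive_functor (op_functor Psi).
Hypothesis Pcomp : compatible mu Psi.

(** The matrix [A] is [gfst_* ∘ diag A ∘ gsnd^*] for the projections of [Y × X]. *)
Definition rmap X Y (A : gmatrix k X Y) : hom (efib X : T) (efib Y) :=
  tr (gfst Y X) ∘ (mult A ∘ pb (gsnd Y X)).

Lemma rmap_push X Y Z (j : gmap Z (prodG Y X)) (a : invfun k Z) :
  rmap (ipush mu j a) = tr (gcomp (gfst Y X) j) ∘ (mult a ∘ pb (gcomp (gsnd Y X) j)).
Proof. by rewrite /rmap -(tr_mult_pb Padd Pcomp) tr_comp pb_comp -!compA. Qed.

Lemma rmap_pull X Y (f : gmap Y X) : rmap (pullmx k f) = pb f.
Proof.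
have -> : pullmx k f = ipush mu (gpair (gid Y) f) (icst Y 1).
  by rewrite -rowscale_pull; apply: invfun_ext => t /=; rewrite mul1r.
rewrite rmap_push (mult1 Padd Pcomp) comp1m.
by rewrite (@tr_eq _ _ _ _ _ _ _ (gid Y)) // tr_id comp1m; exact: pb_eq.
Qed.

Lemma rmap1 (X : Perm mu) : rmap (idm X : gmatrix k X X) = idm (efib X : T).
Proof. by rewrite -(pb_id Psi X) -rmap_pull. Qed.

(** In [rmap B ∘ rmap A] the inner pair [pb (gsnd Z Y) ∘ tr (gfst Y X)] is exchanged by base change
    through [Z × Y × X]. The two multiplications then meet there and combine into the integrand of
    the matrix product. *)
Lemma rmapM (X Y Z : SG) (B : gmatrix k Y Z) (A : gmatrix k X Y) :
  rmap (mxcomp mu B A) = rmap B ∘ rmap A.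
Proof.
have e12 : gprod (gid Z) (gfst Y X) = prj12 Z Y X by exact: gmap_ext.
rewrite /mxcomp rmap_push (multM Padd Pcomp) /rmap.
have e := pb_snd_tr Pleft Z (gfst Y X).
have mA := mult_pb Padd Pcomp (prj23 Z Y X) A.
have mB := tr_mult Padd Pcomp (prj12 Z Y X) B.
move: (mult A) (mult B) (mult (ipull _ A)) (mult (ipull _ B)) mA mB => a b a' b' mA mB.
rewrite -!compA (whisk2 e) -!compA e12.
rewrite (whisk2 (esym mB)) -!compA (whisk2 (esym mA)) -!compA.
by rewrite -pb_comp (compA (tr _) (tr _)) -tr_comp.
Qed.

Lemma rmap_lin X Y : linear (@rmap X Y).
Proof.
by move=> c A B; rewrite /rmap (mult_lin Padd Pcomp) compDl compDr compZl compZr.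
Qed.

Definition rfun : functor (Perm mu) T :=
  @Functor (Perm mu) T (fun X : SG => efib X : T) rmap rmap1
    (fun X Y Z B A => @rmapM X Y Z B A).

Lemma point_inv : exists V : hom (efib (ptG G) : T) 𝟙,
  V ∘ aone (efib (ptG G)) = idm 𝟙 /\ aone (efib (ptG G)) ∘ V = idm _.
Proof.
have ptP : @is_product (S_cat G) void (of_void _) (ptG G) (fun i => of_void _ i).
  by move=> M q; exists (gterm M); split=> [[]|u _]; apply: gmap_ext => x; case: (gfun u x).
have prodE := left_exact_product Pleft ptP.
have [V [_ _]] := prodE (unit_et T) (fun i => of_void _ i).
have [w [_ wU]] := prodE (efib (ptG G)) (fun i => of_void _ i).
exists (ahom (V : hom (efib (ptG G)) (unit_et T))); split.
  exact: (ahom1 (V : hom (efib (ptG G)) (unit_et T))).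
have e1 : w = idm (efib (ptG G)) by apply: wU => -[].
have e2 : w = @comp (et_cat T) _ _ _ (unit_init (efib (ptG G)) : hom (unit_et T) _) V.
  by apply: wU => -[].
by have := congr1 (fun v : hom (efib (ptG G)) (efib (ptG G)) => ahom v) (etrans (esym e2) e1).
Qed.

Definition pointV : hom (efib (ptG G) : T) 𝟙 := projT1 (cid point_inv).

Lemma pointK : pointV ∘ aone (efib (ptG G)) = idm 𝟙.
Proof. by rewrite /pointV; case: cid => V []. Qed.

Lemma pointVK : aone (efib (ptG G)) ∘ pointV = idm _.
Proof. by rewrite /pointV; case: cid => V []. Qed.

Lemma rfun_nat X X' Y Y' (A : gmatrix k X X') (B : gmatrix k Y Y') :
  box X' Y' ∘ (rmap A ⊠ rmap B) = rmap (kron A B) ∘ box X Y.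
Proof.
(* The regrouping of coordinates that turns the external product of [A] and [B] into the Kronecker
   product. *)
pose s : gmap (prodG (prodG X' X) (prodG Y' Y)) (prodG (prodG X' Y') (prodG X Y)) :=
  gpair (gprod (gfst _ _) (gfst _ _)) (gprod (gsnd _ _) (gsnd _ _)).
have sinj : injective s by move=> [[? ?] [? ?]] [[? ?] [? ?]] /= [-> -> -> ->].
have -> : kron A B = ipush mu s (imul (ipull (gfst _ _) A) (ipull (gsnd _ _) B)).
  apply: invfun_ext => -[[x' y'] [x y]].
  pose t : prodG (prodG X' X) (prodG Y' Y) := ((x', x), (y', y)).
  by rewrite -[RHS]/(ipush mu s _ (s t)) (ipush_inj _ _ _ sinj).
rewrite rmap_push (@tr_eq _ _ _ _ _ _ _ (gprod (gfst X' X) (gfst Y' Y))) //.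
rewrite (@pb_eq _ _ _ _ _ _ _ (gprod (gsnd X' X) (gsnd Y' Y))) //.
rewrite -!compA pb_gprod (whisk2 (mult_box Pleft Padd Pcomp A B)).
by rewrite /rmap !tensmM -!compA (whisk2 (tr_gprod Pleft _ _)) -!compA.
Qed.

Lemma rfun_assoc X Y Z :
  rmap (mxassoc k X Y Z) ∘ box (prodG X Y) Z ∘ (box X Y ⊠ idm (efib Z : T)) =
  box X (prodG Y Z) ∘ (idm (efib X : T) ⊠ box Y Z) ∘ assoc (efib X : T) (efib Y) (efib Z).
Proof.
rewrite rmap_pull pb_box -[LHS]compA -tensmM compm1 pb_box amul_tens3.
rewrite (boxE Psi X) -[RHS]compA -[RHS]compA (whisk2 (esym (tensmM _ _ _ _))) compm1 pb_box.
by congr (_ ∘ ((_ ⊠ (_ ∘ (_ ⊠ _))) ∘ _)); exact: pb_eq.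
Qed.

Lemma rfun_lunit X :
  rmap (mxlunit k X) ∘ box (ptG G) X ∘ (aone (efib (ptG G)) ⊠ idm (efib X : T)) =
  lunit (efib X : T).
Proof.
rewrite rmap_pull pb_pair -compA -tensmM pb_id comp1m.
by rewrite (ahom1 (et_pull Psi (gterm X))) amul1.
Qed.

Lemma rfun_runit X :
  rmap (mxrunit k X) ∘ box X (ptG G) ∘ (idm (efib X : T) ⊠ aone (efib (ptG G))) =
  runit (efib X : T).
Proof.
rewrite rmap_pull pb_pair -compA -tensmM pb_id comp1m.
by rewrite (ahom1 (et_pull Psi (gterm X))) amul1r.
Qed.

Lemma rfun_braid X Y :
  rmap (mxbraid k X Y) ∘ box X Y = box Y X ∘ braid (efib X : T) (efib Y).
Proof.
rewrite rmap_pull pb_pair boxE -compA -braid_nat compA amulC.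
by [].
Qed.

End Reconstruction.

Section FunctorIsomorphism.
Variables (C D : category) (F F' : functor C D).
Variables (a : forall X, hom (F X) (F' X)) (b : forall X, hom (F' X) (F X)).
Hypothesis ab : forall X, a X ∘ b X = idm (F' X).
Hypothesis ba : forall X, b X ∘ a X = idm (F X).
Hypothesis nat_a : forall X Y (f : hom X Y), a Y ∘ fmap F f = fmap F' f ∘ a X.

Lemma iso_natV X Y (f : hom X Y) : fmap F f ∘ b X = b Y ∘ fmap F' f.
Proof. by apply: esym; apply: (conj_square (ba Y) (ab X)). Qed.

Lemma left_exact_iso : left_exact F -> left_exact F'.
Proof.
move=> lF J Jfin E L p lim M q.
have cP i j (w : hom i j) : fmap (comp_functor F E) w ∘ (b (E i) ∘ q i) = b (E j) ∘ q j.
  by rewrite -(cproj_nat q w) /= (whisk2 (iso_natV _)) -!compA.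
have [u [uP uU]] := lF J Jfin E L p lim M (@Cone J D (comp_functor F E) M _ cP).
exists (a L ∘ u); split=> [j|v vP] /=.
  have := uP j; rewrite /= => e.
  by rewrite (whisk2 (esym (nat_a (p j)))) -compA e (whisk2 (ab _)) comp1m.
rewrite (uU (b L ∘ v)) => [|j] /=; first by rewrite (whisk2 (ab _)) comp1m.
by rewrite (whisk2 (iso_natV _)) -compA; congr (_ ∘ _); exact: vP.
Qed.

Lemma additive_iso : additive_functor F -> additive_functor F'.
Proof.
move=> aF I X S inj cop M q.
have [u [uP uU]] := aF I X S inj cop M (fun i => q i ∘ a (X i)).
exists (u ∘ b S); split=> [i|v vP].
  by rewrite -compA -iso_natV compA uP -compA ab compm1.
rewrite (uU (v ∘ a S)) => [|i]; first by rewrite -compA ab compm1.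
by rewrite -compA nat_a compA vP.
Qed.

End FunctorIsomorphism.

Lemma nt_comp_id (C D : category) (F F' : functor C D) (a : nat_trans F F') (b : nat_trans F' F) :
  nt_comp b a = nt_id F -> forall X, b X ∘ a X = idm (F X).
Proof. by move=> e X; exact: (congr1 (fun c : nat_trans F F => ntc c X) e). Qed.

Lemma isom_cat_iso (C : category) (X Y : isom_cat C) (f : hom X Y) : is_iso f.
Proof.
have [g [gf fg]] := ihomP f.
have gI : is_iso g by exists (ihom f).
by exists (IsoHom gI); split; apply: iso_hom_ext.
Qed.

(** * Fully faithful and essentially surjective functors are equivalences *)

Section Equivalence.
Variables (C D : category) (F : functor C D).
Hypothesis ffF : fully_faithful F.
Hypothesis esF : forall Y : D, exists X : C, isomorphic (F X) Y.

Lemma ff_lift X Y (h : hom (F X) (F Y)) : exists f : hom X Y, fmap F f = h.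
Proof. by have [g _ gK] := ffF X Y; exists (g h). Qed.

Definition fpre X Y (h : hom (F X) (F Y)) : hom X Y := projT1 (cid (ff_lift h)).

Lemma fpreK X Y (h : hom (F X) (F Y)) : fmap F (fpre h) = h.
Proof. by rewrite /fpre; case: cid. Qed.

Lemma ff_inj X Y (f g : hom X Y) : fmap F f = fmap F g -> f = g.
Proof. exact: (bij_inj (ffF X Y)). Qed.

Lemma ess_iso : exists (Q : D -> C) (e : forall Y, hom (F (Q Y)) Y) (e' : forall Y, hom Y (F (Q Y))),
  (forall Y, e Y ∘ e' Y = idm Y) /\ (forall Y, e' Y ∘ e Y = idm (F (Q Y))).
Proof.
pose Q Y := projT1 (cid (esF Y)).
have eP Y : {e : hom (F (Q Y)) Y & {e' | e' ∘ e = idm (F (Q Y)) /\ e ∘ e' = idm Y}}.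
  rewrite /Q; case: cid => X /= iXY; have [e eI] := cid iXY; have [e' e'P] := cid eI.
  by exists e, e'.
exists Q, (fun Y => projT1 (eP Y)), (fun Y => sval (projT2 (eP Y))).
by split=> Y; case: (eP Y) => e [e' []].
Qed.

Lemma ff_ess_equivalence : is_equivalence F.
Proof.
have [Q [e [e' [ee' e'e]]]] := ess_iso.
pose Qm X Y (f : hom X Y) : hom (Q X) (Q Y) := fpre (e' Y ∘ (f ∘ e X)).
have Q1 X : Qm X X (idm X) = idm (Q X) by apply: ff_inj; rewrite fpreK comp1m e'e fmap1.
have QM X Y Z (g : hom Y Z) (f : hom X Y) : Qm X Z (g ∘ f) = Qm Y Z g ∘ Qm X Y f.
  by apply: ff_inj; rewrite fmapM !fpreK -!compA (whisk2 (ee' Y)) comp1m.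
pose QF : functor D C := Functor Q1 QM.
have n1P X Y (f : hom X Y) : fpre (e (F Y)) ∘ fmap (comp_functor QF F) f = f ∘ fpre (e (F X)).
  by apply: ff_inj; rewrite !fmapM /= !fpreK (whisk2 (ee' _)) comp1m.
have n2P X Y (f : hom X Y) : e Y ∘ fmap (comp_functor F QF) f = f ∘ e X.
  by rewrite /= fpreK (whisk2 (ee' _)) comp1m.
exists QF; split.
- exists (@NatTrans C C (comp_functor QF F) (id_functor C) (fun X => fpre (e (F X))) n1P).
  apply: nat_trans_iso => X; exists (fpre (e' (F X))).
  by split; apply: ff_inj; rewrite fmapM !fpreK fmap1 ?ee' ?e'e.
- exists (@NatTrans D D (comp_functor F QF) (id_functor D) e n2P).
  by apply: nat_trans_iso => X; exists (e' X); split; [exact: e'e | exact: ee'].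
Qed.

End Equivalence.

(** * The essential image *)

Section EssentialImage.
Variables (k : fieldType) (G : proOligoGroup) (mu : measure G k) (T : tensorCat k).

Lemma psi_admissible (Phi : tensor_functor (Perm mu) T) : admissible mu (psi Phi).
Proof. by split; [exact: psi_left_exact | exact: psi_additive | exact: psi_compatible]. Qed.

Lemma admissible_iso (F F' : functor (op (S_cat G)) (et_cat T)) :
  @isomorphic (functor_cat (op (S_cat G)) (et_cat T)) F F' -> admissible mu F -> admissible mu F'.
Proof.
move=> [a [b [ba ab]]] [lF aF cF].
have baE := nt_comp_id ba; have abE := nt_comp_id ab.
(* Passing to opposite categories reverses arrows, so the components of [b] are the ones that run
   from [op_functor F] to [op_functor F']. *)
have nb (X Y : S_cat G) (f : hom X Y) :
    @comp (op (et_cat T)) _ _ _ (ntc b Y) (fmap (op_functor F) f) =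
    @comp (op (et_cat T)) _ _ _ (fmap (op_functor F') f) (ntc b X).
  exact/esym/(ntP b (f : @hom (op (S_cat G)) Y X)).
split.
- exact: (@left_exact_iso _ _ (op_functor F) (op_functor F') (ntc b) (ntc a) abE baE nb).
- exact: (@additive_iso _ _ (op_functor F) (op_functor F') (ntc b) (ntc a) abE baE nb).
- apply/compatibleP => X Y f tX; move/compatibleP: cF => /(_ X Y f tX).
  rewrite /gamma_tilde => cF.
  pose aX : hom (F X) (F' X) := ntc a X; pose aY : hom (F Y) (F' Y) := ntc a Y.
  pose bX : hom (F' X) (F X) := ntc b X; pose bY : hom (F' Y) (F Y) := ntc b Y.
  have abh Z : ahom (ntc a Z) ∘ ahom (ntc b Z) = idm _ by exact: (congr1 (@ahom _ _ _ _) (abE Z)).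
  have bah Z : ahom (ntc b Z) ∘ ahom (ntc a Z) = idm _ by exact: (congr1 (@ahom _ _ _ _) (baE Z)).
  have e : @comp (et_cat T) _ _ _ (fmap F' f) aX = @comp (et_cat T) _ _ _ aY (fmap F f).
    exact/esym/(ntP a (f : @hom (op (S_cat G)) X Y)).
  have := congr1 (@et_transpose _ _ _ _) e; rewrite !et_transpose_comp.
  rewrite (@et_transpose_iso _ _ _ _ aX (ahom bX) (abh X) (bah X)).
  rewrite (@et_transpose_iso _ _ _ _ aY (ahom bY) (abh Y) (bah Y)) => e'.
  (* The transpose for [F'] is the conjugate of the one for [F], because [aX] and [aY] transpose to
     their inverses. As algebra maps preserve [1], [gamma_tilde] is transported with the same
     scalar. *)
  have tE : et_transpose (fmap F' f) = ahom aX ∘ (et_transpose (fmap F f) ∘ ahom bY).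
    by rewrite -e' compA abh comp1m.
  rewrite [LHS](congr1 (fun t => t ∘ _) tE) -[LHS]compA -[_ ∘ aone (F' Y)]compA (ahom1 bY).
  by rewrite cF compZr (ahom1 aX).
Qed.

Section Reconstruct.
Variable Psi : functor (op (S_cat G)) (et_cat T).
Hypothesis Pleft : left_exact (op_functor Psi).
Hypothesis Padd : additive_functor (op_functor Psi).
Hypothesis Pcomp : compatible mu Psi.

Definition reconstruct : tensor_functor (Perm mu) T :=
  @TensorFunctor k (Perm mu) T (rfun Pleft Padd Pcomp) (rmap_lin Padd Pcomp)
    (box Psi) (boxV Pleft) (aone (efib Psi (ptG G))) (pointV Pleft)
    (boxK Pleft) (boxVK Pleft) (pointK Pleft) (pointVK Pleft)
    (fun X X' Y Y' A B => rfun_nat Pleft Padd Pcomp A B)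
    (rfun_assoc Padd Pcomp) (rfun_lunit Padd Pcomp) (rfun_runit Padd Pcomp)
    (rfun_braid Padd Pcomp).

(** The underlying objects agree on the nose, but the multiplication of the reconstructed algebra is
    given by [rmap] and [box], so the identity still has to be shown to be an algebra map. *)
Lemma reconstructM (X : sgset G) : idm (efib Psi X : T) ∘ amul (psi_ob reconstruct X) =
  amul (efib Psi X) ∘ (idm (efib Psi X : T) ⊠ idm (efib Psi X : T)).
Proof.
rewrite comp1m -[amul _]/(rmap Psi (pullmx k (gdiag X)) ∘ box Psi X X).
by rewrite (rmap_pull Padd Pcomp) pb_pair pb_id.
Qed.

Lemma reconstruct1 (X : sgset G) :
  idm (efib Psi X : T) ∘ aone (psi_ob reconstruct X) = aone (efib Psi X).
Proof.
rewrite comp1m -[LHS]/(rmap Psi (pullmx k (gterm X)) ∘ aone (efib Psi (ptG G))).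
rewrite (rmap_pull Padd Pcomp); exact: (ahom1 (et_pull Psi (gterm X))).
Qed.

Definition reconstruct_hom (X : sgset G) : hom (psi_ob reconstruct X) (efib Psi X) :=
  @AlgHom k T (psi_ob reconstruct X) (efib Psi X) _ (reconstructM X) (reconstruct1 X).

Lemma reconstruct_nat (X Y : op (S_cat G)) (f : hom X Y) :
  reconstruct_hom Y ∘ fmap (psi reconstruct) f = fmap Psi f ∘ reconstruct_hom X.
Proof.
apply: alg_hom_ext; rewrite /= comp1m compm1.
exact: (rmap_pull Padd Pcomp).
Qed.

Lemma reconstruct_iso :
  @is_iso (functor_cat (op (S_cat G)) (et_cat T)) (psi reconstruct) Psi
    (@NatTrans _ _ (psi reconstruct) Psi reconstruct_hom reconstruct_nat).
Proof.
apply: nat_trans_iso => X; apply: (@alg_hom_iso k T).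
by exists (idm (efib Psi X : T)); rewrite /= comp1m.
Qed.

Lemma admissible_essential_image : essential_image (psi_functor mu T) Psi.
Proof.
exists reconstruct; exists (IsoHom reconstruct_iso); exact: isom_cat_iso.
Qed.

End Reconstruct.

End EssentialImage.

Theorem theorem1 (k : fieldType) (G : proOligoGroup) (mu : measure G k)
    (T : tensorCat k) (hT : karoubian T) :
  [/\ fully_faithful (psi_functor mu T),
      forall Psi : functor (op (S_cat G)) (et_cat T),
        essential_image (psi_functor mu T) Psi <->
        [/\ left_exact (op_functor Psi), additive_functor (op_functor Psi) &
            compatible mu Psi] &
      exists H : forall Phi : tensor_functor (Perm mu) T, admissible mu (psi Phi),
        is_equivalence (corestrict (F := psi_functor mu T) H)].
Proof.
have ff := @psi_fully_faithful k G mu T.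
split=> //; first split.
- move=> [Phi [f _]]; apply: (@admissible_iso k G mu T (psi Phi)); last exact: psi_admissible.
  by exists (ihom f); exact: ihomP.
- by move=> [lP aP cP]; exact: admissible_essential_image.
- exists (@psi_admissible k G mu T); apply: ff_ess_equivalence => [Phi Phi'|[Psi [lP aP cP]]].
    exact: ff.
  have [Phi iso] := admissible_essential_image lP aP cP.
  by exists Phi.
Qed.
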